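(* Let $A$ be a C$^*$-algebra, or the group algebra $L^1(G)$ of a locally compact group $G$. Then $A$ has the strong property $(\mathbb{B})$ with a constant given by $288\pi(1+\sqrt{2})$.
   Context: A Banach algebra $A$ has the strong property $(\mathbb{B})$ with a constant $r>0$ if for each Banach space $X$ and every bounded bilinear map $\varphi:A\times A\to X$, $$\|\varphi(ab,c)-\varphi(a,bc)\|\leq r\,\alpha(\varphi)\,\|a\|\|b\|\|c\|\qquad(a,b,c\in A),$$ where $\alpha(\varphi)=\sup\{\|\varphi(a,b)\| : a,b\in A,\ \|a\|,\|b\|\leq 1,\ ab=0\}$. $L^1(G)$ is the group algebra with convolution product and the $L^1$-norm with respect to a left Haar measure. *)

(* Defs.v *)
From HB Require Import structures.
From mathcomp Require Import all_boot all_order all_algebra.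
From mathcomp Require Import sesquilinear ring_quotient generic_quotient.
From mathcomp Require Import complex.
From mathcomp Require Import all_classical all_reals all_analysis.
From mathcomp Require Import measurable_realfun.

Set Implicit Arguments.
Unset Strict Implicit.
Unset Printing Implicit Defensive.

Import Order.TTheory GRing.Theory Num.Theory.
Import numFieldNormedType.Exports.

Local Open Scope classical_set_scope.
Local Open Scope complex_scope.
Local Open Scope ring_scope.

(* Complex scalars are [R[i]] for [R : realType]; the norm of a normed module
   over [R[i]] takes its values in the nonnegative reals of [R[i]].           *)

Section strong_property_B.
(* The algebras here need not be unital, so the product is an explicit map
   rather than the multiplication of a ring structure.                        *)
Context {R : realType} (A : normedModType R[i]) (mul : A -> A -> A).

Definition bounded_bilinear (X : normedModType R[i])
    (phi : {bilinear A -> A -> X}) : Prop :=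
  exists M : R, forall a b : A, `|phi a b| <= M%:C * `|a| * `|b|.

(* For bounded [phi] this is a supremum of a bounded set containing 0, as
   required for [sup] to be the least upper bound.                            *)
Definition alphaB (X : normedModType R[i]) (phi : A -> A -> X) : R :=
  sup [set t : R | exists a b : A,
    [/\ `|a| <= 1, `|b| <= 1, mul a b = 0 & t%:C = `|phi a b|]].

Definition strong_property_B (r : R) : Prop :=
  0 < r /\
  forall (X : completeNormedModType R[i]) (phi : {bilinear A -> A -> X}),
    bounded_bilinear phi ->
    forall a b c : A,
      `|phi (mul a b) c - phi a (mul b c)|
        <= (r * alphaB phi)%:C * `|a| * `|b| * `|c|.

End strong_property_B.

Record is_banach_algebra (R : realType) (A : completeNormedModType R[i])
    (mul : {bilinear A -> A -> A}) : Prop := {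
  banach_mulA : forall a b c, mul a (mul b c) = mul (mul a b) c ;
  banach_normM : forall a b, `|mul a b| <= `|a| * `|b| }.

Record is_cstar_algebra (R : realType) (A : completeNormedModType R[i])
    (mul : {bilinear A -> A -> A}) (star : A -> A) : Prop := {
  cstar_banach : is_banach_algebra mul ;
  cstarD : forall a b, star (a + b) = star a + star b ;
  cstarZ : forall (k : R[i]) a, star (k *: a) = k^* *: star a ;
  cstarM : forall a b, star (mul a b) = mul (star b) (star a) ;
  cstarK : involutive star ;
  cstar_norm : forall a, `|mul (star a) a| = `|a| ^+ 2 }.

HB.mixin Record isTopologicalGroup G & Topological G & Group G := {
  mulg_continuous : continuous (fun p : G * G => (p.1 * p.2)%g) ;
  invg_continuous : continuous (fun x : G => (x^-1)%g) }.

(* The base point comes only from the requirement of the library that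
   measurable types be pointed; it need not be the unit and plays no role.    *)
#[short(type="topologicalGroupType")]
HB.structure Definition TopologicalGroup :=
  {G of PointedTopological G & Group G & isTopologicalGroup G}.

Section cabs.
Context {R : realType}.
Implicit Types z w : R[i].

Definition cabs z : R := complex.Re `|z|.

Lemma cabsE z : (cabs z)%:C = `|z|.
Proof. by case: z. Qed.

Lemma cabs_ge0 z : 0 <= cabs z.
Proof. by rewrite -lecR cabsE; exact: normr_ge0. Qed.

Lemma cabsD z w : cabs (z + w) <= cabs z + cabs w.
Proof. by rewrite -lecR rmorphD /= !cabsE ler_normD. Qed.

Lemma cabsM z w : cabs (z * w) = cabs z * cabs w.
Proof. by apply: complexI; rewrite rmorphM /= !cabsE normrM. Qed.

Lemma cabs_eq0 z : cabs z = 0 -> z = 0.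
Proof. by move=> z0; apply/eqP; rewrite -normr_eq0 -cabsE z0. Qed.

End cabs.

Section L1.
Context {d : measure_display} {T : measurableType d} {R : realType}
  (mu : {measure set T -> \bar R}).

Definition cintegrable : {pred T -> R[i]} := fun f =>
  mu.-integrable setT (EFin \o (@complex.Re R \o f)) &&
  mu.-integrable setT (EFin \o (@complex.Im R \o f)).

Definition cintegral (f : T -> R[i]) : R[i] :=
  (\int[mu]_x complex.Re (f x)) +i* (\int[mu]_x complex.Im (f x)).

Lemma cintegrable_submod_closed : submod_closed cintegrable.
Proof.
split; first by rewrite unfold_in; apply/andP; split; exact: integrable0.
move=> a f g /andP[fR fI] /andP[gR gI]; apply/andP; split.
- have -> : EFin \o (@complex.Re R \o (a *: f + g)) =
      ((fun x => (complex.Re a)%:E * (EFin \o (@complex.Re R \o f)) x) \+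
       ((fun x => (- complex.Im a)%:E * (EFin \o (@complex.Im R \o f)) x) \+
        (EFin \o (@complex.Re R \o g))))%E.
    apply/funext => x /=; rewrite -!EFinM -!EFinD; congr EFin.
    change ((a *: f + g) x) with (a * f x + g x).
    by case: a (f x) (g x) => [a b] [c e] [k l] /=; rewrite mulNr addrA.
  by do 2?[apply: integrableD => //]; exact: integrableZl.
- have -> : EFin \o (@complex.Im R \o (a *: f + g)) =
      ((fun x => (complex.Re a)%:E * (EFin \o (@complex.Im R \o f)) x) \+
       ((fun x => (complex.Im a)%:E * (EFin \o (@complex.Re R \o f)) x) \+
        (EFin \o (@complex.Im R \o g))))%E.
    apply/funext => x /=; rewrite -!EFinM -!EFinD; congr EFin.
    change ((a *: f + g) x) with (a * f x + g x).
    by case: a (f x) (g x) => [a b] [c e] [k l] /=; rewrite addrA.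
  by do 2?[apply: integrableD => //]; exact: integrableZl.
Qed.

HB.instance Definition _ :=
  GRing.isSubmodClosed.Build R[i] (T -> R[i]) cintegrable
    cintegrable_submod_closed.

Lemma integrable_cabs (f : T -> R[i]) : f \in cintegrable ->
  mu.-integrable setT (EFin \o (cabs \o f)).
Proof.
move=> /andP[fR fI].
have mR : measurable_fun setT (@complex.Re R \o f).
  by apply/measurable_EFinP; exact: measurable_int fR.
have mI : measurable_fun setT (@complex.Im R \o f).
  by apply/measurable_EFinP; exact: measurable_int fI.
apply: (@le_integrable _ _ _ mu _ measurableT _
  ((abse \o (EFin \o (@complex.Re R \o f))) \+
   (abse \o (EFin \o (@complex.Im R \o f))))%E).
- apply/measurable_EFinP.
  have -> : cabs \o f = (@Num.sqrt R) \o
      (fun x => complex.Re (f x) ^+ 2 + complex.Im (f x) ^+ 2).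
    by apply/funext => x; rewrite /= /cabs; case: (f x).
  apply: measurableT_comp.
    by apply: continuous_measurable_fun; exact: sqrt_continuous.
  by apply: measurable_funD; exact: measurable_funX.
- move=> x _.
  change (`|(cabs (f x))%:E| <=
    `|(`|complex.Re (f x)|%R + `|complex.Im (f x)|%R)%:E|)%E.
  rewrite !abse_EFin lee_fin.
  rewrite ger0_norm ?cabs_ge0// ger0_norm ?addr_ge0//.
  have {1}-> : f x = (complex.Re (f x))%:C + 'i%C * (complex.Im (f x))%:C.
    exact: complexE.
  apply: le_trans (cabsD _ _) _; rewrite cabsM.
  have cabsR r : cabs (r%:C) = `|r|.
    by rewrite /cabs /= expr0n /= addr0 sqrtr_sqr.
  by rewrite !cabsR /cabs /= expr0n /= add0r expr1n sqrtr1 mul1r.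
- by apply: integrableD => //; exact: integrable_abse.
Qed.

(* Integrable representatives; [L1] below is their quotient by a.e. equality. *)
Definition L1fun : Type := {f : T -> R[i] | f \in cintegrable}.
HB.instance Definition _ := [isSub of L1fun for @sval _ _].
HB.instance Definition _ := [Choice of L1fun by <:].
HB.instance Definition _ := [SubChoice_isSubLmodule of L1fun by <:].

Definition ae_null : {pred L1fun} := fun f =>
  `[< {ae mu, forall x, val f x = 0} >].

Lemma ae_null_submod_closed : submod_closed ae_null.
Proof.
split; first by apply/asboolP; exact: aeW.
move=> a f g /asboolP f0 /asboolP g0; apply/asboolP.
apply: filterS2 f0 g0 => x fx gx.
have -> : val (a *: f + g) x = a * val f x + val g x by rewrite linearP.
by rewrite fx gx mulr0 addr0.
Qed.

HB.instance Definition _ :=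
  GRing.isSubmodClosed.Build R[i] L1fun ae_null ae_null_submod_closed.

Definition L1 : Type := Quotient.quot ae_null.
HB.instance Definition _ := EqQuotient.on L1.
HB.instance Definition _ := GRing.Zmodule.on L1.

Local Open Scope quotient_scope.

Definition L1repr (u : L1) : T -> R[i] := val (repr u).

(* Junk value: the zero class when [f] is not integrable. *)
Definition L1class (f : T -> R[i]) : L1 := \pi_L1 (insubd (0 : L1fun) f).

Lemma pi_L1_eqP (f g : L1fun) :
  \pi_L1 f = \pi_L1 g <-> {ae mu, forall x, val f x = val g x}.
Proof.
have E : (\pi_L1 f == \pi_L1 g) = (f - g \in ae_null).
  by rewrite Quotient.idealrBE.
have D x : val (f - g) x = val f x - val g x by rewrite linearB.
split=> [/eqP|fg]; [|apply/eqP]; rewrite E.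
  move=> /asboolP; apply: filterS => x; rewrite D => /eqP.
  by rewrite subr_eq0 => /eqP.
by apply/asboolP; apply: filterS fg => x; rewrite D => ->; rewrite subrr.
Qed.

Lemma L1repr_pi (f : L1fun) :
  {ae mu, forall x, L1repr (\pi_L1 f) x = val f x}.
Proof. by apply/pi_L1_eqP; rewrite reprK. Qed.

Lemma L1repr_class (f : T -> R[i]) : f \in cintegrable ->
  {ae mu, forall x, L1repr (L1class f) x = f x}.
Proof.
move=> fi; apply: filterS (L1repr_pi (insubd (0 : L1fun) f)) => x ->.
by rewrite val_insubd fi.
Qed.

Lemma L1reprD (u v : L1) :
  {ae mu, forall x, L1repr (u + v) x = L1repr u x + L1repr v x}.
Proof.
have uv : \pi_L1 (repr u + repr v) = u + v by rewrite raddfD /= !reprK.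
apply: filterS (L1repr_pi (repr u + repr v)) => x.
by rewrite uv => ->; rewrite linearD.
Qed.

Definition L1scale (a : R[i]) (u : L1) : L1 := \pi_L1 (a *: repr u).

Lemma L1repr_scale a (u : L1) :
  {ae mu, forall x, L1repr (L1scale a u) x = a * L1repr u x}.
Proof.
by apply: filterS (L1repr_pi (a *: repr u)) => x ->; rewrite linearZ_LR.
Qed.

Lemma L1_eqP (u v : L1) : {ae mu, forall x, L1repr u x = L1repr v x} -> u = v.
Proof. by move=> uv; rewrite -[u]reprK -[v]reprK; apply/pi_L1_eqP. Qed.

Lemma L1scaleA a b u : L1scale a (L1scale b u) = L1scale (a * b) u.
Proof.
apply: L1_eqP; have := L1repr_scale a (L1scale b u).
apply: filterS3 (L1repr_scale b u) (L1repr_scale (a * b) u) => x.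
by move=> -> -> ->; rewrite mulrA.
Qed.

Lemma L1scale1 : left_id 1 L1scale.
Proof.
move=> u; apply: L1_eqP; apply: filterS (L1repr_scale 1 u) => x ->.
by rewrite mul1r.
Qed.

Lemma L1scaleDr : right_distributive L1scale +%R.
Proof.
move=> a u v; apply: L1_eqP.
apply: filterS3 (filterI (L1repr_scale a u) (L1repr_scale a v))
  (filterI (L1repr_scale a (u + v)) (L1reprD u v))
  (L1reprD (L1scale a u) (L1scale a v)).
by move=> x [au av] [auv uv] auav; rewrite auv uv auav au av mulrDr.
Qed.

Lemma L1scaleDl u : {morph L1scale^~ u : a b / a + b}.
Proof.
move=> a b; apply: L1_eqP.
apply: filterS3 (L1repr_scale (a + b) u)
  (filterI (L1repr_scale a u) (L1repr_scale b u))
  (L1reprD (L1scale a u) (L1scale b u)).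
by move=> x abu [au bu] aubu; rewrite abu aubu au bu mulrDl.
Qed.

HB.instance Definition _ := GRing.Zmodule_isLmodule.Build R[i] L1
  L1scaleA L1scale1 L1scaleDr L1scaleDl.

Definition L1norm (u : L1) : R[i] := (\int[mu]_x cabs (L1repr u x))%:C.

Lemma integrable_L1repr (u : L1) :
  mu.-integrable setT (EFin \o (cabs \o L1repr u)).
Proof. by apply: integrable_cabs; exact: (valP (repr u)). Qed.

Lemma le_L1norm (u : L1) (g : T -> R) : (forall x, 0 <= g x) ->
    mu.-integrable setT (EFin \o g) ->
    {ae mu, forall x, cabs (L1repr u x) <= g x} ->
  L1norm u <= (\int[mu]_x g x)%:C.
Proof.
move=> g0 gi ug; rewrite /L1norm lecR; apply: fine_le.
- exact: integrable_fin_num (integrable_L1repr u).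
- exact: integrable_fin_num gi.
apply: ae_ge0_le_integral => //.
- by move=> x _; rewrite lee_fin cabs_ge0.
- exact: measurable_int (integrable_L1repr u).
- by move=> x _; rewrite lee_fin.
- exact: measurable_int gi.
- by apply: filterS ug => x; rewrite lee_fin.
Qed.

Lemma L1normD u v : L1norm (u + v) <= L1norm u + L1norm v.
Proof.
have ui := integrable_L1repr u; have vi := integrable_L1repr v.
rewrite /L1norm -rmorphD /= -RintegralD//; apply: le_L1norm.
  by move=> x; rewrite addr_ge0 ?cabs_ge0.
  by rewrite (_ : _ \o _ = (EFin \o (cabs \o L1repr u)) \+
    (EFin \o (cabs \o L1repr v)))%E//; exact: integrableD.
by apply: filterS (L1reprD u v) => x ->; exact: cabsD.
Qed.

Lemma L1normZ (a : R[i]) u : L1norm (a *: u) = `|a| * L1norm u.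
Proof.
have ui := integrable_L1repr u; have aui := integrable_L1repr (a *: u).
rewrite /L1norm -cabsE -rmorphM /= -RintegralZl//; congr (_%:C); congr fine.
apply: ae_eq_integral => //.
- exact: measurable_int aui.
- by apply: measurable_int (integrableZl measurableT (cabs a) ui).
- by apply: filterS (L1repr_scale a u) => x + _; rewrite /= -cabsM => <-.
Qed.

Lemma L1norm_eq0 u : L1norm u = 0 -> u = 0.
Proof.
have ui := integrable_L1repr u => /complexI u0.
have /ae_eq_integral_abs : (\int[mu]_x `|(cabs (L1repr u x))%:E| = 0)%E.
  under eq_integral do rewrite gee0_abs ?lee_fin ?cabs_ge0//.
  by rewrite -[LHS]fineK ?(integrable_fin_num _ ui)// -/(Rintegral _ _ _) u0.
move=> /(_ measurableT (measurable_int _ ui)) u0'.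
rewrite -[u]reprK -(raddf0 \pi_L1); apply/pi_L1_eqP.
by apply: filterS u0' => x /(_ I) [/cabs_eq0 ux]; rewrite linear0.
Qed.

HB.instance Definition _ := Lmodule_isNormed.Build R[i] L1
  L1normD L1normZ L1norm_eq0.
End L1.

Notation borel G := (g_sigma_algebraType (@open G)).

Section group_algebra.
Context {R : realType} {G : topologicalGroupType}.

(* A nonzero left-invariant Radon measure on the Borel sets. *)
Record is_left_haar_measure (mu : {measure set (borel G) -> \bar R}) : Prop := {
  haar_left_invariant : forall (x : G) (A : set (borel G)), measurable A ->
    mu [set (x * y)%g | y in A] = mu A ;
  haar_neq0 : mu setT != 0%E ;
  haar_compact : forall K : set G, compact K -> (mu K < +oo)%E ;
  haar_outer_regular : forall A : set (borel G), measurable A ->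
    mu A = ereal_inf [set mu U | U in [set U : set G | open U /\ A `<=` U]] ;
  haar_inner_regular : forall U : set G, open U ->
    mu U = ereal_sup [set mu K | K in [set K : set G | compact K /\ K `<=` U]] }.

Context (mu : {measure set (borel G) -> \bar R}).

Definition convolution (f g : G -> R[i]) (x : G) : R[i] :=
  cintegral mu (fun y : borel G => f y * g ((y : G)^-1 * x)%g).

(* For a left Haar measure on a locally compact group, the convolution of two
   integrable functions is integrable and its class does not depend on the
   representatives, so neither the junk value of [L1class] nor the choice made
   by [L1repr] matters.                                                       *)
Definition L1conv (u v : L1 mu) : L1 mu :=
  L1class mu (convolution (L1repr u) (L1repr v)).

End group_algebra.

(* Main.v *)
Require Import Defs.
From HB Require Import structures.
From mathcomp Require Import all_boot all_order all_algebra finmap.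
From mathcomp Require Import sesquilinear complex cyclic separable cyclotomic ring lra zify.
From mathcomp Require Import all_classical all_reals all_analysis.
From mathcomp Require Import measurable_realfun.

Set Implicit Arguments.
Unset Strict Implicit.
Unset Printing Implicit Defensive.

Import Order.TTheory GRing.Theory Num.Theory.
Import numFieldNormedType.Exports.

Local Open Scope classical_set_scope.
Local Open Scope complex_scope.
Local Open Scope ring_scope.

(** Call a quadruple (R, R', L, L') of linear contractions of A with R' = R^-1,
L' = L^-1 and (R a) c = a (L c) a unitary double multiplier U.  The heart of the
proof is the estimate [multiplier_estimate]: for bounded bilinear phi,

  |phi(R a, c) - phi(a, L c)| <= 144 alpha(phi) |a| |c|.

If b is an average of such U (in the sense that a b and b c are the same averages
of R a and L c) this bounds |phi(ab, c) - phi(a, bc)|, and in both kinds of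
algebras there are enough unitary double multipliers.

The multiplier estimate.  For |z| = 1 consider the multiplier zU and its real and
imaginary parts C = (zU + z^-1 U^-1)/2 and S = (zU - z^-1 U^-1)/(2i), so that
C^2 + S^2 = 1.  The iteration Y_(n+1) = (C^2 + Y_n^2)/2, Y_0 = 0, converges at rate
O(1/n) to Y with H = 1 - Y satisfying H^2 = 1 - C^2 = S^2 ([sqrt_exists]).
Then (H + S)(H - S) = 0, so that the products of (H + S) a and (H - S) c and of
(H - S) a and (H + S) c vanish, and hence phi(H a, H c) - phi(S a, S c) is at most
9 alpha |a| |c| ([product_estimate]).
Now average over z in the N-th roots of unity, N large.  As Y_n is a Laurent
polynomial in zU, the average of phi((1 - Y_n) a, (1 - Y_n) c) only keeps the terms
phi(U^m a, U^-m c).  Put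

  D_U(a, c) = phi(a, c) - (phi(U a, U^-1 c) + phi(U^-1 a, U c)) / 2.

The average of phi(S a, S c) gives (phi(a, c) - D_U(a, c))/2, while the other one
gives phi(a, c)/2, up to O(1/n), minus a combination of terms D_(U^m)(a, c).  Its
coefficients are nonnegative, since those of Y_n are, and their sum is the mean
value of |Y_n|^2 <= cos^4, that is at most 3/8.  If K is the supremum of
|D_U(a, c)| over all U and all unit vectors, then K/2 <= 9 alpha + 3K/8, so
K <= 72 alpha ([symdiff_le]).  Finally
phi(U a, c) - phi(a, U c) = (phi(U^2 a, c') - phi(a, U^2 c'))/2 + D_U(U a, c) with
c' = U^-1 c, and the same kind of argument gives 144 alpha.

C*-algebras.  If b is self-adjoint with |b| <= 1, the square root h of 1 - b^2
exists as a double multiplier by the same iteration, b + ih is a unitary double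
multiplier by the C*-identity, and b is the average of b + ih and b - ih.
Splitting b into its real and imaginary parts gives the constant 288.

Group algebras.  Let D be the modular function.  The maps
R_t a(x) = D(t) a(x t^-1) and L_t c(x) = c(t^-1 x) form a unitary double multiplier
of L^1(G), and a * b and b * c are the averages of R_t a and of L_t c with the
weight b(t) dt.  For continuous a, b, c with compact support, both integrals are
norm limits of Riemann sums over the same points t ([simultaneous_averages]).
The general case follows by density, one argument at a time, and by splitting
three functions into real and imaginary parts, with constant 8 * 144 = 1152.
Both 288 and 1152 are at most 288 pi (1 + sqrt 2).

Most of the work for groups is the integration theory on G, which need not be
sigma-finite: Fubini's theorem is proved for continuous functions with compact
support by step approximation, and integrable functions are dominated almost
everywhere by series of such functions ([Cc_domination]), which gives Tonelli's
inequality for convolutions ([conv_tonelli]). *)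

(** * Real-valued norms and square roots by iteration *)

(** Equalities between signed sums in an abelian group: both sides are gathered
    on the left, and opposite terms are brought next to each other. *)
Ltac zmod_identity := apply/eqP; rewrite -subr_eq0;
  match goal with |- is_true (?a == _) => rewrite -[a]add0r end;
  rewrite ?(opprD, opprB, opprK, oppr0, addr0, subr0, addrA);
  repeat match goal with |- context [ - ?x ] =>
    (repeat progress rewrite (addrAC _ x));
    (repeat progress rewrite (addrAC _ (- x))); rewrite addrK end;
  by rewrite ?addr0 ?add0r eqxx.

Section real_norm.
Context {R : realType} {E : normedModType R[i]}.
Implicit Types (x y : E) (z : R[i]).

(** The norm of a normed module over R[i] is a complex number; inequalities are
    easier in R. *)
Definition nrm x : R := complex.Re `|x|.

Lemma nrmE x : (nrm x)%:C = `|x|.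
Proof.
rewrite /nrm; case: `|x| (normr_ge0 x) => a b.
by rewrite lecE /= => /andP[/eqP -> _].
Qed.

Lemma nrm_ge0 x : 0 <= nrm x.
Proof. by rewrite -lecR nrmE normr_ge0. Qed.

Lemma nrm0 : nrm 0 = 0.
Proof. by rewrite /nrm normr0. Qed.

Lemma nrmN x : nrm (- x) = nrm x.
Proof. by rewrite /nrm normrN. Qed.

Lemma nrmD x y : nrm (x + y) <= nrm x + nrm y.
Proof. by rewrite -lecR rmorphD /= !nrmE ler_normD. Qed.

Lemma nrmB x y : nrm (x - y) <= nrm x + nrm y.
Proof. by rewrite -(nrmN y) nrmD. Qed.

Lemma nrm_distC x y : nrm (x - y) = nrm (y - x).
Proof. by rewrite -nrmN opprB. Qed.

Lemma nrm_dist x y w : nrm (x - w) <= nrm (x - y) + nrm (y - w).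
Proof.
have -> : x - w = (x - y) + (y - w) by rewrite addrA subrK.
exact: nrmD.
Qed.

Lemma nrmZ z x : nrm (z *: x) = cabs z * nrm x.
Proof. by apply: complexI; rewrite rmorphM /= !nrmE cabsE normrZ. Qed.

Lemma nrm_eq0 x : nrm x = 0 -> x = 0.
Proof. by move=> x0; apply/eqP; rewrite -normr_eq0 -nrmE x0. Qed.

Lemma nrm_sum (I : Type) (r : seq I) (P : pred I) (F : I -> E) :
  nrm (\sum_(i <- r | P i) F i) <= \sum_(i <- r | P i) nrm (F i).
Proof.
apply: (big_ind2 (fun x a => nrm x <= a)); first by rewrite nrm0.
  by move=> x a y b xa yb; rewrite (le_trans (nrmD _ _))// lerD.
by [].
Qed.

End real_norm.

Section cabs_extra.
Context {R : realType}.
Implicit Types (z : R[i]) (r : R).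

Lemma cabsR r : cabs r%:C = `|r|.
Proof. by rewrite /cabs /= expr0n /= addr0 sqrtr_sqr. Qed.

Lemma cabsRn (n : nat) : cabs (n%:R : R[i]) = n%:R.
Proof. by rewrite -[n%:R in LHS](rmorph_nat (@real_complex R)) cabsR ger0_norm. Qed.

Lemma cabs0 : cabs (0 : R[i]) = 0.
Proof. by rewrite (cabsRn 0). Qed.

Lemma cabs1 : cabs (1 : R[i]) = 1.
Proof. by rewrite (cabsRn 1). Qed.

Lemma cabsi : cabs ('i : R[i]) = 1.
Proof. by rewrite /cabs /= expr0n expr1n add0r sqrtr1. Qed.

Lemma cabsV z : cabs z^-1 = (cabs z)^-1.
Proof. by apply: complexI; rewrite fmorphV /= !cabsE normfV. Qed.

Lemma cabsX z n : cabs (z ^+ n) = cabs z ^+ n.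
Proof. by apply: complexI; rewrite rmorphXn /= !cabsE normrX. Qed.

End cabs_extra.

Section scalar_iteration.
Context {R : realType}.

(** The values of the iteration [op_root_iter] at the identity operator; they
    majorize the norms of its iterates and of their increments. *)
Fixpoint root_iter (n : nat) : R := if n is m.+1 then (1 + root_iter m ^+ 2) / 2 else 0.

Lemma root_iter_bound n : 0 <= root_iter n <= 1.
Proof. elim: n => [|n /andP[h0 h1]] /=; apply/andP; split; nra. Qed.

Lemma root_iter_ge0 n : 0 <= root_iter n. Proof. by case/andP: (root_iter_bound n). Qed.
Lemma root_iter_le1 n : root_iter n <= 1. Proof. by case/andP: (root_iter_bound n). Qed.

Lemma root_iter_incr n : root_iter n <= root_iter n.+1.
Proof. by rewrite /=; have := root_iter_bound n => /andP[]; nra. Qed.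

(** With d the distance to 1, one step is d |-> d - d^2/2.  This decay is only
    of order 1/n, because 1 - sqrt(1 - x) is not differentiable at x = 1. *)
Lemma root_iter_rate n : 1 - root_iter n <= 2 / (n%:R + 2).
Proof.
elim: n => [|n IH] /=; first by rewrite subr0 add0r divff.
have n0 : 0 <= n%:R :> R by [].
set d := 1 - root_iter n in IH *.
have -> : 1 - (1 + root_iter n ^+ 2) / 2 = d - d ^+ 2 / 2 by rewrite /d; field.
have d0 : 0 <= d by rewrite /d subr_ge0 root_iter_le1.
have d1 : d <= 1 by rewrite /d gerBl root_iter_ge0.
set e := 2 / _ in IH.
have e1 : e <= 1 by rewrite /e ler_pdivrMr; lra.
apply: (@le_trans _ _ (e - e ^+ 2 / 2)); first by nra.
have -> : e - e ^+ 2 / 2 = 2 * (n%:R + 1) / (n%:R + 2) ^+ 2 by rewrite /e; field; lra.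
rewrite ler_pdivrMr; last by apply: exprn_gt0; lra.
rewrite mulrAC ler_pdivlMr; last by rewrite -natr1; lra.
by rewrite -natr1; nra.
Qed.

(** Turns the rate of [root_iter_rate] into exact statements; errors O(1/n) are
    kept in this form throughout to avoid limits. *)
Lemma le0_rate (x B : R) : (forall n, x <= 2 / (n%:R + 2) * B) -> x <= 0.
Proof.
move=> h; apply: contrapT => /negP; rewrite -ltNge => x0.
have B0 : 0 < B.
  have := h 0%N; rewrite add0r divff// mul1r; exact: lt_le_trans.
have [n nB] : exists n : nat, 2 * B / x < n%:R.
  exists (Num.bound (2 * B / x)); apply: archi_boundP.
  by rewrite ltW// divr_gt0// mulr_gt0.
have := h n; rewrite mulrAC ler_pdivlMr; last by have : 0 <= n%:R :> R by []; lra.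
move: nB; rewrite ltr_pdivrMr// => nB; nra.
Qed.

End scalar_iteration.

Section sqrt_iteration.
Context {R : realType} {E : normedModType R[i]}.
Implicit Types (C S : {linear E -> E}) (x : E).

Definition contractive (C : E -> E) := forall x, nrm (C x) <= nrm x.

(** The iterates Y_(n+1) = (C^2 + Y_n^2)/2; a fixed point satisfies
    (1 - Y)^2 = 1 - C^2.  They are operators rather than elements, since the
    algebras have no unit. *)
Fixpoint op_root_iter C (n : nat) : {linear E -> E} :=
  if n is m.+1 then
    2^-1 \*: ((C \o C) \+ (op_root_iter C m \o op_root_iter C m)) else \0.

Lemma op_root_iterS C n x : op_root_iter C n.+1 x = 2^-1 *: (C (C x) + op_root_iter C n (op_root_iter C n x)).
Proof. by []. Qed.

Lemma op_root_iter_comm C S : (forall x, S (C x) = C (S x)) ->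
  forall n x, S (op_root_iter C n x) = op_root_iter C n (S x).
Proof.
move=> SC; elim=> [|n IH] x; first by rewrite /= linear0.
by rewrite !op_root_iterS linearZ linearD !SC !IH.
Qed.

Lemma nrm_half x : nrm (2^-1 *: x) = nrm x / 2.
Proof. by rewrite nrmZ cabsV cabsRn mulrC. Qed.

Lemma op_root_iter_le C : contractive C ->
  forall n x, nrm (op_root_iter C n x) <= root_iter n * nrm x.
Proof.
move=> C1; elim=> [|n IH] x; first by rewrite /= nrm0 mul0r.
rewrite op_root_iterS nrm_half /= mulrAC ler_pM2r// mulrDl mul1r.
rewrite (le_trans (nrmD _ _))// lerD//; first by rewrite (le_trans (C1 _))// C1.
rewrite (le_trans (IH _))// expr2 -mulrA ler_wpM2l// ?IH//; exact: root_iter_ge0.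
Qed.

(** Induction on Y^2 - Z^2 = Y(Y - Z) + (Y - Z)Z, the same identity being an
    equality for the majorizing scalar sequence. *)
Lemma op_root_iter_diff C : contractive C -> forall n x,
  nrm (op_root_iter C n.+1 x - op_root_iter C n x) <= (root_iter n.+1 - root_iter n) * nrm x.
Proof.
move=> C1; elim=> [|n IH] x.
  rewrite op_root_iterS /= !subr0 addr0 expr0n /= addr0 nrm_half mul1r mulrC.
  by rewrite ler_pM2l// (le_trans (C1 _)).
rewrite [op_root_iter C n.+2 x]op_root_iterS [in X in _ - X]op_root_iterS -scalerBr nrm_half.
set Y := op_root_iter C n.+1; set Z := op_root_iter C n.
have -> : C (C x) + Y (Y x) - (C (C x) + Z (Z x)) =
    Y (Y x - Z x) + (Y (Z x) - Z (Z x)) by rewrite linearB /= subrKA opprD addrACA subrr add0r.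
apply: (@le_trans _ _ ((root_iter n.+1 * ((root_iter n.+1 - root_iter n) * nrm x) +
   (root_iter n.+1 - root_iter n) * (root_iter n * nrm x)) / 2)).
  rewrite ler_pM2r// (le_trans (nrmD _ _))// lerD//.
    by rewrite (le_trans (op_root_iter_le C1 _ _))// ler_wpM2l ?root_iter_ge0 ?IH.
  rewrite (le_trans (IH _))// ler_wpM2l ?subr_ge0 ?root_iter_incr//; exact: op_root_iter_le.
by rewrite le_eqVlt; apply/orP; left; apply/eqP => /=; field.
Qed.

End sqrt_iteration.

(** Completeness in the form in which it is used: sequences whose increments
    are dominated by those of a bounded real sequence have a limit, with the
    natural estimate of the tail.  It holds in complete normed modules and is
    directly provable for L^1. *)
Definition series_complete {R : realType} (E : normedModType R[i]) :=
  forall (u : nat -> E) (t : nat -> R) (B : R),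
    (forall n, nrm (u n.+1 - u n) <= t n.+1 - t n) -> (forall n, t n <= B) ->
  exists l, forall n, nrm (l - u n) <= B - t n.

Section sqrt_limit.
Context {R : realType} {E : normedModType R[i]}.
Hypothesis Ec : series_complete E.
Implicit Types (C S : {linear E -> E}) (x : E).

(** The operator h = sqrt(1 - C^2) is 1 minus the pointwise limit of the
    iterates.  Linearity, the equation and the bound pass to the limit by
    [le0_rate].  The bound 2 is crude but costs only a constant. *)
Lemma sqrt_exists C : contractive C -> exists h : {linear E -> E},
  [/\ forall n x, nrm (x - h x - op_root_iter C n x) <= 2 / (n%:R + 2) * nrm x,
      forall x, h (h x) = x - C (C x) & forall x, nrm (h x) <= 2 * nrm x].
Proof.
move=> C1.
have /choice[Y YP] : forall x, exists l, forall n,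
    nrm (l - op_root_iter C n x) <= 2 / (n%:R + 2) * nrm x.
  move=> x; have := @Ec (fun n => op_root_iter C n x) (fun n => root_iter n * nrm x) (nrm x).
  case=> [n|n|l lP].
  - by rewrite -mulrBl; exact: op_root_iter_diff.
  - by rewrite -[leRHS]mul1r ler_wpM2r ?nrm_ge0 ?root_iter_le1.
  exists l => n; rewrite (le_trans (lP n))// -[X in X - _]mul1r -mulrBl.
  by rewrite ler_wpM2r ?nrm_ge0 ?root_iter_rate.
have Y_lin : linear Y.
  move=> a u v; apply/eqP; rewrite -subr_eq0; apply/eqP/nrm_eq0/eqP.
  rewrite eq_le nrm_ge0 andbT.
  apply: (@le0_rate _ _ (nrm (a *: u + v) + cabs a * nrm u + nrm v)) => n.
  set s := op_root_iter C n.
  have -> : Y (a *: u + v) - (a *: Y u + Y v) =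
     (Y (a *: u + v) - s (a *: u + v)) - a *: (Y u - s u) - (Y v - s v).
    rewrite (linearP s) (scalerBr a (Y u)) !opprB -[RHS]addrA.
    by rewrite (addrACA (_ *: s u)) -(opprD (_ *: Y u)) addrA subrK.
  rewrite !mulrDr (le_trans (nrmB _ _))// lerD ?YP// (le_trans (nrmB _ _))//.
  by rewrite lerD ?YP// nrmZ mulrCA ler_wpM2l ?cabs_ge0 ?YP.
pose YL : {linear E -> E} := HB.pack Y (GRing.isLinear.Build _ _ _ _ Y Y_lin).
have YE x : YL x = Y x by [].
have Y_le x : nrm (Y x) <= nrm x.
  rewrite -subr_le0; apply: (@le0_rate _ _ (nrm x)) => n.
  rewrite lerBlDr -[Y x](subrK (op_root_iter C n x)) (le_trans (nrmD _ _))// lerD ?YP//.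
  by rewrite (le_trans (op_root_iter_le C1 _ _))// -[leRHS]mul1r ler_wpM2r ?nrm_ge0 ?root_iter_le1.
have Y_eq x : C (C x) + Y (Y x) = 2 *: Y x.
  apply/eqP; rewrite -subr_eq0; apply/eqP/nrm_eq0/eqP.
  rewrite eq_le nrm_ge0 andbT.
  apply: (@le0_rate _ _ (4 * nrm x)) => n.
  set s := op_root_iter C n.
  have -> : C (C x) + Y (Y x) - 2 *: Y x =
     (Y (Y x) - s (Y x)) + s (Y x - s x) - 2 *: (Y x - op_root_iter C n.+1 x).
    rewrite op_root_iterS (scalerBr 2) scalerA divff// scale1r (linearB s) subrKA.
    by rewrite opprB addrA (addrCA _ (C (C x))) subrK.
  rewrite (le_trans (nrmB _ _))// (@le_trans _ _ (2 / (n%:R + 2) * nrm x * 4))//; last first.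
    by rewrite [4 * _]mulrC mulrA.
  have e0 : 0 <= 2 / (n%:R + 2) * nrm x :> R by rewrite mulr_ge0 ?nrm_ge0 ?divr_ge0 ?addr_ge0.
  have h1 : nrm (Y (Y x) - s (Y x)) <= 2 / (n%:R + 2) * nrm x.
    by rewrite (le_trans (YP _ _))// ler_wpM2l ?divr_ge0 ?addr_ge0.
  have h2 : nrm (s (Y x - s x)) <= 2 / (n%:R + 2) * nrm x.
    rewrite (le_trans (op_root_iter_le C1 _ _))// (le_trans _ (YP x n))//.
    by rewrite -[leRHS]mul1r ler_wpM2r ?nrm_ge0 ?root_iter_le1.
  have h3 : nrm (2 *: (Y x - op_root_iter C n.+1 x)) <= 2 * (2 / (n%:R + 2) * nrm x).
    rewrite nrmZ cabsRn ler_pM2l// (le_trans (YP _ _))// ler_wpM2r ?nrm_ge0//.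
    by rewrite ler_pM2l// lef_pV2 ?posrE ?ltr_wpDl// lerD2r ler_nat.
  have := nrmD (Y (Y x) - s (Y x)) (s (Y x - s x)); lra.
exists (idfun \- YL); split=> [n x|x|x] /=.
- by rewrite subKr; exact: YP.
- have YY : Y (Y x) = Y x + Y x - C (C x).
    by rewrite -mulr2n -scaler_nat -Y_eq addrAC subrr add0r.
  by rewrite -!YE (linearB YL) ?YE YY opprB (addrAC (Y x + Y x)) addrK subrKA.
- by rewrite (le_trans (nrmB _ _))// mulr2n mulrDl mul1r lerD2l.
Qed.

End sqrt_limit.

(** * Averaging over roots of unity *)

Section root_average.
Context {R : realType}.
Local Notation C := R[i].

(** The roots of X^n - 1, a separable polynomial, are n distinct n-th roots of
    unity, and such a set contains a primitive one. *)
Lemma prim_root_exists (F : numClosedFieldType) n : (0 < n)%N ->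
  exists w : F, n.-primitive_root w.
Proof.
move=> n0; have [r pE] := closed_field_poly_normal ('X^n - 1 : {poly F}).
rewrite (monicP (monicXnsubC 1 n0)) scale1r in pE.
have /hasP[w _ wn] : has n.-primitive_root r; last by exists w.
apply: has_prim_root => //.
- by apply/allP => z zr; rewrite /root_of_unity pE root_prod_XsubC.
- by rewrite -separable_prod_XsubC -pE separable_Xn_sub_1// pnatr_eq0 -lt0n.
- by rewrite -ltnS -(size_prod_XsubC r id) -pE size_XnsubC.
Qed.

Lemma cabs_prim_root n (w : C) : n.-primitive_root w -> cabs w = 1.
Proof.
move=> wn; have n0 := prim_order_gt0 wn.
apply/eqP; rewrite -(@pexpr_eq1 _ _ n) ?cabs_ge0// -?cabsX.
by rewrite prim_expr_order// cabs1.
Qed.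

Lemma unit_neq0 (z : C) : cabs z = 1 -> z != 0.
Proof. by apply: contra_eqN => /eqP ->; rewrite cabs0 eq_sym oner_eq0. Qed.

(** Averaging over the n-th roots of unity replaces integration over the circle:
    it is exact on Laurent polynomials whose exponents are smaller than n. *)
Lemma root_average n (w : C) (m : int) : n.-primitive_root w -> (`|m| < n)%N ->
  \sum_(k < n) (w ^+ k) ^ m = if m == 0 then n%:R else 0.
Proof.
move=> wn mn; have w0 : w != 0 by rewrite unit_neq0// (cabs_prim_root wn).
case: eqVneq => [->|m0].
  by under eq_bigr do rewrite expr0z; rewrite sumr_const card_ord.
have E (k : nat) : (w ^+ k) ^ m = (w ^ m) ^+ k.
  by rewrite !exprnP !exprz_exp mulrC.
under eq_bigr do rewrite E.
have wm1 : w ^ m - 1 != 0.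
  rewrite subr_eq0; apply/eqP => wm.
  have {}wm : w ^+ `|m| = 1.
    case: m {mn m0 E} wm => k //=.
    by rewrite NegzE -exprnN => /(congr1 GRing.inv); rewrite invrK invr1.
  have := prim_order_dvd wn `|m|%N; rewrite wm eqxx => /dvdn_leq.
  by rewrite absz_gt0 leqNgt mn => /(_ m0).
apply: (mulfI wm1); rewrite mulr0 -subrX1 exprnP exprz_exp mulrC -exprz_exp.
by rewrite -[w ^ n]exprnP prim_expr_order// exp1rz subrr.
Qed.

Implicit Types s : seq (C * int).

(** Laurent polynomials are lists of pairs (coefficient, exponent), with
    repetitions.  The average of a product of two of them, with an arbitrary
    vector for each pair of exponents, keeps the pairs of opposite exponents. *)
Lemma average2 (X : lmodType C) (V : int -> int -> X) n (w : C) s s' :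
  n.-primitive_root w ->
  (forall p q, p \in s -> q \in s' -> (`|(p.2 + q.2)%R| < n)%N) ->
  \sum_(k < n) \sum_(p <- s) \sum_(q <- s')
     (p.1 * q.1 * (w ^+ k) ^ (p.2 + q.2)) *: V p.2 q.2 =
  n%:R *: \sum_(p <- s) \sum_(q <- s' | p.2 + q.2 == 0)
     (p.1 * q.1) *: V p.2 q.2.
Proof.
move=> wn small; rewrite exchange_big scaler_sumr; apply: eq_big_seq => p ps.
rewrite exchange_big scaler_sumr [RHS]big_mkcond; apply: eq_big_seq => q qs.
rewrite -scaler_suml -mulr_sumr (root_average wn (small _ _ ps qs)).
by case: ifP; rewrite ?mulr0 ?scale0r// scalerA mulrC.
Qed.

Definition laurent_eval s (z : C) : C := \sum_(p <- s) p.1 * z ^ p.2.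

Lemma laurent_evalM s s' z : z != 0 -> laurent_eval s z * laurent_eval s' z =
  \sum_(p <- s) \sum_(q <- s') p.1 * q.1 * z ^ (p.2 + q.2).
Proof.
move=> z0; rewrite /laurent_eval mulr_suml; apply: eq_bigr => p _.
rewrite mulr_sumr; apply: eq_bigr => q _.
by rewrite expfzDr// mulrACA.
Qed.

Definition constant_term s s' : C := \sum_(p <- s) \sum_(q <- s' | p.2 + q.2 == 0) p.1 * q.1.

Lemma laurent_eval_average n (w : C) s s' : n.-primitive_root w ->
  (forall p q, p \in s -> q \in s' -> (`|(p.2 + q.2)%R| < n)%N) ->
  n%:R * constant_term s s' = \sum_(k < n) laurent_eval s (w ^+ k) * laurent_eval s' (w ^+ k).
Proof.
move=> wn small; have w0 : w != 0 by rewrite unit_neq0// (cabs_prim_root wn).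
have := average2 (fun _ _ => 1 : C^o) wn small.
under eq_bigr do under eq_bigr do under eq_bigr do rewrite /GRing.scale/= mulr1.
under eq_bigr do rewrite -laurent_evalM ?expf_neq0//.
move=> ->; congr (_ * _); apply: eq_bigr => p _; apply: eq_bigr => q _.
by rewrite /GRing.scale /= mulr1.
Qed.

End root_average.

(** * The square root iteration as a Laurent polynomial *)

Section laurent.
Context {R : realType}.
Local Notation C := R[i].
Implicit Types s : seq (C * int).

(** The function cos^2 on the circle as a Laurent polynomial. *)
Definition cos2_laurent : seq (C * int) := [:: (4^-1, 2); (2^-1, 0); (4^-1, -2)].
(** The function sin on the circle as a Laurent polynomial. *)
Definition sin_laurent : seq (C * int) := [:: ((2 * 'i)^-1, 1); (- (2 * 'i)^-1, -1)].

(** The iterates of [op_root_iter] at C = cos, as formal Laurent polynomials. *)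
Fixpoint laurent_root_iter (n : nat) : seq (C * int) := if n is m.+1 then
  [seq (p.1 / 2, p.2) | p <- cos2_laurent] ++
  [seq (p.1 * q.1 / 2, p.2 + q.2) | p <- laurent_root_iter m, q <- laurent_root_iter m] else [::].

(** All coefficients stay nonnegative because the recursion only adds and
    multiplies; the bound on [antidiagonal] sums rests on this. *)
Lemma laurent_root_iter_ge0 n : all (fun p => 0 <= p.1) (laurent_root_iter n).
Proof.
elim: n => //= n IH; rewrite !divr_ge0 ?invr_ge0//=.
apply/allP => _ /allpairsP[[p q] /= [pn qn ->]] /=.
by rewrite divr_ge0// mulr_ge0// ?(allP IH p pn)// (allP IH q qn).
Qed.

Lemma laurent_eval_cos2_laurent (z : C) : z != 0 -> laurent_eval cos2_laurent z = ((z + z^-1) / 2) ^+ 2.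
Proof.
move=> z0; rewrite /laurent_eval !big_cons big_nil /= expr0z.
rewrite -(exprnP z 2) -(exprnN z 2) addr0.
by field.
Qed.

Lemma laurent_eval_sin_laurent (z : C) : z != 0 -> laurent_eval sin_laurent z ^+ 2 = 1 - laurent_eval cos2_laurent z.
Proof.
move=> z0; rewrite laurent_eval_cos2_laurent// /laurent_eval !big_cons big_nil /= addr0.
rewrite exprN1 expr1z mulNr -mulrBr exprMn exprVn exprMn sqr_i.
by field.
Qed.

Lemma laurent_eval_laurent_root_iter n (z : C) : z != 0 ->
  laurent_eval (laurent_root_iter n.+1) z = (laurent_eval cos2_laurent z + laurent_eval (laurent_root_iter n) z ^+ 2) / 2.
Proof.
move=> z0; rewrite /laurent_eval big_cat big_map /= mulrDl; congr (_ + _).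
  by rewrite mulr_suml; apply: eq_bigr => p _; rewrite mulrAC.
rewrite big_allpairs_dep /= expr2 mulr_suml mulr_suml; apply: eq_bigr => p _.
rewrite mulr_sumr mulr_suml; apply: eq_bigr => q _.
by rewrite expfzDr// mulrAC (mulrACA p.1).
Qed.

Lemma laurent_eval_cos2_laurent_real (z : C) : cabs z = 1 ->
  exists2 x : R, 0 <= x <= 1 & laurent_eval cos2_laurent z = x%:C.
Proof.
move=> z1; have z0 := unit_neq0 z1.
(* On the unit circle the inverse is the conjugate. *)
have zz : z^-1 = z^*.
  by apply: (mulfI z0); rewrite divff// -sqr_normc -cabsE z1 rmorph1 expr1n.
exists (complex.Re z ^+ 2).
  have : `|complex.Re z| <= 1 by rewrite -z1 -lecR cabsE normc_ge_Re.
  by rewrite sqr_ge0 /= ler_norml => /andP[]; nra.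
rewrite laurent_eval_cos2_laurent// zz; case: z {z1 z0 zz} => a b /=.
rewrite (_ : (_ + _) / 2 = a%:C) ?rmorphXn//.
apply: (mulIf (_ : 2 != 0)) => //; rewrite divfK//.
by rewrite mulr_natr mulr2n; apply/eqP; rewrite eq_complex /= subrr addr0 !eqxx.
Qed.

(** The values of the iteration at a point of the circle where cos^2 is x. *)
Fixpoint real_root_iter (x : R) n : R := if n is m.+1 then (x + real_root_iter x m ^+ 2) / 2 else 0.

Lemma laurent_eval_laurent_root_iterE n (z : C) (x : R) : z != 0 -> laurent_eval cos2_laurent z = x%:C ->
  laurent_eval (laurent_root_iter n) z = (real_root_iter x n)%:C.
Proof.
move=> z0 zx; elim: n => [|n IH]; first by rewrite /laurent_eval big_nil.
by rewrite laurent_eval_laurent_root_iter// zx IH /= rmorphM rmorphD rmorphXn fmorphV rmorph_nat.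
Qed.

Lemma real_root_iter_bound x n : 0 <= x <= 1 -> 0 <= real_root_iter x n <= x.
Proof.
move=> /andP[x0 x1]; elim: n => [|n /andP[IH0 IH1]] /=; apply/andP; split => //.
  by rewrite divr_ge0// addr_ge0// sqr_ge0.
nra.
Qed.

Lemma real_root_iter_diff x n : 0 <= x <= 1 ->
  [/\ real_root_iter x n <= root_iter n, 0 <= real_root_iter x n.+1 - real_root_iter x n &
    real_root_iter x n.+1 - real_root_iter x n <= root_iter n.+1 - root_iter n].
Proof.
move=> x01; have /andP[x0 x1] := x01; elim: n => [|n [IH0 IH1 IH2]].
  by split => //=; nra.
have /andP[r0 _] := real_root_iter_bound n x01; have /andP[r1 _] := real_root_iter_bound n.+1 x01.
have t0 := @root_iter_ge0 R n; have t1 := @root_iter_ge0 R n.+1.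
have -> : real_root_iter x n.+2 - real_root_iter x n.+1 =
  (real_root_iter x n.+1 - real_root_iter x n) * (real_root_iter x n.+1 + real_root_iter x n) / 2.
  by rewrite [real_root_iter x n.+2]/= -/(real_root_iter x n.+1) {2}[real_root_iter x n.+1]/=; field.
have -> : root_iter n.+2 - root_iter n.+1 =
  (root_iter n.+1 - root_iter n) * (root_iter n.+1 + root_iter n) / 2 :> R.
  by rewrite [root_iter n.+2]/= -/(root_iter n.+1) {2}[root_iter n.+1]/=; field.
have le1 : real_root_iter x n.+1 <= root_iter n.+1 by lra.
split=> //; first by rewrite divr_ge0// mulr_ge0// addr_ge0.
by rewrite ler_pM2r// ler_pM// ?addr_ge0// lerD.
Qed.

Lemma exponent_bound s s' : exists2 n, (0 < n)%N &
  forall p q, p \in s -> q \in s' -> (`|(p.2 + q.2)%R| < n)%N.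
Proof.
exists (\max_(p <- s) `|p.2| + \max_(q <- s') `|q.2|).+1%N => // p q ps qs.
have := @leq_bigmax_seq _ s xpredT (fun p : C * int => `|p.2|%N) p ps isT.
have := @leq_bigmax_seq _ s' xpredT (fun p : C * int => `|p.2|%N) q qs isT.
move: (\max_(p <- s) _)%N (\max_(p <- s') _)%N => /=; lia.
Qed.

(** By averaging, the constant term of Y_n^2 is a mean value of numbers
    0 <= Y_n^2 <= cos^4, and 3/8 is the mean value of cos^4. *)
Lemma constant_term_laurent_root_iter n : constant_term (laurent_root_iter n) (laurent_root_iter n) <= 3 / 8.
Proof.
have [N N0 NP] := exponent_bound (laurent_root_iter n) (laurent_root_iter n).
have [N' N'0 N'P] := exponent_bound cos2_laurent cos2_laurent.
have [w wN] := prim_root_exists C (ltn_addr N' N0).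
have c : constant_term cos2_laurent cos2_laurent = 3 / 8.
  by rewrite /constant_term /cos2_laurent !big_cons !big_nil /=; field.
have NN : 0 < (N + N')%:R :> C by rewrite ltr0n ltn_addr.
rewrite -(ler_pM2l NN) -c !(laurent_eval_average wN); first last.
- by move=> p q ps qs; rewrite ltn_addr ?NP.
- by move=> p q ps qs; rewrite ltn_addl ?N'P.
apply: ler_sum => k _.
have wk : cabs (w ^+ k) = 1 by rewrite cabsX (cabs_prim_root wN) expr1n.
have [x x01 xE] := laurent_eval_cos2_laurent_real wk.
rewrite (laurent_eval_laurent_root_iterE n (unit_neq0 wk) xE) xE -!rmorphM lecR.
by have /andP[] := real_root_iter_bound n x01; nra.
Qed.

Definition one_minus s : seq (C * int) := (1, 0) :: [seq (- p.1, p.2) | p <- s].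

Lemma laurent_eval_one_minus s z : laurent_eval (one_minus s) z = 1 - laurent_eval s z.
Proof.
rewrite /laurent_eval big_cons big_map expr0z mulr1 /= -sumrN; congr (_ + _).
by apply: eq_bigr => p _; rewrite mulNr.
Qed.

Lemma constant_term_sin_laurent : constant_term sin_laurent sin_laurent = 2^-1.
Proof.
rewrite /constant_term /sin_laurent !big_cons !big_nil /= !addr0 mulrN mulNr.
have -> : (2 * 'i)^-1 * (2 * 'i)^-1 = - 4^-1 :> C.
  by rewrite -expr2 exprVn exprMn sqr_i; field.
by field.
Qed.

(** In the limit, (1 - Y)^2 = sin^2 has mean value 1/2.  The error is exactly
    computable, since (1 - Y_n)^2 - (1 - x) = 2 (Y_(n+1) - Y_n) at a point where cos^2
    is x. *)
Lemma constant_term_one_minus n :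
  cabs (constant_term (one_minus (laurent_root_iter n)) (one_minus (laurent_root_iter n)) - 2^-1) <= 2 * (2 / (n%:R + 2)).
Proof.
set s := one_minus _.
have [N N0 NP] := exponent_bound s s.
have [N' N'0 N'P] := exponent_bound sin_laurent sin_laurent.
have [w wN] := prim_root_exists C (ltn_addr N' N0).
have NN : 0 < (N + N')%:R :> R by rewrite ltr0n ltn_addr.
rewrite -(ler_pM2l NN) -[X in X * cabs _]cabsRn -cabsM mulrBr -constant_term_sin_laurent.
rewrite !(laurent_eval_average wN); first last.
- by move=> p q ps qs; rewrite ltn_addr ?NP.
- by move=> p q ps qs; rewrite ltn_addl ?N'P.
rewrite -sumrB; apply: (@le_trans _ _ (\sum_(k < N + N') 2 * (2 / (n%:R + 2)))); last first.
  by rewrite sumr_const card_ord [leRHS]mulr_natl.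
apply: (@le_trans _ _ (\sum_(k < N + N')
  cabs (laurent_eval s (w ^+ k) * laurent_eval s (w ^+ k) - laurent_eval sin_laurent (w ^+ k) * laurent_eval sin_laurent (w ^+ k)))).
  apply: (big_ind2 (fun x a => cabs x <= a)); rewrite ?cabs0//.
  by move=> x a y b xa yb; rewrite (le_trans (cabsD _ _))// lerD.
apply: ler_sum => k _.
have wk : cabs (w ^+ k) = 1 by rewrite cabsX (cabs_prim_root wN) expr1n.
have [x x01 xE] := laurent_eval_cos2_laurent_real wk.
rewrite -[laurent_eval sin_laurent _ * _]expr2 laurent_eval_sin_laurent ?unit_neq0// laurent_eval_one_minus xE.
rewrite (laurent_eval_laurent_root_iterE n (unit_neq0 wk) xE) -expr2.
have [_ r0 r1] := real_root_iter_diff n x01.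
have -> : (1 - (real_root_iter x n)%:C) ^+ 2 - (1 - x%:C) = (2 * (real_root_iter x n.+1 - real_root_iter x n))%:C.
  rewrite /= -[1 in LHS](rmorph1 (real_complex R)).
  by rewrite -!rmorphB -rmorphXn -rmorphB; congr (_%:C); field.
rewrite cabsR ger0_norm ?mulr_ge0// ler_pM2l// (le_trans r1)//.
by rewrite (le_trans _ (root_iter_rate n))// lerD2r root_iter_le1.
Qed.

End laurent.

(** * Operators and double multipliers *)

Section integer_powers.
Context {T : Type} (W Wi : T -> T).
Hypotheses (WK : cancel W Wi) (WiK : cancel Wi W).

Definition int_power (m : int) : T -> T :=
  match m with Posz n => iter n W | Negz n => iter n.+1 Wi end.

Lemma int_powerS m x : int_power (m + 1) x = W (int_power m x).
Proof.
case: m => [n|[|n]]; first by rewrite -PoszD addn1.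
  by rewrite /= WiK.
have -> : Negz n.+1 + 1 = Negz n by rewrite !NegzE; lia.
by rewrite /= WiK.
Qed.

Lemma int_powerP m x : int_power (m - 1) x = Wi (int_power m x).
Proof.
by rewrite -[in RHS](subrK 1 m) int_powerS WK.
Qed.

Lemma int_powerD m k x : int_power (m + k) x = int_power m (int_power k x).
Proof.
elim/int_rect: m => [|n IH|n IH]; first by rewrite add0r.
  by rewrite -addn1 PoszD addrAC !int_powerS IH.
by rewrite -addn1 PoszD opprD addrAC !int_powerP IH.
Qed.

End integer_powers.

Lemma int_powerV {T : Type} (W Wi : T -> T) m x : int_power Wi W m x = int_power W Wi (- m) x.
Proof. by case: m => [[|n]|n]. Qed.

Section laurent_operators.
Context {R : realType} {E : normedModType R[i]} (W Wi : {linear E -> E}).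
Hypotheses (WK : cancel W Wi) (WiK : cancel Wi W).
Implicit Types (s : seq (R[i] * int)) (z : R[i]) (x : E).

Lemma int_power_linear m : linear (int_power W Wi m).
Proof.
move=> a u v; case: m => n; rewrite /int_power; elim: n => [|n IH] //.
- by rewrite !iterS IH linearP.
- by rewrite /= linearP.
- by rewrite !(iterS n.+1) IH linearP.
Qed.

HB.instance Definition _ m := GRing.isLinear.Build _ _ _ _ (int_power W Wi m) (int_power_linear m).

(** The Laurent polynomial s evaluated at the operator zW. *)
Definition laurent_op s z x := \sum_(p <- s) (p.1 * z ^ p.2) *: int_power W Wi p.2 x.

Definition cosop z : {linear E -> E} := 2^-1 \*: ((z \*: W) \+ (z^-1 \*: Wi)).
Definition sinop z : {linear E -> E} := (2 * 'i)^-1 \*: ((z \*: W) \- (z^-1 \*: Wi)).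

Lemma cosopE z x : cosop z x = 2^-1 *: (z *: W x + z^-1 *: Wi x).
Proof. by []. Qed.

Lemma sinopE z x : sinop z x = (2 * 'i)^-1 *: (z *: W x - z^-1 *: Wi x).
Proof. by []. Qed.

Lemma cosop2 z x : z != 0 -> cosop z (cosop z x) = laurent_op cos2_laurent z x.
Proof.
move=> z0; rewrite cosopE [cosop z x]cosopE /laurent_op !big_cons big_nil /= addr0 expr0z.
rewrite !linearZ/= !linearD/= !linearZ/= WK WiK.
rewrite -(exprnP z 2) -(exprnN z 2) !scalerA.
rewrite -[in LHS]addrA; congr (_ *: _ + _); first by field.
rewrite addrA; congr (_ + _ *: _); last by field.
by rewrite -scalerDl; congr (_ *: _); field.
Qed.

Lemma sin_cos z x : z != 0 -> sinop z (sinop z x) = x - cosop z (cosop z x).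
Proof.
move=> z0; rewrite cosop2// sinopE [sinop z x]sinopE.
rewrite /laurent_op !big_cons big_nil /= addr0 expr0z.
rewrite !linearZ/= ?linearD/= ?linearN/= ?linearZ/= ?linearN/= ?WK ?WiK.
rewrite -(exprnP z 2) -(exprnN z 2) !scalerA.
have kk : (2 * 'i)^-1 * (2 * 'i)^-1 = - 4^-1 :> R[i].
  by rewrite -expr2 exprVn exprMn sqr_i; field.
move: (2 * 'i)^-1 kk => k kk; rewrite opprK -!scaleNr.
rewrite -[LHS]addrA [X in _ + X]addrA -scalerDl [RHS]addrCA addrA.
rewrite [X in _ = _ + X]addrA -[X in _ = _ + (X + _ + _)]scale1r -scalerDl addrA.
congr (_ *: _ + _ *: _ + _ *: _).
- by rewrite /GRing.scale/= -kk; ring.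
- rewrite /GRing.scale/= mulr1; apply: (@etrans _ _ (- (k * k) - k * k)); first by field.
  by rewrite kk; field.
- by rewrite /GRing.scale/= -kk; field.
Qed.

Lemma op_root_iter_laurent_op z n x : z != 0 -> op_root_iter (cosop z) n x = laurent_op (laurent_root_iter n) z x.
Proof.
move=> z0; elim: n x => [|n IH] x; first by rewrite /laurent_op big_nil.
rewrite op_root_iterS cosop2// !IH [RHS]/laurent_op big_cat big_map scalerDr; congr (_ + _).
  rewrite /laurent_op scaler_sumr; apply: eq_bigr => p _ /=.
  by rewrite scalerA; congr (_ *: _); ring.
rewrite big_allpairs_dep /= /laurent_op scaler_sumr; apply: eq_bigr => p _.
rewrite linear_sum !scaler_sumr; apply: eq_bigr => q _ /=.
rewrite int_powerD// expfzDr// (linearZ_LR (int_power W Wi p.2)) !scalerA; congr (_ *: _); ring.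
Qed.

Lemma laurent_op_one_minus s z x : laurent_op (one_minus s) z x = x - laurent_op s z x.
Proof.
rewrite /laurent_op big_cons big_map /= expr0z mulr1 scale1r -sumrN; congr (_ + _).
by apply: eq_bigr => p _; rewrite mulNr scaleNr.
Qed.

Lemma laurent_op_sin_laurent z x : laurent_op sin_laurent z x = sinop z x.
Proof.
rewrite sinopE /laurent_op !big_cons big_nil /= addr0 scalerBr !scalerA.
by rewrite mulNr scaleNr.
Qed.

End laurent_operators.

Lemma cosop_comm {R : realType} {E : normedModType R[i]} (W Wi S : {linear E -> E}) z :
  (forall x, S (W x) = W (S x)) -> (forall x, S (Wi x) = Wi (S x)) ->
  forall x, S (cosop W Wi z x) = cosop W Wi z (S x).
Proof. by move=> SW SWi x; rewrite !cosopE linearZ/= linearD/= !linearZ/= SW SWi. Qed.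

Lemma sinop_comm {R : realType} {E : normedModType R[i]} (W Wi S : {linear E -> E}) z :
  (forall x, S (W x) = W (S x)) -> (forall x, S (Wi x) = Wi (S x)) ->
  forall x, S (sinop W Wi z x) = sinop W Wi z (S x).
Proof.
by move=> SW SWi x; rewrite !sinopE linearZ_LR (linearB S) !(linearZ_LR S) SW SWi.
Qed.

Section unimult.
Context {R : realType} {A : normedModType R[i]} (mul : {bilinear A -> A -> A}).

(** Unitary double multipliers (R, L) of a possibly nonunital algebra: R and L
    play the roles of right and left multiplication by a unitary element. *)
Record unimult := Unimult {
  umR : {linear A -> A}; umRi : {linear A -> A};
  umL : {linear A -> A}; umLi : {linear A -> A};
  umRK : cancel umR umRi; umRiK : cancel umRi umR;
  umLK : cancel umL umLi; umLiK : cancel umLi umL;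
  umR1 : contractive umR; umRi1 : contractive umRi;
  umL1 : contractive umL; umLi1 : contractive umLi;
  umM : forall a c, mul (umR a) c = mul a (umL c) }.

Lemma umMi U a c : mul (umRi U a) c = mul a (umLi U c).
Proof. by rewrite -{1}(umLiK U c) -umM umRiK. Qed.

Definition umV U := Unimult (umRiK U) (umRK U) (umLiK U) (umLK U)
  (umRi1 U) (umR1 U) (umLi1 U) (umL1 U) (umMi U).

Program Definition um1 : unimult := @Unimult idfun idfun idfun idfun _ _ _ _ _ _ _ _ _.
Solve All Obligations with by move=> *.

Lemma comp_contractive (f g : A -> A) : contractive f -> contractive g -> contractive (f \o g).
Proof. by move=> f1 g1 x; rewrite (le_trans (f1 _)). Qed.

Definition umD U V := @Unimult (umR U \o umR V) (umRi V \o umRi U)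
  (umL V \o umL U) (umLi U \o umLi V)
  (can_comp (umRK U) (umRK V)) (can_comp (umRiK V) (umRiK U))
  (can_comp (umLK V) (umLK U)) (can_comp (umLiK U) (umLiK V))
  (comp_contractive (umR1 U) (umR1 V)) (comp_contractive (umRi1 V) (umRi1 U))
  (comp_contractive (umL1 V) (umL1 U)) (comp_contractive (umLi1 U) (umLi1 V))
  (fun a c => etrans (umM U (umR V a) c) (umM V a (umL U c))).

Definition umX U n := iter n (umD U) um1.

Definition umXz U (m : int) :=
  match m with Posz n => umX U n | Negz n => umX (umV U) n.+1 end.

(** The integer powers of a unitary double multiplier, acting through R on the
    first argument and through L on the second one. *)
Lemma umXzE U m : [/\ umR (umXz U m) =1 int_power (umR U) (umRi U) m,
  umL (umXz U m) =1 int_power (umL U) (umLi U) m,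
  umRi (umXz U m) =1 int_power (umR U) (umRi U) (- m) &
  umLi (umXz U m) =1 int_power (umL U) (umLi U) (- m)].
Proof.
have H V n : [/\ umR (umX V n) =1 iter n (umR V), umL (umX V n) =1 iter n (umL V),
    umRi (umX V n) =1 iter n (umRi V) & umLi (umX V n) =1 iter n (umLi V)].
  elim: n => [|n [IH1 IH2 IH3 IH4]]; first by split.
  by split => x /=; rewrite ?IH1 ?IH2 ?IH3 ?IH4 -?iterS// iterSr.
case: m => n /=; first by have [H1 H2 H3 H4] := H U n; case: n H1 H2 H3 H4.
by have [H1 H2 H3 H4] := H (umV U) n.+1; split; rewrite ?NegzE ?opprK //.
Qed.

End unimult.

(** * The estimate for one rotation *)

Lemma nrm_eq_rate {R : realType} {E : normedModType R[i]} (x y : E) (B : R) :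
  (forall n, nrm (x - y) <= 2 / (n%:R + 2) * B) -> x = y.
Proof.
move=> h; apply/eqP; rewrite -subr_eq0; apply/eqP/nrm_eq0/eqP.
by rewrite eq_le nrm_ge0 andbT; exact: le0_rate h.
Qed.

Definition approx_root {R : realType} {E : normedModType R[i]} (C h : {linear E -> E}) :=
  forall n x, nrm (x - h x - op_root_iter C n x) <= 2 / (n%:R + 2) * nrm x.

(** The square root h is a limit of polynomials in C, so whatever intertwines C
    and C' intertwines the square roots.  T is additive and bounded rather than linear, to cover the conjugate-linear
    involution of a C*-algebra. *)
Lemma root_intertwine {R : realType} {E F : normedModType R[i]} (T : E -> F)
    (C h : {linear E -> E}) (C' h' : {linear F -> F}) (B : R) :
  0 <= B -> {morph T : x y / x - y} -> (forall x, nrm (T x) <= B * nrm x) ->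
  (forall n x, T (op_root_iter C n x) = op_root_iter C' n (T x)) ->
  approx_root C h -> approx_root C' h' -> forall x, T (h x) = h' (T x).
Proof.
move=> B0 TB Tb TC Ch Ch' x; apply: (@nrm_eq_rate _ _ _ _ (2 * (B * nrm x))) => n.
have e0 : 0 <= 2 / (n%:R + 2) :> R by rewrite divr_ge0 ?addr_ge0.
have -> : T (h x) - h' (T x) =
    (T x - h' (T x) - op_root_iter C' n (T x)) - T (x - h x - op_root_iter C n x).
  by rewrite !TB TC opprB addrA subrK opprB addrC addrA subrK.
have -> : 2 / (n%:R + 2) * (2 * (B * nrm x)) =
  2 / (n%:R + 2) * (B * nrm x) + B * (2 / (n%:R + 2) * nrm x) by ring.
rewrite (le_trans (nrmB _ _))// lerD//.
  by rewrite (le_trans (Ch' _ _))// ler_wpM2l.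
by rewrite (le_trans (Tb _))// ler_wpM2l.
Qed.

Section multiplier_pairs.
Context {R : realType} {A : normedModType R[i]} (mul : {bilinear A -> A -> A}).
Hypothesis mul_le : forall a b, nrm (mul a b) <= nrm a * nrm b.

(** Double multipliers: f acts as a right and g as a left multiplication by the
    same virtual element. *)
Definition mpair (f g : A -> A) := forall a c, mul (f a) c = mul a (g c).

Lemma mpair_op_root_iter (f g : {linear A -> A}) n : mpair f g -> mpair (op_root_iter f n) (op_root_iter g n).
Proof.
move=> fg; elim: n => [|n IH] a c; first by rewrite /= linear0l linear0r.
by rewrite !op_root_iterS linearZl_LR linearDl linearZr_LR linearDr !fg !IH.
Qed.

Lemma mpair_root (f g h k : {linear A -> A}) :
  mpair f g -> approx_root f h -> approx_root g k -> mpair h k.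
Proof.
move=> fg fh gk a c; apply: (@nrm_eq_rate _ _ _ _ (2 * (nrm a * nrm c))) => n.
have -> : mul (h a) c - mul a (k c) =
    mul a (c - k c - op_root_iter g n c) - mul (a - h a - op_root_iter f n a) c.
  rewrite !linearBr !linearBl (mpair_op_root_iter n fg) !opprD !opprK.
  by zmod_identity.
have -> : 2 / (n%:R + 2) * (2 * (nrm a * nrm c)) =
  nrm a * (2 / (n%:R + 2) * nrm c) + 2 / (n%:R + 2) * nrm a * nrm c by ring.
rewrite (le_trans (nrmB _ _))// lerD// (le_trans (mul_le _ _))//.
  by rewrite ler_wpM2l ?nrm_ge0 ?gk.
by rewrite ler_wpM2r ?nrm_ge0 ?fh.
Qed.

End multiplier_pairs.

Section rotation_estimate.
Context {R : realType} {A : normedModType R[i]} (mul : {bilinear A -> A -> A}).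
Hypothesis mul_le : forall a b, nrm (mul a b) <= nrm a * nrm b.
Hypothesis Ac : series_complete A.
Context {X : normedModType R[i]} (phi : {bilinear A -> A -> X}) (M al : R).
Hypothesis phi_le : forall a b, nrm (phi a b) <= M * nrm a * nrm b.
Hypothesis M0 : 0 <= M.
Hypothesis al0 : 0 <= al.
Hypothesis phi_al : forall a b, mul a b = 0 -> nrm (phi a b) <= al * nrm a * nrm b.

Lemma cosop_contractive (W Wi : {linear A -> A}) z : cabs z = 1 ->
  contractive W -> contractive Wi -> contractive (cosop W Wi z).
Proof.
move=> z1 W1 Wi1 x; rewrite cosopE nrm_half ler_pdivrMr// mulr_natr mulr2n.
by rewrite (le_trans (nrmD _ _))// !nrmZ cabsV z1 invr1 !mul1r lerD.
Qed.

Lemma sinop_contractive (W Wi : {linear A -> A}) z : cabs z = 1 ->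
  contractive W -> contractive Wi -> contractive (sinop W Wi z).
Proof.
move=> z1 W1 Wi1 x; rewrite sinopE nrmZ cabsV cabsM cabsi mulr1 cabsRn mulrC.
rewrite ler_pdivrMr// mulr_natr mulr2n.
by rewrite (le_trans (nrmB _ _))// !nrmZ cabsV z1 invr1 !mul1r lerD.
Qed.

(** With h^2 = s^2 and commuting h and s, the double multiplier (h + s)(h - s)
    vanishes. *)
Lemma zero_product (hR sR hL sL : {linear A -> A}) a c :
  mpair mul hR hL -> mpair mul sR sL ->
  (forall x, hL (hL x) = sL (sL x)) -> (forall x, sL (hL x) = hL (sL x)) ->
  mul (hR a + sR a) (hL c - sL c) = 0.
Proof.
move=> mh ms hs sh; rewrite linearDl mh ms -linearDr !linearB/= hs sh.
by rewrite addrC subrKA subrr linear0r.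
Qed.

(** phi(h, h) - phi(s, s) is half the sum of phi(h + s, h - s) and
    phi(h - s, h + s), both evaluated at arguments with product 0.  The norms
    3 = 2 + 1 of h + s and h - s give 9 = 3 * 3. *)
Lemma product_estimate (hR sR hL sL : {linear A -> A}) a c :
  mpair mul hR hL -> mpair mul sR sL ->
  (forall x, hL (hL x) = sL (sL x)) -> (forall x, sL (hL x) = hL (sL x)) ->
  (forall x, nrm (hR x) <= 2 * nrm x) -> (forall x, nrm (hL x) <= 2 * nrm x) ->
  contractive sR -> contractive sL ->
  nrm (phi (hR a) (hL c) - phi (sR a) (sL c)) <= 9 * al * (nrm a * nrm c).
Proof.
move=> mh ms hs sh hR2 hL2 sR1 sL1.
have E1 : nrm (phi (hR a + sR a) (hL c - sL c)) <= 9 * al * (nrm a * nrm c).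
  rewrite (le_trans (phi_al (zero_product _ _ mh ms hs sh)))//.
  have := nrmD (hR a) (sR a); have := nrmB (hL c) (sL c).
  have := hR2 a; have := hL2 c; have := sR1 a; have := sL1 c => h1 h2 h3 h4 h5 h6.
  have -> : 9 * al * (nrm a * nrm c) = al * (3 * nrm a) * (3 * nrm c) by ring.
  rewrite ler_pM ?mulr_ge0 ?nrm_ge0 ?ler_wpM2l//; lra.
have E2 : nrm (phi (hR a - sR a) (hL c + sL c)) <= 9 * al * (nrm a * nrm c).
  have z : mul (hR a - sR a) (hL c + sL c) = 0.
    have := @zero_product hR (\- sR) hL (\- sL) a c mh.
    rewrite /= opprK; apply => [x y|x|x] /=.
    + by rewrite linearNl linearNr ms.
    + by rewrite linearN /= opprK.
    + by rewrite linearN /= sh.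
  rewrite (le_trans (phi_al z))//.
  have := nrmB (hR a) (sR a); have := nrmD (hL c) (sL c).
  have := hR2 a; have := hL2 c; have := sR1 a; have := sL1 c => h1 h2 h3 h4 h5 h6.
  have -> : 9 * al * (nrm a * nrm c) = al * (3 * nrm a) * (3 * nrm c) by ring.
  rewrite ler_pM ?mulr_ge0 ?nrm_ge0 ?ler_wpM2l//; lra.
have -> : phi (hR a) (hL c) - phi (sR a) (sL c) =
  2^-1 *: (phi (hR a + sR a) (hL c - sL c) + phi (hR a - sR a) (hL c + sL c)).
  rewrite !linearDl !linearDr !linearNl !linearNr.
  set p := phi (hR a) (hL c); set q := phi (hR a) (sL c).
  set r := phi (sR a) (hL c); set s := phi (sR a) (sL c).
  have -> : p - q + (r - s) + (p + q + (- r - s)) = (p - s) + (p - s) by zmod_identity.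
  by rewrite scalerDr -scalerDl (_ : _ + _ = 1) ?scale1r//; field.
rewrite nrm_half; have := nrmD (phi (hR a + sR a) (hL c - sL c)) (phi (hR a - sR a) (hL c + sL c)); lra.
Qed.

(** [product_estimate] for the cosine and sine of zU, with the square root
    replaced by its n-th approximation, which is a Laurent polynomial. *)
Lemma rotation_estimate (U : unimult mul) z n a c : cabs z = 1 ->
  nrm (phi (a - op_root_iter (cosop (umR U) (umRi U) z) n a)
           (c - op_root_iter (cosop (umL U) (umLi U) z) n c) -
       phi (sinop (umR U) (umRi U) z a) (sinop (umL U) (umLi U) z c)) <=
  (9 * al + 4 * M * (2 / (n%:R + 2))) * (nrm a * nrm c).
Proof.
move=> z1; have z0 := unit_neq0 z1.
set cR := cosop _ _ _; set cL := cosop _ _ _.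
set sR := sinop _ _ _; set sL := sinop _ _ _.
have cR1 : contractive cR by apply: cosop_contractive => //; [exact: umR1|exact: umRi1].
have cL1 : contractive cL by apply: cosop_contractive => //; [exact: umL1|exact: umLi1].
have sR1 : contractive sR by apply: sinop_contractive => //; [exact: umR1|exact: umRi1].
have sL1 : contractive sL by apply: sinop_contractive => //; [exact: umL1|exact: umLi1].
have mc : mpair mul cR cL.
  move=> x y; rewrite /cR /cL !cosopE linearZl_LR linearDl !linearZl_LR.
  by rewrite linearZr_LR linearDr !linearZr_LR umM umMi.
have ms : mpair mul sR sL.
  move=> x y; rewrite /sR /sL !sinopE linearZl_LR linearBl !linearZl_LR.
  by rewrite linearZr_LR linearBr !linearZr_LR umM umMi.
have [hR [hRa hR2 hRn]] := sqrt_exists Ac cR1.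
have [hL [hLa hL2 hLn]] := sqrt_exists Ac cL1.
have mh := mpair_root mul_le mc hRa hLa.
have hs x : hL (hL x) = sL (sL x).
  by rewrite hL2 /sL sin_cos//; [exact: umLK|exact: umLiK].
have sc x : sL (cL x) = cL (sL x).
  by apply: cosop_comm => y; rewrite /sL; apply/esym; apply: sinop_comm => // u;
    rewrite umLK umLiK.
have sh x : sL (hL x) = hL (sL x).
  apply: (@root_intertwine _ _ _ sL cL hL cL hL 1) => //.
  - by move=> u v; rewrite linearB.
  - by move=> u; rewrite mul1r.
  - by move=> m u; apply: op_root_iter_comm.
have := product_estimate a c mh ms hs sh hRn hLn sR1 sL1.
set P := phi (sR a) _ => E.
have -> : phi (a - op_root_iter cR n a) (c - op_root_iter cL n c) - P =
  (phi (hR a) (hL c) - P) + (phi (hR a) (c - hL c - op_root_iter cL n c) +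
    phi (a - hR a - op_root_iter cR n a) (c - op_root_iter cL n c)).
  rewrite (addrAC c) (addrAC a) (linearBr _ (hR a)) (linearBl _ _ (a - _) (hR a)).
  by zmod_identity.
rewrite (le_trans (nrmD _ _))// [leRHS]mulrDl lerD//.
have e0 : 0 <= 2 / (n%:R + 2) :> R by rewrite divr_ge0 ?addr_ge0.
have yn : nrm (c - op_root_iter cL n c) <= 2 * nrm c.
  rewrite (le_trans (nrmB _ _))// mulr_natl mulr2n lerD2l.
  by rewrite (le_trans (op_root_iter_le cL1 _ _))// -[leRHS]mul1r ler_wpM2r ?nrm_ge0 ?root_iter_le1.
have -> : 4 * M * (2 / (n%:R + 2)) * (nrm a * nrm c) =
  M * (2 * nrm a) * (2 / (n%:R + 2) * nrm c) + M * (2 / (n%:R + 2) * nrm a) * (2 * nrm c) by ring.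
rewrite (le_trans (nrmD _ _))// lerD// (le_trans (phi_le _ _))//.
  by rewrite ler_pM ?mulr_ge0 ?nrm_ge0 ?ler_wpM2l ?hRn ?hLa.
by rewrite ler_pM ?mulr_ge0 ?nrm_ge0 ?ler_wpM2l ?hRa ?yn.
Qed.

End rotation_estimate.

(** * The multiplier estimate *)

Section antidiagonal_sum.
Context {R : realType} {X : normedModType R[i]}.
Implicit Types (s : seq (R[i] * int)) (F : int -> X).

(** What remains of a product of Laurent polynomials after averaging over the
    circle. *)
Definition antidiagonal s s' F : X :=
  \sum_(p <- s) \sum_(q <- s' | p.2 + q.2 == 0) (p.1 * q.1) *: F p.2.

Lemma antidiagonalB s s' F F' : antidiagonal s s' (fun m => F m - F' m) = antidiagonal s s' F - antidiagonal s s' F'.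
Proof.
rewrite /antidiagonal -sumrB; apply: eq_bigr => p _; rewrite -sumrB.
by apply: eq_bigr => q _; rewrite scalerBr.
Qed.

Lemma antidiagonalD s s' F F' : antidiagonal s s' (fun m => F m + F' m) = antidiagonal s s' F + antidiagonal s s' F'.
Proof.
rewrite /antidiagonal -big_split; apply: eq_bigr => p _; rewrite -big_split.
by apply: eq_bigr => q _; rewrite scalerDr.
Qed.

Lemma antidiagonalZ s s' F k : antidiagonal s s' (fun m => k *: F m) = k *: antidiagonal s s' F.
Proof.
rewrite /antidiagonal scaler_sumr; apply: eq_bigr => p _; rewrite scaler_sumr.
by apply: eq_bigr => q _; rewrite !scalerA [_ * k]mulrC.
Qed.

Lemma antidiagonal_cst s s' v : antidiagonal s s' (fun _ => v) = constant_term s s' *: v.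
Proof.
rewrite /antidiagonal /constant_term scaler_suml; apply: eq_bigr => p _.
by rewrite scaler_suml.
Qed.

Lemma antidiagonal_sin_laurent F : (forall m, F (- m) = F m) -> antidiagonal sin_laurent sin_laurent F = 2^-1 *: F 1.
Proof.
move=> Fe; rewrite -constant_term_sin_laurent /antidiagonal /constant_term /sin_laurent !big_cons !big_nil /=.
by rewrite -[-1]/(- 1) Fe !addr0 scalerDl.
Qed.

(** The constant term 1 of 1 - Y contributes only through F 0. *)
Lemma antidiagonal_one_minus s F : F 0 = 0 -> antidiagonal (one_minus s) (one_minus s) F = antidiagonal s s F.
Proof.
move=> F0; rewrite /antidiagonal big_cons/= big1 ?add0r => [|q _]; last by rewrite F0 scaler0.
rewrite big_map; apply: eq_bigr => p _ /=.
rewrite big_cons big_map /= addr0 (eq_bigr (fun q => (p.1 * q.1) *: F p.2)).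
  by case: eqVneq => // ->; rewrite F0 scaler0 add0r.
by move=> q _; rewrite mulrNN.
Qed.

(** The coefficients are nonnegative, so they may be summed before the estimate,
    and their sum is the constant term of Y_n^2. *)
Lemma antidiagonal_laurent_root_iter_le n F K : (forall m, nrm (F m) <= K) ->
  nrm (antidiagonal (laurent_root_iter n) (laurent_root_iter n) F) <= 3 / 8 * K.
Proof.
move=> FK; have K0 : 0 <= K := le_trans (nrm_ge0 _) (FK 0).
have pos p q : p \in laurent_root_iter n -> q \in laurent_root_iter n -> p.1 * q.1 = (cabs (p.1 * q.1))%:C.
  move=> pn qn; rewrite cabsE ger0_norm// mulr_ge0//;
  by [exact: (allP (laurent_root_iter_ge0 n) p pn)|exact: (allP (laurent_root_iter_ge0 n) q qn)].
apply: (@le_trans _ _ (\sum_(p <- laurent_root_iter n) \sum_(q <- laurent_root_iter n | p.2 + q.2 == 0)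
    cabs (p.1 * q.1) * K)).
  rewrite (le_trans (nrm_sum _ _ _))//; apply: ler_sum => p _.
  rewrite (le_trans (nrm_sum _ _ _))//; apply: ler_sum => q _.
  by rewrite nrmZ ler_wpM2l ?cabs_ge0.
under eq_bigr do rewrite -mulr_suml.
rewrite -mulr_suml ler_wpM2r// -lecR rmorphM fmorphV !rmorph_nat rmorph_sum /=.
rewrite -(ler_pM2r (_ : 0 < 1)) ?mulr1//; apply: le_trans (constant_term_laurent_root_iter n).
rewrite le_eqVlt; apply/orP; left; apply/eqP; apply: eq_big_seq => p pn.
rewrite rmorph_sum big_seq_cond [RHS]big_seq_cond; apply: eq_bigr => q /andP[qn _].
by rewrite /= -pos.
Qed.

End antidiagonal_sum.

(** If a bound B + x can be improved to B + 3x/4, then the excess x can be made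
    arbitrarily small; the geometric decay is weakened to the rate 1/n. *)
Lemma geometric_limit {R : realType} (P : R -> Prop) (B x0 : R) :
  (forall x, 0 <= x -> P (B + x) -> P (B + 3 / 4 * x)) -> 0 <= x0 -> P (B + x0) ->
  forall n, exists2 x, 0 <= x <= 2 / (n%:R + 2) * (2 * x0) & P (B + x).
Proof.
move=> step x00 P0; elim=> [|n [x /andP[x0' xn] Px]].
  by exists x0 => //; rewrite x00 add0r divff// mul1r; lra.
(* The first step is separate because 3/4 is not below the ratio of the rate
   at n = 0. *)
exists (if n == 0%N then 3 / 4 * x0 else 3 / 4 * x).
  case: eqVneq => [->|n0].
    have -> : 2 / (1%:R + 2) = 2 / 3 :> R by field.
    by apply/andP; split; [rewrite mulr_ge0|lra].
  apply/andP; split; first by rewrite mulr_ge0.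
  apply: (@le_trans _ _ (3 / 4 * (2 / (n%:R + 2) * (2 * x0)))); first by lra.
  rewrite mulrA ler_wpM2r ?mulr_ge0// -natr1.
  have n1 : 1 <= n%:R :> R by rewrite ler1n lt0n.
  rewrite mulrA ler_pdivrMr; last by lra.
  rewrite [leRHS]mulrAC ler_pdivlMr; last by lra.
  by lra.
by case: ifP => _; exact: step.
Qed.

Section multiplier_theorem.
Context {R : realType} {A : normedModType R[i]} (mul : {bilinear A -> A -> A}).
Hypothesis mul_le : forall a b, nrm (mul a b) <= nrm a * nrm b.
Hypothesis Ac : series_complete A.
Context {X : normedModType R[i]} (phi : {bilinear A -> A -> X}) (M al : R).
Hypothesis phi_le : forall a b, nrm (phi a b) <= M * nrm a * nrm b.
Hypothesis M0 : 0 <= M.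
Hypothesis al0 : 0 <= al.
Hypothesis phi_al : forall a b, mul a b = 0 -> nrm (phi a b) <= al * nrm a * nrm b.
Implicit Types U : unimult mul.

Lemma phi_laurent_op (W Wi V Vi : {linear A -> A}) s s' z a c : z != 0 ->
  phi (laurent_op W Wi s z a) (laurent_op V Vi s' z c) =
  \sum_(p <- s) \sum_(q <- s')
    (p.1 * q.1 * z ^ (p.2 + q.2)) *: phi (int_power W Wi p.2 a) (int_power V Vi q.2 c).
Proof.
move=> z0; rewrite /laurent_op linear_sumlz; apply: eq_bigr => p _.
rewrite linear_sumr; apply: eq_bigr => q _.
rewrite linearZl_LR linearZr_LR /= scalerA; congr (_ *: _).
by rewrite expfzDr//; ring.
Qed.

(** The average over z of phi evaluated at Laurent polynomials in zU only involves
    these values. *)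
Definition shift U a c (m : int) : X :=
  phi (int_power (umR U) (umRi U) m a) (int_power (umL U) (umLi U) (- m) c).

Lemma average_estimate U n a c :
  nrm (antidiagonal (one_minus (laurent_root_iter n)) (one_minus (laurent_root_iter n)) (shift U a c) -
       antidiagonal sin_laurent sin_laurent (shift U a c)) <=
  (9 * al + 4 * M * (2 / (n%:R + 2))) * (nrm a * nrm c).
Proof.
set s := one_minus _.
have [N N0 NP] := exponent_bound s s.
have [N' N'0 N'P] := exponent_bound (@sin_laurent R) sin_laurent.
have [w wN] := prim_root_exists R[i] (ltn_addr N' N0).
have NN : 0 < (N + N')%:R :> R by rewrite ltr0n ltn_addr.
have w1 (k : nat) : cabs (w ^+ k) = 1 by rewrite cabsX (cabs_prim_root wN) expr1n.
have av t : (forall p q, p \in t -> q \in t -> (`|(p.2 + q.2)%R| < N + N')%N) ->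
    (N + N')%:R *: antidiagonal t t (shift U a c) = \sum_(k < N + N')
    phi (laurent_op (umR U) (umRi U) t (w ^+ k) a) (laurent_op (umL U) (umLi U) t (w ^+ k) c).
  move=> tP; under [RHS]eq_bigr do rewrite phi_laurent_op ?(unit_neq0 (w1 _))//.
  rewrite (average2 (fun m k => phi (int_power (umR U) (umRi U) m a)
    (int_power (umL U) (umLi U) k c)) wN tP).
  congr (_ *: _); apply: eq_bigr => p _; apply: eq_bigr => q /eqP pq.
  by rewrite /shift (_ : q.2 = - p.2)//; apply/eqP; rewrite -addr_eq0 addrC pq.
rewrite -(ler_pM2l NN) -[X in X * nrm (_ - _)]cabsRn -nrmZ scalerBr !av; first last.
- by move=> p q ps qs; rewrite ltn_addr ?NP.
- by move=> p q ps qs; rewrite ltn_addl ?N'P.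
rewrite -sumrB (le_trans (nrm_sum _ _ _))//.
rewrite [leRHS](_ : _ = \sum_(k < N + N') (9 * al + 4 * M * (2 / (n%:R + 2))) * (nrm a * nrm c)); last first.
  by rewrite sumr_const card_ord [LHS]mulr_natl.
apply: ler_sum => k _; have z0 := unit_neq0 (w1 k).
rewrite !laurent_op_one_minus !laurent_op_sin_laurent -!op_root_iter_laurent_op//; do ?[exact: umRK|exact: umRiK|exact: umLK|exact: umLiK].
exact: rotation_estimate.
Qed.

(** The quantity D_U(a, c) of the proof; it is even in the exponent when U runs
    through powers, which removes the asymmetry between U and its inverse. *)
Definition symdiff U a c : X :=
  phi a c - 2^-1 *: (phi (umR U a) (umLi U c) + phi (umRi U a) (umL U c)).

Lemma symdiff_shift U a c m :
  symdiff (umXz U m) a c = phi a c - 2^-1 *: (shift U a c m + shift U a c (- m)).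
Proof.
by rewrite /symdiff /shift; have [-> -> -> ->] := umXzE U m; rewrite opprK.
Qed.

(** One pass of K/2 <= 9 alpha + 3K/8, in the form of the improvement of an
    available bound K. *)
Lemma symdiff_step K : (forall U a c, nrm (symdiff U a c) <= K * (nrm a * nrm c)) ->
  forall U a c, nrm (symdiff U a c) <= (18 * al + 3 / 4 * K) * (nrm a * nrm c).
Proof.
move=> HK U a c; rewrite -subr_le0.
apply: (@le0_rate _ _ (12 * M * (nrm a * nrm c))) => n.
pose D m := symdiff (umXz U m) a c.
have Dsym m : D (- m) = D m by rewrite /D !symdiff_shift opprK [X in _ *: X]addrC.
have D0 : D 0 = 0.
  rewrite /D symdiff_shift oppr0 /shift oppr0 /= scalerDr -scalerDl.
  by rewrite (_ : _ + _ = 1) ?scale1r ?subrr//; field.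
have D1 : D 1 = symdiff U a c.
  by rewrite /D symdiff_shift.
pose T (F : int -> X) := antidiagonal (one_minus (laurent_root_iter n)) (one_minus (laurent_root_iter n)) F - antidiagonal sin_laurent sin_laurent F.
have E1 := average_estimate U n a c.
have E2 := average_estimate (umV U) n a c.
have shV m : shift (umV U) a c m = shift U a c (- m).
  by rewrite /shift /= (int_powerV (umR U)) (int_powerV (umL U)) ?opprK.
(* The averages for U and for U^-1 add up to an expression in D alone. *)
have key : 2^-1 *: D 1 = 2^-1 *: (T (shift U a c) + T (shift (umV U) a c))
   - (constant_term (one_minus (laurent_root_iter n)) (one_minus (laurent_root_iter n)) - 2^-1) *: phi a c
   + antidiagonal (laurent_root_iter n) (laurent_root_iter n) D.
  have -> : 2^-1 *: (T (shift U a c) + T (shift (umV U) a c)) =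
      T (fun m => phi a c - D m).
    rewrite /T [RHS](_ : _ = T (fun m => 2^-1 *: (shift U a c m + shift (umV U) a c m))).
      by rewrite /T !antidiagonalZ !antidiagonalD -scalerBr; congr (_ *: _); zmod_identity.
    by congr (T _); apply/funext => m; rewrite shV /D symdiff_shift subKr.
  rewrite /T !(antidiagonalB _ _ (fun=> phi a c) D) !antidiagonal_cst antidiagonal_one_minus// (antidiagonal_sin_laurent Dsym) constant_term_sin_laurent.
  rewrite scalerBl.
  by zmod_identity.
have := HK U a c; rewrite -D1 => HD.
have E3 : nrm (antidiagonal (laurent_root_iter n) (laurent_root_iter n) D) <= 3 / 8 * (K * (nrm a * nrm c)).
  by apply: antidiagonal_laurent_root_iter_le => m; exact: HK.
have E4 : nrm ((constant_term (one_minus (laurent_root_iter n)) (one_minus (laurent_root_iter n)) - 2^-1) *: phi a c) <=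
    2 * (2 / (n%:R + 2)) * (M * nrm a * nrm c).
  by rewrite nrmZ ler_pM ?cabs_ge0 ?nrm_ge0 ?constant_term_one_minus.
have E5 : nrm (2^-1 *: D 1) <= (9 * al + 4 * M * (2 / (n%:R + 2))) * (nrm a * nrm c) +
    2 * (2 / (n%:R + 2)) * (M * nrm a * nrm c) + 3 / 8 * (K * (nrm a * nrm c)).
  rewrite key (le_trans (nrmD _ _))// lerD// (le_trans (nrmB _ _))// lerD//.
  rewrite nrm_half; have := nrmD (T (shift U a c)) (T (shift (umV U) a c)).
  rewrite -/(T _) in E1 E2; lra.
rewrite nrm_half in E5.
have -> : 2 / (n%:R + 2) * (12 * M * (nrm a * nrm c)) =
  2 * (4 * M * (2 / (n%:R + 2)) * (nrm a * nrm c) + 2 * (2 / (n%:R + 2)) * (M * nrm a * nrm c)) by ring.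
lra.
Qed.

Lemma symdiff_le U a c : nrm (symdiff U a c) <= 72 * al * (nrm a * nrm c).
Proof.
pose P K := forall U a c, nrm (symdiff U a c) <= K * (nrm a * nrm c).
have P0 : P (72 * al + 2 * M).
  move=> V x y; rewrite /symdiff (le_trans (nrmB _ _))// nrm_half.
  have := nrmD (phi (umR V x) (umLi V y)) (phi (umRi V x) (umL V y)).
  have le (f g : A -> A) : contractive f -> contractive g ->
      nrm (phi (f x) (g y)) <= M * (nrm x * nrm y).
    move=> f1 g1; rewrite (le_trans (phi_le _ _))// -mulrA ler_wpM2l//.
    by rewrite ler_pM ?nrm_ge0 ?f1 ?g1.
  have := le _ _ (umR1 V) (umLi1 V); have := le _ _ (umRi1 V) (umL1 V).
  have := phi_le x y; rewrite -mulrA.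
  have : 0 <= 72 * al * (nrm x * nrm y) by rewrite !mulr_ge0 ?nrm_ge0.
  lra.
have step x : 0 <= x -> P (72 * al + x) -> P (72 * al + 3 / 4 * x).
  move=> x0 /symdiff_step Px V y w; rewrite (le_trans (Px V y w))// ler_wpM2r ?mulr_ge0 ?nrm_ge0//.
  lra.
rewrite -subr_le0; apply: (@le0_rate _ _ (2 * (2 * M) * (nrm a * nrm c))) => n.
have [x /andP[x0 xn] Px] := geometric_limit step (mulr_ge0 (ler0n _ 2) M0) P0 n.
rewrite lerBlDl (le_trans (Px U a c))// mulrDl lerD2l [leRHS]mulrA ler_wpM2r//.
by rewrite mulr_ge0 ?nrm_ge0.
Qed.

(** The identity 2(U - 1) = (U^2 - 1) - (U - 1)^2 for the
    two actions of U on phi, with the second argument shifted by U^-1. *)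
Lemma multiplier_step U a c :
  phi (umR U a) c - phi a (umL U c) =
  2^-1 *: (phi (umR (umD U U) a) (umLi U c) - phi a (umL (umD U U) (umLi U c))) +
  symdiff U (umR U a) c.
Proof.
rewrite /symdiff /= umRK umLiK scalerBr scalerDr.
have h : phi a (umL U c) = 2^-1 *: phi a (umL U c) + 2^-1 *: phi a (umL U c).
  by rewrite -scalerDl (_ : _ + _ = 1) ?scale1r//; field.
rewrite {1}h; zmod_identity.
Qed.

(** By [multiplier_step], a bound K for all U yields the bound K/2 + 72 alpha. *)
Theorem multiplier_estimate U a c :
  nrm (phi (umR U a) c - phi a (umL U c)) <= 144 * al * (nrm a * nrm c).
Proof.
pose P K := forall U a c, nrm (phi (umR U a) c - phi a (umL U c)) <= K * (nrm a * nrm c).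
have P0 : P (144 * al + 2 * M).
  move=> V x y; rewrite (le_trans (nrmB _ _))//.
  have h1 : nrm (phi (umR V x) y) <= M * (nrm x * nrm y).
    rewrite (le_trans (phi_le _ _))// -mulrA ler_wpM2l// ler_wpM2r ?nrm_ge0//; exact: umR1.
  have h2 : nrm (phi x (umL V y)) <= M * (nrm x * nrm y).
    rewrite (le_trans (phi_le _ _))// -mulrA ler_wpM2l// ler_wpM2l ?nrm_ge0//; exact: umL1.
  have : 0 <= 144 * al * (nrm x * nrm y) by rewrite !mulr_ge0 ?nrm_ge0.
  lra.
have step x : 0 <= x -> P (144 * al + x) -> P (144 * al + 3 / 4 * x).
  move=> x0 Px V y w; rewrite multiplier_step (le_trans (nrmD _ _))// nrm_half.
  have h1 := Px (umD V V) y (umLi V w); have h2 := symdiff_le V (umR V y) w.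
  have k1 : (144 * al + x) * (nrm y * nrm (umLi V w)) <= (144 * al + x) * (nrm y * nrm w).
    rewrite ler_wpM2l ?addr_ge0 ?mulr_ge0// ler_wpM2l ?nrm_ge0//; exact: umLi1.
  have k2 : 72 * al * (nrm (umR V y) * nrm w) <= 72 * al * (nrm y * nrm w).
    rewrite ler_wpM2l ?mulr_ge0// ler_wpM2r ?nrm_ge0//; exact: umR1.
  have k3 : 0 <= x * (nrm y * nrm w) by rewrite !mulr_ge0 ?nrm_ge0.
  lra.
rewrite -subr_le0; apply: (@le0_rate _ _ (2 * (2 * M) * (nrm a * nrm c))) => n.
have [x /andP[x0 xn] Px] := geometric_limit step (mulr_ge0 (ler0n _ 2) M0) P0 n.
rewrite lerBlDl (le_trans (Px U a c))// mulrDl lerD2l [leRHS]mulrA ler_wpM2r//.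
by rewrite mulr_ge0 ?nrm_ge0.
Qed.

End multiplier_theorem.

(** * C*-algebras *)

Section bridge.
Context {R : realType} {A : normedModType R[i]} (mul : {bilinear A -> A -> A}).

(** Normalizing the two arguments turns the supremum over unit balls into a
    homogeneous estimate. *)
Lemma zero_product_le_alphaB (X : normedModType R[i]) (phi : {bilinear A -> A -> X}) :
  bounded_bilinear phi -> 0 <= alphaB mul phi /\
  forall a b, mul a b = 0 -> nrm (phi a b) <= alphaB mul phi * nrm a * nrm b.
Proof.
move=> [M phiM].
set S : set R := [set t : R | exists a b : A,
    [/\ `|a| <= 1, `|b| <= 1, mul a b = 0 & t%:C = `|phi a b|]].
have S0 : S 0 by exists 0, 0; rewrite normr0 !linear0r normr0 ler01.
have supS : has_sup S.
  split; first by exists 0.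
  exists `|M| => t [a [b [a1 b1 _ tE]]]; rewrite -lecR tE (le_trans (phiM _ _))//.
  rewrite -!nrmE -!rmorphM lecR -mulrA (le_trans (ler_norm _))// normrM.
  rewrite -[leRHS]mulr1 ler_wpM2l// normrM !ger0_norm ?nrm_ge0//.
  by rewrite mulr_ile1 ?nrm_ge0// -lecR nrmE.
have ubS t : S t -> t <= alphaB mul phi by move=> St; exact: sup_upper_bound.
split=> [|a b ab]; first exact: ubS.
have [a0|a0] := eqVneq (nrm a) 0.
  by rewrite (nrm_eq0 a0) linear0l !nrm0 mulr0 mul0r.
have [b0|b0] := eqVneq (nrm b) 0.
  by rewrite (nrm_eq0 b0) linear0r !nrm0 mulr0.
have {}a0 : 0 < nrm a by rewrite lt_def a0 nrm_ge0.
have {}b0 : 0 < nrm b by rewrite lt_def b0 nrm_ge0.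
have unit (x : A) : 0 < nrm x -> nrm (((nrm x)^-1)%:C *: x) = 1.
  by move=> x0; rewrite nrmZ cabsR ger0_norm ?invr_ge0 ?ltW// mulVf// gt_eqF.
rewrite -mulrA mulrC -ler_pdivrMl ?mulr_gt0//.
apply: ubS; exists ((nrm a)^-1%:C *: a), ((nrm b)^-1%:C *: b).
rewrite -!nrmE !unit// lexx linearZl_LR linearZr_LR ab !scaler0; split => //.
rewrite linearZl_LR linearZr_LR /= !nrmZ !cabsR !ger0_norm ?invr_ge0 ?nrm_ge0//.
by rewrite invfM mulrA.
Qed.

Lemma strong_property_BP (r : R) : 0 < r ->
  (forall (X : normedModType R[i]) (phi : {bilinear A -> A -> X}) (M al : R),
    (forall a b, nrm (phi a b) <= M * nrm a * nrm b) -> 0 <= M -> 0 <= al ->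
    (forall a b, mul a b = 0 -> nrm (phi a b) <= al * nrm a * nrm b) ->
    forall a b c, nrm (phi (mul a b) c - phi a (mul b c)) <=
      r * al * (nrm a * nrm b * nrm c)) -> strong_property_B mul r.
Proof.
move=> r0 H; split=> // X phi phib a b c.
have [al0 alP] := zero_product_le_alphaB phib; case: phib => M phiM.
rewrite -!nrmE -!rmorphM lecR -!mulrA mulrA (mulrA (nrm a)).
apply: (H _ _ `|M|) => // x y.
rewrite -lecR nrmE (le_trans (phiM _ _))// !rmorphM -!nrmE -!rmorphM lecR.
by rewrite !ler_wpM2r ?nrm_ge0// ler_norm.
Qed.

End bridge.

Lemma complete_series_complete {R : realType} (E : completeNormedModType R[i]) :
  series_complete E.
Proof.
move=> u t B ut tB.
have t_incr m n : (m <= n)%N -> nrm (u n - u m) <= t n - t m.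
  move=> /subnK <-; elim: (n - m)%N => [|k IH]; first by rewrite !add0n !subrr nrm0.
  rewrite addSn (le_trans (nrm_dist _ (u (k + m)%N) _))//.
  by have := ut (k + m)%N; lra.
have supt : has_sup (range t).
  by split; [exists (t 0%N), 0%N|exists B => _ [n _ <-]].
have tail (e : R) : 0 < e -> exists N, forall n, (N <= n)%N -> nrm (u n - u N) < e.
  move=> e0; have [_ [N _ <-] tN] := sup_adherent e0 supt.
  exists N => n Nn; rewrite (le_lt_trans (t_incr _ _ Nn))//.
  have := @sup_upper_bound _ _ supt (t n) (ex_intro2 _ _ n I erefl); lra.
have : cauchy (u @ \oo).
  apply: cauchy_exP => e e0.
  have eE : e = (complex.Re e)%:C by case: e e0 => x y; rewrite ltcE /= => /andP[/eqP -> _].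
  have re0 : 0 < complex.Re e by rewrite -ltcR -eE.
  have [N NP] := tail _ re0; exists (u N).
  exists N => // n /= Nn; rewrite -ball_normE /= eE -nrmE ltcR nrm_distC.
  exact: NP.
move=> /cauchy_cvg /cvg_ex[l ul]; exists l => n.
apply/ler_addgt0Pr => e e0.
have ec : 0 < e%:C :> R[i] by rewrite ltcR.
have /cvgrPdist_lt/(_ _ ec)[N _ NP] := ul.
have := NP (maxn N n) (leq_maxl _ _); rewrite -nrmE ltcR => h1.
have h2 := t_incr _ _ (leq_maxr N n); have h3 := tB (maxn N n).
by have := nrm_dist l (u (maxn N n)) (u n); lra.
Qed.

Section cstar.
Context {R : realType} {A : completeNormedModType R[i]} (mul : {bilinear A -> A -> A})
  (star : A -> A).
Hypothesis H : is_cstar_algebra mul star.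

Let Ac : series_complete A := @complete_series_complete R A.
Let mulA a b c : mul a (mul b c) = mul (mul a b) c.
Proof. by case: H => -[]. Qed.

Let mul_le a b : nrm (mul a b) <= nrm a * nrm b.
Proof. by rewrite -lecR rmorphM /= !nrmE; case: H => -[]. Qed.

Let nrm_starM a : nrm (mul (star a) a) = nrm a ^+ 2.
Proof. by apply: complexI; rewrite rmorphXn /= !nrmE; case: H. Qed.

Let starD := cstarD H.
Let starZ := cstarZ H.
Let starM := cstarM H.
Let starK := cstarK H.

Let nrm_le_star a : nrm a <= nrm (star a).
Proof.
have := mul_le (star a) a; rewrite nrm_starM expr2.
have [->|a0] := eqVneq (nrm a) 0; first by rewrite nrm_ge0.
by rewrite ler_pM2r// lt_def a0 nrm_ge0.
Qed.

Let nrm_star a : nrm (star a) = nrm a.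
Proof. by apply/eqP; rewrite eq_le nrm_le_star -{2}(starK a) nrm_le_star. Qed.

Let nrm_Mstar a : nrm (mul a (star a)) = nrm a ^+ 2.
Proof. by rewrite -{1}(starK a) nrm_starM nrm_star. Qed.

Let star0 : star 0 = 0.
Proof. by rewrite -(scale0r (0 : A)) starZ rmorph0 !scale0r. Qed.

Let starN a : star (- a) = - star a.
Proof. by rewrite -scaleN1r starZ rmorphN rmorph1 scaleN1r. Qed.

Section selfadjoint.
Variable b : A.
Hypotheses (b_sa : star b = b) (b1 : nrm b <= 1).

Definition right_mul (x : A) := mul x b.
Let right_mul_linear : linear right_mul.
Proof. by move=> k x y; rewrite /right_mul linearPl. Qed.
HB.instance Definition _ := GRing.isLinear.Build _ _ _ _ right_mul right_mul_linear.
Let CR : {linear A -> A} := right_mul.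
Let CL : {linear A -> A} := mul b.

Let CR1 : contractive CR.
Proof.
move=> x; rewrite (le_trans (mul_le _ _))// -[leRHS]mulr1.
by rewrite ler_wpM2l ?nrm_ge0.
Qed.

Let CL1 : contractive CL.
Proof.
move=> x; rewrite (le_trans (mul_le _ _))// -[leRHS]mul1r.
by rewrite ler_wpM2r ?nrm_ge0.
Qed.

(** With h = sqrt(1 - b^2), the pair of b + ih and b - ih is inverse to each other
    by b^2 + h^2 = 1.  They are isometric by the C*-identity, because the
    involution exchanges the right and the left action and sends b + ih to
    b - ih. *)
Lemma selfadjoint_unimult : exists U : unimult mul,
  forall x, [/\ CR x = 2^-1 *: (umR U x + umRi U x) &
                CL x = 2^-1 *: (umL U x + umLi U x)].
Proof.
have [hR [hRa hR2 _]] := sqrt_exists Ac CR1.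
have [hL [hLa hL2 _]] := sqrt_exists Ac CL1.
have mC : mpair mul CR CL by move=> x y; rewrite /= /right_mul mulA.
have mh := mpair_root mul_le mC hRa hLa.
have CRh x : CR (hR x) = hR (CR x).
  apply: (@root_intertwine _ _ _ CR CR hR CR hR 1) => //.
  - by move=> u v; rewrite linearB.
  - by move=> u; rewrite mul1r.
  - by move=> n u; apply: op_root_iter_comm.
have CLh x : CL (hL x) = hL (CL x).
  apply: (@root_intertwine _ _ _ CL CL hL CL hL 1) => //.
  - by move=> u v; rewrite linearB.
  - by move=> u; rewrite mul1r.
  - by move=> n u; apply: op_root_iter_comm.
have starCR x : star (CR x) = CL (star x) by rewrite /= /right_mul starM b_sa.
have star_op_root_iter n x : star (op_root_iter CR n x) = op_root_iter CL n (star x).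
  elim: n x => [|n IH] x; first by rewrite /= star0.
  by rewrite !op_root_iterS starZ starD !starCR !IH fmorphV rmorph_nat.
have star_h x : star (hR x) = hL (star x).
  apply: (@root_intertwine _ _ _ star CR hR CL hL 1) => //.
  - by move=> u v; rewrite starD starN.
  - by move=> u; rewrite mul1r nrm_star.
have star_hL x : star (hL x) = hR (star x) by rewrite -{1}(starK x) -star_h starK.
have starCL x : star (CL x) = CR (star x) by rewrite -{1}(starK x) -starCR starK.
(* The multipliers b + kh, with k = i and k = -i below. *)
pose WR (k : R[i]) : {linear A -> A} := CR \+ (k \*: hR).
pose WL (k : R[i]) : {linear A -> A} := CL \+ (k \*: hL).
have WRE k x : WR k x = CR x + k *: hR x by [].
have WLE k x : WL k x = CL x + k *: hL x by [].
have ii : 'i * 'i = -1 :> R[i] by rewrite -expr2 sqr_i.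
have WRK k : k * k = -1 -> cancel (WR k) (WR (- k)).
  move=> kk x; rewrite !WRE linearD (linearD hR) !linearZ_LR CRh hR2 /=.
  by rewrite scalerDr !scalerA mulNr kk opprK scale1r scaleNr; zmod_identity.
have WLK k : k * k = -1 -> cancel (WL k) (WL (- k)).
  move=> kk x; rewrite !WLE linearD (linearD hL) !linearZ_LR CLh hL2 /=.
  by rewrite scalerDr !scalerA mulNr kk opprK scale1r scaleNr; zmod_identity.
have mW k : mpair mul (WR k) (WL k).
  by move=> x y; rewrite WRE WLE linearDl linearDr linearZl_LR linearZr_LR mC mh.
have nkk (k : R[i]) : k * k = -1 -> - k * - k = -1 by rewrite mulrNN.
have starWR k x : k^* = - k -> star (WR k x) = WL (- k) (star x).
  by move=> kc; rewrite WRE WLE starD starZ starCR star_h kc.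
have starWL k x : k^* = - k -> star (WL k x) = WR (- k) (star x).
  by move=> kc; rewrite WRE WLE starD starZ starCL star_hL kc.
have WR1 k : k * k = -1 -> k^* = - k -> contractive (WR k).
  move=> kk kc x; rewrite -ler_sqr ?nnegrE ?nrm_ge0// -!nrm_Mstar starWR// mW.
  by have := WLK _ (nkk _ kk) (star x); rewrite opprK => ->.
have WL1 k : k * k = -1 -> k^* = - k -> contractive (WL k).
  move=> kk kc x; rewrite -ler_sqr ?nnegrE ?nrm_ge0// -!nrm_starM starWL// mW.
  by rewrite WLK.
have ic : ('i : R[i])^* = - 'i by apply/eqP; rewrite eq_complex /= oppr0 !eqxx.
have nic : (- 'i : R[i])^* = - - 'i by apply/eqP; rewrite eq_complex /= ?opprK ?oppr0 !eqxx.
have WRKi := WRK _ (nkk _ ii); have WLKi := WLK _ (nkk _ ii).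
rewrite opprK in WRKi WLKi.
exists (@Unimult _ _ mul (WR 'i) (WR (- 'i)) (WL 'i) (WL (- 'i))
  (WRK _ ii) WRKi (WLK _ ii) WLKi (WR1 _ ii ic) (WR1 _ (nkk _ ii) nic)
  (WL1 _ ii ic) (WL1 _ (nkk _ ii) nic) (mW _)) => x.
have half (y k : A) : y = 2^-1 *: ((y + 'i *: k) + (y + - 'i *: k)).
  have -> : y + 'i *: k + (y + - 'i *: k) = y + y by rewrite scaleNr; zmod_identity.
  by rewrite scalerDr -scalerDl (_ : _ + _ = 1) ?scale1r//; field.
by split; exact: half.
Qed.

End selfadjoint.

Section form.
Context {X : normedModType R[i]} (phi : {bilinear A -> A -> X}) (M al : R).
Hypothesis phi_le : forall a b, nrm (phi a b) <= M * nrm a * nrm b.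
Hypothesis M0 : 0 <= M.
Hypothesis al0 : 0 <= al.
Hypothesis phi_al : forall a b, mul a b = 0 -> nrm (phi a b) <= al * nrm a * nrm b.

Let defect a b c := phi (mul a b) c - phi a (mul b c).

Let defectZ k a b c : defect a (k *: b) c = k *: defect a b c.
Proof.
by rewrite /defect linearZr_LR !linearZl_LR linearZr_LR /= scalerBr.
Qed.

Let defectD a b b' c : defect a (b + b') c = defect a b c + defect a b' c.
Proof.
by rewrite /defect linearDr !linearDl linearDr; zmod_identity.
Qed.

Let unit_selfadjoint_estimate a b c : star b = b -> nrm b <= 1 ->
  nrm (defect a b c) <= 144 * al * (nrm a * nrm c).
Proof.
move=> b_sa b1; have [U UE] := selfadjoint_unimult b_sa b1.
have -> : defect a b c =
    2^-1 *: ((phi (umR U a) c - phi a (umL U c)) + (phi (umRi U a) c - phi a (umLi U c))).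
  have [ha _] := UE a; have [_ hc] := UE c; rewrite /= /right_mul in ha hc.
  rewrite /defect ha hc linearZl_LR linearDl linearZr_LR linearDr /= -scalerBr.
  by congr (_ *: _); zmod_identity.
have h1 := multiplier_estimate mul_le Ac phi_le M0 al0 phi_al U a c.
have h2 := multiplier_estimate mul_le Ac phi_le M0 al0 phi_al (umV U) a c.
rewrite nrm_half; have := nrmD (phi (umR U a) c - phi a (umL U c))
  (phi (umRi U a) c - phi a (umLi U c)).
rewrite /= in h2; lra.
Qed.

Let selfadjoint_estimate a b c : star b = b ->
  nrm (defect a b c) <= 144 * al * (nrm a * nrm b * nrm c).
Proof.
move=> b_sa; have [b0|b0] := eqVneq (nrm b) 0.
  rewrite (nrm_eq0 b0) -(scale0r (0 : A)) defectZ scale0r nrm0.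
  by rewrite scale0r nrm0 mulr0 mul0r mulr0.
have bp : 0 < nrm b by rewrite lt_def b0 nrm_ge0.
set b' := (nrm b)^-1%:C *: b.
have bE : b = (nrm b)%:C *: b'.
  by rewrite /b' scalerA -rmorphM divff// rmorph1 scale1r.
have b'1 : nrm b' = 1.
  by rewrite /b' nrmZ cabsR ger0_norm ?invr_ge0 ?ltW// mulVf.
have b'sa : star b' = b'.
  rewrite /b' starZ b_sa; congr (_ *: _).
  by apply/eqP; rewrite eq_complex /= oppr0 !eqxx.
have -> : 144 * al * (nrm a * nrm b * nrm c) = nrm b * (144 * al * (nrm a * nrm c)) by ring.
rewrite {1}bE defectZ nrmZ cabsR ger0_norm ?nrm_ge0// ler_wpM2l ?nrm_ge0//.
by apply: unit_selfadjoint_estimate; rewrite ?b'1.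
Qed.

(** The real and imaginary parts of b each contribute 144. *)
Lemma cstar_estimate a b c :
  nrm (phi (mul a b) c - phi a (mul b c)) <= 288 * al * (nrm a * nrm b * nrm c).
Proof.
pose b1 := 2^-1 *: (b + star b); pose b2 := (2 * 'i)^-1 *: (b - star b).
have conj_half : (2^-1 : R[i])^* = 2^-1 by rewrite fmorphV rmorph_nat.
have ic : ('i : R[i])^* = - 'i by apply/eqP; rewrite eq_complex /= oppr0 !eqxx.
have conj_i : ((2 * 'i : R[i])^-1)^* = - (2 * 'i)^-1.
  by rewrite fmorphV rmorphM rmorph_nat -invrN -mulrN; congr (_ * _)^-1; exact: ic.
have b1sa : star b1 = b1 by rewrite /b1 starZ starD starK conj_half addrC.
have b2sa : star b2 = b2.
  by rewrite /b2 starZ starD starN starK conj_i scaleNr -scalerN opprD opprK addrC.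
have i0 : 'i != 0 :> R[i] by rewrite unit_neq0// cabsi.
have bE : b = b1 + 'i *: b2.
  rewrite /b1 /b2 scalerA (_ : 'i * (2 * 'i)^-1 = 2^-1); last by field.
  rewrite -scalerDr (_ : b + star b + (b - star b) = b + b) ?scalerDr -?scalerDl; last by zmod_identity.
  by rewrite (_ : 2^-1 + 2^-1 = 1) ?scale1r//; field.
have n1 : nrm b1 <= nrm b.
  by rewrite nrm_half; have := nrmD b (star b); rewrite nrm_star; lra.
have n2 : nrm b2 <= nrm b.
  rewrite nrmZ cabsV cabsM cabsi cabsRn mulr1.
  by have := nrmB b (star b); rewrite nrm_star; lra.
rewrite {1 2}bE -/(defect _ _ _) defectD (defectZ 'i) (le_trans (nrmD _ _))//.
rewrite nrmZ cabsi mul1r.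
have e b' : star b' = b' -> nrm b' <= nrm b ->
    nrm (defect a b' c) <= 144 * al * (nrm a * nrm b * nrm c).
  move=> b'sa b'b; rewrite (le_trans (selfadjoint_estimate _ _ b'sa))//.
  by rewrite ler_wpM2l ?mulr_ge0// ler_wpM2r ?nrm_ge0// ler_wpM2l ?nrm_ge0.
have := e _ b1sa n1; have := e _ b2sa n2; lra.
Qed.

End form.
End cstar.

Lemma constant_ge288 {R : realType} : 288 <= 288 * pi * (1 + Num.sqrt 2) :> R.
Proof.
have p2 : 2 <= pi :> R by exact: pi_ge2.
have s0 : 0 <= Num.sqrt 2 :> R by exact: sqrtr_ge0.
nra.
Qed.

Theorem cstar_strong_property_B {R : realType} (A : completeNormedModType R[i])
    (mul : {bilinear A -> A -> A}) (star : A -> A) :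
  is_cstar_algebra mul star ->
  strong_property_B mul (288 * pi * (1 + Num.sqrt 2)).
Proof.
move=> H; have c := @constant_ge288 R; apply: strong_property_BP.
  by apply: lt_le_trans c; rewrite ltr0n.
move=> X phi M al phi_le M0 al0 phi_al a b c'.
rewrite (le_trans (cstar_estimate H phi_le M0 al0 phi_al a b c'))//.
by rewrite !ler_wpM2r ?mulr_ge0 ?nrm_ge0.
Qed.

(** * Topology of locally compact groups *)

Section compactness.
Context {R : realType} {G : ptopologicalType}.

(** Tube lemma: joint continuity is uniform in the variable of a compact set. *)
Lemma near_compact_uniform (T : topologicalType) (F : T -> G -> R) (K : set G) t0 (e : R) :
  continuous (fun p : T * G => F p.1 p.2) -> compact K -> 0 < e ->
  \forall t \near t0, forall x, K x -> `|F t x - F t0 x| < e.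
Proof.
move=> Fc /compact_near_coveringP cK e0.
apply: (cK T (nbhs t0) (fun t x => `|F t x - F t0 x| < e)) => x Kx.
have e20 : 0 < e / 2 by rewrite divr_gt0.
have /cvgrPdist_lt/(_ _ e20)[[A B] /= [At Bx] AB] := Fc (t0, x).
exists (B, A) => //= -[x' t] /= [Bx' At'].
have h1 := AB (t, x') (conj At' Bx').
have h2 := AB (t0, x') (conj (nbhs_singleton At) Bx').
rewrite /= in h1 h2; rewrite (splitr e).
have -> : F t x' - F t0 x' = (F t0 x - F t0 x') - (F t0 x - F t x') by ring.
by rewrite (le_lt_trans (ler_normB _ _))// ltrD.
Qed.

Hypothesis Gh : hausdorff_space G.
Hypothesis Gl : locally_compact [set: G].

Lemma precompact_open_superset (K : set G) : compact K ->
  exists W, [/\ open W, K `<=` W & compact (closure W)].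
Proof.
move=> cK.
have exB : forall x : G, exists B : set G, [/\ nbhs x B, compact B & closed B].
  move=> x; have [B Bx [cB clB]] := Gl (I : [set: G] x).
  exists B; split => //; move: Bx; rewrite /within /=; apply: filterS => y; exact.
have [B HB] := choice exB.
have : cover_compact K by rewrite -compact_cover.
move=> /(_ G setT (fun x => interior (B x))) []; first by move=> *; exact: open_interior.
  by move=> x Kx; exists x => //; have [Bx _ _] := HB x.
move=> D _ KD; exists (\bigcup_(x in [set` D]) interior (B x)); split => //.
  by apply: bigcup_open => *; exact: open_interior.
set W := \bigcup_(_ in _) _; set C := \bigcup_(x in [set` D]) B x.
have cC : compact C.
  rewrite /C -bigsetU_fset_set//; apply: bigsetU_compact.
  by move=> x _; have [_ cB _] := HB x; exact: cB.
apply: (subclosed_compact (@closed_closure _ W) cC).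
rewrite [X in _ `<=` X](closure_id C).1; last exact: compact_closed.
apply: closureS => x [y Dy /interior_subset yx]; by exists y.
Qed.

(** The one-point compactification is compact Hausdorff, hence normal, and
    provides the separating function; intersecting U with a precompact
    neighbourhood of K makes its support compact. *)
Lemma compact_open_urysohn (K U : set G) : compact K -> open U -> K `<=` U ->
  exists f : G -> R, [/\ continuous f, forall x, 0 <= f x <= 1,
    forall x, K x -> f x = 1, forall x, ~ U x -> f x = 0 &
    exists2 C, compact C & forall x, ~ C x -> f x = 0].
Proof.
move=> cK oU KU; have [W [oW KW cW]] := precompact_open_superset cK.
(* Continuous functions are constructed on a normal space containing G. *)
pose opc := one_point_compactification G.
have hO : hausdorff_space opc by exact: one_point_compactification_hausdorff.
have /normal_separatorP nO : normal_space opc.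
  by apply: compact_normal => //; exact: one_point_compactification_compact.
pose V := U `&` W.
have oV : @open opc (Some @` V).
  by apply: one_point_compactification_open_some; exact: openI.
have cK' : @closed opc (Some @` K).
  apply: compact_closed => //; apply: continuous_compact => //.
  by apply: continuous_subspaceT => x; exact: one_point_compactification_some_continuous.
have VK : (~` (Some @` V)) `&` (Some @` K : set opc) = set0.
  rewrite -subset0 => -[x|] [/= nV [y Ky]] // [yx]; subst y.
  by apply: nV; exists x => //; split; [exact: KU|exact: KW].
have [f [fc f01 f0 f1]] := (@uniform_separatorP opc R _ _).1 (nO R _ _ (open_closedC oV) cK' VK).
exists (f \o Some); split => [|x|x Kx|x nU|].
- move=> x; apply: (@continuous_comp _ _ _ (Some : G -> opc) f); last exact: fc.
  exact: one_point_compactification_some_continuous.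
- by have := f01 (f (Some x)) (ex_intro2 _ _ (Some x) I erefl); rewrite /= in_itv.
- by apply: f1; exists (Some x) => //; exists x.
- by apply: f0; exists (Some x) => //= -[y [Uy _] [yx]]; subst y.
- exists (closure W) => // x nW; apply: f0; exists (Some x) => //= -[y [_ Wy] [yx]].
  by subst y; apply: nW; exact: subset_closure.
Qed.

End compactness.

Section group_topology.
Context {G : topologicalGroupType}.

Lemma mulgl_continuous (x : G) : continuous (fun y : G => (x * y)%g).
Proof.
move=> y; apply: (@continuous_comp _ _ _ (fun y => (x, y)) (fun p : G * G => (p.1 * p.2)%g)).
  by apply: cvg_pair; [exact: cvg_cst|exact: cvg_id].
exact: mulg_continuous.
Qed.

Lemma mulgr_continuous (x : G) : continuous (fun y : G => (y * x)%g).
Proof.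
move=> y; apply: (@continuous_comp _ _ _ (fun y => (y, x)) (fun p : G * G => (p.1 * p.2)%g)).
  by apply: cvg_pair; [exact: cvg_id|exact: cvg_cst].
exact: mulg_continuous.
Qed.

Lemma continuous_mulg (T : topologicalType) (f g : T -> G) :
  continuous f -> continuous g -> continuous (fun t => (f t * g t)%g).
Proof.
move=> cf cg t; apply: (@continuous_comp _ _ _ (fun t => (f t, g t)) (fun p : G * G => (p.1 * p.2)%g)).
  by apply: cvg_pair; [exact: cf|exact: cg].
exact: mulg_continuous.
Qed.

Lemma continuous_invg (T : topologicalType) (f : T -> G) :
  continuous f -> continuous (fun t => (f t)^-1%g).
Proof. by move=> cf t; apply: continuous_comp; [exact: cf|exact: invg_continuous]. Qed.

Lemma compact_mulg (K L : set G) : compact K -> compact L ->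
  compact [set (p.1 * p.2)%g | p in K `*` L].
Proof.
move=> cK cL; apply: continuous_compact; last exact: compact_setX.
by apply: continuous_subspaceT; exact: mulg_continuous.
Qed.

Lemma compact_invg (K : set G) : compact K -> compact [set (x^-1)%g | x in K].
Proof.
move=> cK; apply: continuous_compact => //.
by apply: continuous_subspaceT; exact: invg_continuous.
Qed.

Lemma compact_image_mulgl (x : G) (K : set G) : compact K -> compact [set (x * y)%g | y in K].
Proof.
move=> cK; apply: continuous_compact => //.
by apply: continuous_subspaceT; exact: mulgl_continuous.
Qed.

Lemma continuous_fst2 (T U : topologicalType) : continuous (fun p : T * U => p.1).
Proof. by move=> p; exact: cvg_fst. Qed.
Lemma continuous_snd2 (T U : topologicalType) : continuous (fun p : T * U => p.2).
Proof. by move=> p; exact: cvg_snd. Qed.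

End group_topology.

(** * Compactly supported functions and the Haar integral *)

Section borel_functions.
Context {R : realType} {G : topologicalGroupType}.

Lemma open_borel (U : set G) : open U -> measurable (U : set (borel G)).
Proof. exact: sub_sigma_algebra. Qed.

Lemma closed_borel (U : set G) : closed U -> measurable (U : set (borel G)).
Proof.
by move=> cU; rewrite -(setCK U); apply: measurableC; apply: open_borel; rewrite openC.
Qed.

Lemma continuous_borel (f : G -> R) : continuous f -> measurable_fun setT (f : borel G -> R).
Proof.
move=> /continuousP cf; apply: (measurability _ (RGenOpens.measurableE R)).
move=> _ [_ [a [b ->] <-]]; rewrite setTI; apply: open_borel; apply: cf.
exact: interval_open.
Qed.

Lemma continuous_borel_map (h : G -> G) : continuous h ->
  measurable_fun setT (h : borel G -> borel G).
Proof.
move=> /continuousP ch; apply: (@measurability _ _ (borel G) (borel G) setT h (@open G) erefl).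
by move=> _ [A oA <-]; rewrite setTI; apply: open_borel; exact: ch.
Qed.

Definition Cc (f : G -> R) :=
  continuous f /\ exists2 K, compact K & forall x, ~ K x -> f x = 0.

End borel_functions.
Arguments Cc {R G}.

Section haar.
Context {R : realType} {G : topologicalGroupType} (mu : {measure set (borel G) -> \bar R}).
Hypotheses (Gh : hausdorff_space G) (Gl : locally_compact [set: G])
  (Hmu : is_left_haar_measure mu).

Implicit Types f g : G -> R.

Definition integ (f : G -> R) := mu.-integrable setT (EFin \o f : borel G -> \bar R).
Definition realint (f : G -> R) : R := \int[mu]_x (f : borel G -> R) x.
Local Notation J := realint.

Lemma integ_measurable f : integ f -> measurable_fun setT (f : borel G -> R).
Proof. by move=> /measurable_int /measurable_EFinP. Qed.

Lemma integD f g : integ f -> integ g -> integ (fun x => f x + g x).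
Proof.
move=> fi gi; rewrite /integ (_ : _ \o _ = ((EFin \o f) \+ (EFin \o g))%E)//.
exact: integrableD.
Qed.

Lemma integZ k f : integ f -> integ (fun x => k * f x).
Proof.
by move=> fi; rewrite /integ (_ : _ \o _ = (fun x => k%:E * (EFin \o f) x)%E)//; exact: integrableZl.
Qed.

Lemma integN f : integ f -> integ (fun x => - f x).
Proof. by move=> /(integZ (-1)); under eq_fun do rewrite mulN1r. Qed.

Lemma integB f g : integ f -> integ g -> integ (fun x => f x - g x).
Proof. by move=> fi gi; apply: integD => //; exact: integN. Qed.

Lemma integ0 : integ (fun=> 0).
Proof. exact: integrable0. Qed.

Lemma integ_abs f : integ f -> integ (fun x => `|f x|).
Proof. exact: integrable_norm. Qed.

Lemma le_integ f g : measurable_fun setT (f : borel G -> R) -> integ g ->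
  (forall x, `|f x| <= g x) -> integ f.
Proof.
move=> mf gi fg; apply: le_integrable gi => //; first exact/measurable_EFinP.
move=> x _ /=; rewrite lee_fin (le_trans (fg x))//; exact: ler_norm.
Qed.

Lemma integ_sum (I : eqType) (r : seq I) (F : I -> G -> R) :
  (forall i, i \in r -> integ (F i)) -> integ (fun x => \sum_(i <- r) F i x).
Proof.
elim: r => [|i r IH] Fi; first by under eq_fun do rewrite big_nil; exact: integ0.
under eq_fun do rewrite big_cons; apply: integD; first by apply: Fi; rewrite mem_head.
by apply: IH => j jr; apply: Fi; rewrite inE jr orbT.
Qed.

Lemma JD f g : integ f -> integ g -> J (fun x => f x + g x) = J f + J g.
Proof. exact: RintegralD. Qed.

Lemma JB f g : integ f -> integ g -> J (fun x => f x - g x) = J f - J g.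
Proof. exact: RintegralB. Qed.

Lemma JZ k f : integ f -> J (fun x => k * f x) = k * J f.
Proof. exact: RintegralZl. Qed.

Lemma J0 : J (fun=> 0) = 0.
Proof. by rewrite /J /Rintegral integral0. Qed.

Lemma J_sum (I : eqType) (r : seq I) (F : I -> G -> R) :
  (forall i, i \in r -> integ (F i)) ->
  J (fun x => \sum_(i <- r) F i x) = \sum_(i <- r) J (F i).
Proof.
elim: r => [|i r IH] Fi.
  by rewrite big_nil -[RHS]J0; congr J; apply/funext => x; rewrite big_nil.
have Fr j : j \in r -> integ (F j) by move=> jr; apply: Fi; rewrite inE jr orbT.
rewrite big_cons -IH// -JD//; last exact: integ_sum.
  by congr J; apply/funext => x; rewrite big_cons.
by apply: Fi; rewrite mem_head.
Qed.

Lemma J_le f g : integ f -> integ g -> (forall x, f x <= g x) -> J f <= J g.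
Proof. by move=> fi gi fg; apply: le_Rintegral. Qed.

Lemma J_ge0 f : (forall x, 0 <= f x) -> 0 <= J f.
Proof. by move=> f0; apply: Rintegral_ge0. Qed.

Lemma J_abs f : integ f -> `|J f| <= J (fun x => `|f x|).
Proof. exact: le_normr_Rintegral. Qed.

Lemma J_EFin f : integ f -> (J f)%:E = (\int[mu]_x (f x)%:E)%E.
Proof. by move=> fi; rewrite /J /Rintegral fineK//; exact: integrable_fin_num fi. Qed.

Lemma integ_indic (E : set (borel G)) : measurable E -> (mu E < +oo)%E -> integ (\1_E).
Proof.
move=> mE Ef; apply/integrableP; split; first exact/measurable_EFinP.
under eq_integral do rewrite /= ger0_norm//.
by rewrite integral_indic// setIT.
Qed.

Lemma J_indic (E : set (borel G)) : measurable E -> J (\1_E) = fine (mu E).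
Proof.
by move=> mE; rewrite /J /Rintegral integral_indic// setIT.
Qed.

Lemma compact_borel (K : set G) : compact K -> measurable (K : set (borel G)).
Proof. by move=> cK; apply: closed_borel; exact: compact_closed. Qed.

Lemma Cc_bounded f : Cc f -> exists2 M, 0 <= M & forall x, `|f x| <= M.
Proof.
move=> [cf [K cK fK]].
have /compact_bounded[M [_ MP]] : compact (f @` K).
  by apply: continuous_compact => //; exact: continuous_subspaceT.
exists (`|M| + 1); first by rewrite addr_ge0.
move=> x; have [Kx|/fK ->] := pselect (K x); last by rewrite normr0 addr_ge0.
by apply: MP; [rewrite (le_lt_trans (ler_norm M))// ltrDl|exists x].
Qed.

Lemma compact_support_integ f (K : set G) (M : R) :
  measurable_fun setT (f : borel G -> R) -> compact K ->
  (forall x, ~ K x -> f x = 0) -> (forall x, `|f x| <= M) -> integ f.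
Proof.
move=> mf cK fK fM; have mK := compact_borel cK.
apply: (@le_integ _ (fun x => M * \1_(K : set (borel G)) x)) => //.
  by apply: integZ; apply: integ_indic => //; exact: haar_compact.
move=> x; rewrite indicE; have [Kx|nK] := pselect (K x).
  by rewrite mem_set// mulr1.
by rewrite memNset// mulr0 fK// normr0.
Qed.

Lemma Cc_integ f : Cc f -> integ f.
Proof.
move=> fc; have [M _ fM] := Cc_bounded fc; case: fc => cf [K cK fK].
by apply: compact_support_integ fK fM => //; exact: continuous_borel.
Qed.

Lemma Cc_abs f : Cc f -> Cc (fun x => `|f x|).
Proof.
move=> [cf [K cK fK]]; split; last by exists K => // x /fK ->; rewrite normr0.
by move=> x; apply: continuous_comp; [exact: cf|exact: norm_continuous].
Qed.

Lemma CcB f g : Cc f -> Cc g -> Cc (fun x => f x - g x).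
Proof.
move=> [cf [K cK fK]] [cg [L cL gL]]; split.
  by move=> x; apply: continuousB; [exact: cf|exact: cg].
exists (K `|` L); first exact: compactU.
by move=> x /not_orP[/fK -> /gL ->]; rewrite subr0.
Qed.

Lemma CcM f g : Cc f -> continuous g -> Cc (fun x => f x * g x).
Proof.
move=> [cf [K cK fK]] cg; split; last by exists K => // x /fK ->; rewrite mul0r.
by move=> x; apply: continuousM; [exact: cf|exact: cg].
Qed.

Lemma Cc_comp_homeo f (h k : G -> G) : continuous h -> continuous k -> cancel h k ->
  cancel k h -> Cc f -> Cc (f \o h).
Proof.
move=> ch ck hk kh [cf [K cK fK]]; split.
  by move=> x; apply: continuous_comp; [exact: ch|exact: cf].
exists (k @` K).
  by apply: continuous_compact => //; exact: continuous_subspaceT.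
by move=> x nx; apply: fK => Khx; apply: nx; exists (h x).
Qed.

Lemma Cc_mulgl f x : Cc f -> Cc (fun y => f (x * y)%g).
Proof.
apply: (@Cc_comp_homeo _ (fun y => (x * y)%g) (fun y => (x^-1 * y)%g)) => [|||y] /=.
- exact: mulgl_continuous.
- exact: mulgl_continuous.
- by move=> y; rewrite mulKg.
- by rewrite mulVKg.
Qed.

Lemma Cc_mulgr f x : Cc f -> Cc (fun y => f (y * x)%g).
Proof.
apply: (@Cc_comp_homeo _ (fun y => (y * x)%g) (fun y => (y * x^-1)%g)) => [|||y] /=.
- exact: mulgr_continuous.
- exact: mulgr_continuous.
- by move=> y; rewrite mulgK.
- by rewrite mulgVK.
Qed.

Lemma Cc_invg f : Cc f -> Cc (fun y => f (y^-1)%g).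
Proof.
apply: (@Cc_comp_homeo _ (fun y => y^-1)%g (fun y => y^-1)%g) => [|||y] /=.
- exact: invg_continuous.
- exact: invg_continuous.
- by move=> y; rewrite invgK.
- by rewrite invgK.
Qed.

Lemma pushforward_mulgl x (E : set (borel G)) : measurable E ->
  pushforward mu (fun y : borel G => (x * y)%g : borel G) E = mu E.
Proof.
move=> mE; rewrite /pushforward -(haar_left_invariant Hmu x^-1%g mE).
congr (mu _); apply/seteqP; split => y /=.
  by move=> Ey; exists (x * y)%g => //; rewrite mulKg.
by move=> [z Ez <-]; rewrite mulVKg.
Qed.

Lemma ge0_integral_mulgl x (f : G -> \bar R) :
  measurable_fun setT (f : borel G -> \bar R) -> (forall y, 0 <= f y)%E ->
  (\int[mu]_y f (x * y)%g = \int[mu]_y f y)%E.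
Proof.
move=> mf f0.
have mx : measurable_fun setT (fun y : borel G => (x * y)%g : borel G).
  by apply: continuous_borel_map; exact: mulgl_continuous.
rewrite -(@ge0_integral_pushforward _ _ _ _ R _ mx mu setT f)//.
by apply: eq_measure_integral => E mE _; exact: pushforward_mulgl.
Qed.

Lemma measurable_mulgl d (T : measurableType d) x (f : G -> T) :
  measurable_fun setT (f : borel G -> T) ->
  measurable_fun setT (fun y : borel G => f (x * y)%g).
Proof.
move=> mf; apply: (measurableT_comp mf).
by apply: continuous_borel_map; exact: mulgl_continuous.
Qed.

Lemma integ_mulgl x f : integ f -> integ (fun y => f (x * y)%g).
Proof.
move=> fi; have mf := integ_measurable fi; apply/integrableP; split.
  by apply/measurable_EFinP; exact: measurable_mulgl.
have /integrableP[_] := fi.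
rewrite -(@ge0_integral_mulgl x (fun y => `|(f y)%:E|%E))//.
by apply: measurableT_comp => //; exact/measurable_EFinP.
Qed.

Lemma J_mulgl x f : measurable_fun setT (f : borel G -> R) -> J (fun y => f (x * y)%g) = J f.
Proof.
move=> mf; rewrite /J /Rintegral; congr fine; rewrite [LHS]integralE [RHS]integralE.
have mfE : measurable_fun setT (EFin \o f : borel G -> \bar R) by exact/measurable_EFinP.
congr (_ - _)%E.
  rewrite -[RHS](@ge0_integral_mulgl x (EFin \o f)^\+%E)//; [by apply: eq_integral => y _; rewrite !funeposE|exact: measurable_funepos].
rewrite -[RHS](@ge0_integral_mulgl x (EFin \o f)^\-%E)//; [by apply: eq_integral => y _; rewrite !funenegE|exact: measurable_funeneg].
Qed.

(** A compact set of positive measure exists by inner regularity, and it is covered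
    by finitely many left translates of a given nonempty open set. *)
Lemma haar_open_gt0 (U : set G) : open U -> U !=set0 -> (0 < mu U)%E.
Proof.
move=> oU [u Uu]; rewrite lt0e measure_ge0 andbT; apply/negP => /eqP U0.
have mU := open_borel oU.
have K0 (K : set G) : compact K -> mu K = 0%E.
  move=> cK; have mK := compact_borel cK.
  move: cK; rewrite compact_cover => /(_ G setT (fun x => [set (x * u^-1 * y)%g | y in U])) [].
  - move=> x _; have -> : [set (x * u^-1 * y)%g | y in U] =
        (fun y => ((x * u^-1)^-1 * y)%g) @^-1` U.
      apply/seteqP; split => y /=; first by move=> [z Uz <-]; rewrite mulKg.
      by move=> Uy; exists ((x * u^-1)^-1 * y)%g => //; rewrite mulVKg.
    by move/continuousP: (@mulgl_continuous G (x * u^-1)^-1%g); exact.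
  - by move=> x _; exists x => //; exists u => //; rewrite mulgVK.
  move=> D _ KD; apply/eqP; rewrite eq_le measure_ge0 andbT.
  have mD x : measurable ([set (x * u^-1 * y)%g | y in U] : set (borel G)).
    have -> : [set (x * u^-1 * y)%g | y in U] = (fun y => ((x * u^-1)^-1 * y)%g) @^-1` U.
      apply/seteqP; split => y /=; first by move=> [z Uz <-]; rewrite mulKg.
      by move=> Uy; exists ((x * u^-1)^-1 * y)%g => //; rewrite mulVKg.
    by rewrite -[X in measurable X]setTI; apply: (continuous_borel_map (@mulgl_continuous G _)).
  have {}KD : K `<=` \big[setU/set0]_(x <- D) [set (x * u^-1 * y)%g | y in U].
    by move=> x /KD [y Dy xy]; rewrite -bigcup_seq; exists y.
  have mB : measurable (\big[setU/set0]_(x <- D) [set (x * u^-1 * y)%g | y in U] : set (borel G)).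
    by apply: bigsetU_measurable => x _; exact: mD.
  apply: (@le_trans _ _ (mu (\big[setU/set0]_(x <- D) [set (x * u^-1 * y)%g | y in U]))).
    by apply: le_measure; rewrite ?inE.
  elim: (D : seq _) => [|x s IH]; first by rewrite big_nil measure0.
  rewrite big_cons; apply: (le_trans (measureU2 _ (mD x) _)).
    by apply: bigsetU_measurable => y _; exact: mD.
  rewrite -[leRHS]adde0; apply: leeD; last exact: IH.
  by have := haar_left_invariant Hmu (x * u^-1)%g mU; rewrite U0 => /= ->.
have := haar_inner_regular Hmu (@openT G); rewrite (_ : [set mu K | K in _] = [set 0%E]).
  by rewrite ereal_sup1 => h; have := haar_neq0 Hmu; rewrite h eqxx.
apply/seteqP; split => e /=; first by move=> [K [cK _] <-]; rewrite K0.
by move=> ->; exists set0; rewrite ?measure0//; split => //; exact: compact0.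
Qed.

End haar.

(** * Fubini's theorem for compactly supported continuous functions *)

Section fubini.
Context {R : realType} {G : topologicalGroupType} (mu : {measure set (borel G) -> \bar R}).
Hypotheses (Gh : hausdorff_space G) (Gl : locally_compact [set: G])
  (Hmu : is_left_haar_measure mu).
Implicit Types (f g : G -> R) (K : set G).
Local Notation J := (realint mu).
Local Notation integ := (integ mu).

Definition ind K (x : G) : R := \1_(K : set (borel G)) x.
Definition mass K : R := fine (mu K).

Lemma ind_in K x : K x -> ind K x = 1.
Proof. by move=> Kx; rewrite /ind indicE mem_set. Qed.

Lemma ind_out K x : ~ K x -> ind K x = 0.
Proof. by move=> Kx; rewrite /ind indicE memNset. Qed.

Lemma ind_ge0 K x : 0 <= ind K x.
Proof. by rewrite /ind indicE. Qed.

Lemma ind_le1 K x : ind K x <= 1.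
Proof. by rewrite /ind indicE; case: (_ \in _). Qed.

Lemma mass_ge0 K : 0 <= mass K.
Proof. exact: fine_ge0. Qed.

Lemma compact_integ_ind K : compact K -> integ (ind K).
Proof.
by move=> cK; apply: integ_indic; [exact: compact_borel|exact: haar_compact].
Qed.

Lemma borel_J_ind (K : set (borel G)) : measurable K -> J (ind K) = mass K.
Proof. exact: J_indic. Qed.

Lemma J_ind K : compact K -> J (ind K) = mass K.
Proof. by move=> cK; apply: J_indic; exact: compact_borel. Qed.

Lemma ind_bounded_integ g K (e : R) : measurable_fun setT (g : borel G -> R) ->
  compact K -> (forall x, `|g x| <= e * ind K x) -> integ g.
Proof. by move=> mg cK; apply: le_integ => //; apply: integZ; exact: compact_integ_ind. Qed.

Lemma J_ind_bounded g K (e : R) : measurable_fun setT (g : borel G -> R) ->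
  compact K -> (forall x, `|g x| <= e * ind K x) -> `|J g| <= e * mass K.
Proof.
move=> mg cK ge; have gi := ind_bounded_integ mg cK ge.
rewrite (le_trans (J_abs gi))// -J_ind// -JZ; last exact: compact_integ_ind.
by apply: J_le => //; [exact: integ_abs|apply: integZ; exact: compact_integ_ind].
Qed.

(** Uniform continuity with a common compact support, in a form ready to be
    integrated. *)
Lemma near_supported_uniform (T : topologicalType) (F : T -> G -> R) K t0 (e : R) :
  continuous (fun p : T * G => F p.1 p.2) -> compact K ->
  (\forall t \near t0, forall x, ~ K x -> F t x = 0) -> 0 < e ->
  \forall t \near t0, forall x, `|F t x - F t0 x| <= e * ind K x.
Proof.
move=> Fc cK F0 e0; have F00 := nbhs_singleton F0.
apply: filterS2 F0 (near_compact_uniform t0 Fc cK e0) => t Ft0 Ft x.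
have [Kx|nK] := pselect (K x); first by rewrite ind_in// mulr1 ltW// Ft.
by rewrite Ft0// F00// subrr normr0 ind_out// mulr0.
Qed.

Lemma section_continuous (T U : topologicalType) (V : topologicalType)
  (F : T -> U -> V) t : continuous (fun p : T * U => F p.1 p.2) -> continuous (F t).
Proof.
move=> Fc x; apply: (@continuous_comp _ _ _ (fun x => (t, x)) (fun p : T * U => F p.1 p.2)).
  by apply: cvg_pair; [exact: cvg_cst|exact: cvg_id].
exact: Fc.
Qed.

Lemma J_parameter_continuous (T : topologicalType) (F : T -> G -> R) (q : G -> R) (M : R) K :
  continuous (fun p : T * G => F p.1 p.2) -> compact K ->
  measurable_fun setT (q : borel G -> R) -> (forall x, `|q x| <= M) ->
  forall t0, (\forall t \near t0, forall x, ~ K x -> F t x = 0) ->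
  {for t0, continuous (fun t => J (fun x => F t x * q x))}.
Proof.
move=> Fc cK mq qM t0 F0.
have M0 : 0 <= M := le_trans (normr_ge0 _) (qM point).
apply/cvgrPdist_le => e e0.
have d0 : 0 < e / (M * mass K + 1).
  by rewrite divr_gt0// ltr_wpDl// mulr_ge0 ?mass_ge0.
have mF t : measurable_fun setT (F t : borel G -> R).
  by apply: continuous_borel; exact: section_continuous.
have iF t : (forall x, ~ K x -> F t x = 0) -> integ (fun x => F t x * q x).
  move=> Ft; have Fcc : Cc (F t) by split; [exact: section_continuous|exists K].
  have [B B0 FB] := Cc_bounded Fcc.
  apply: (@ind_bounded_integ _ K (B * M)) => //; first exact: measurable_funM.
  move=> x; have [Kx|nK] := pselect (K x).
    by rewrite ind_in// mulr1 normrM ler_pM.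
  by rewrite Ft// mul0r normr0 ind_out// mulr0.
have F00 := nbhs_singleton F0.
apply: filterS2 F0 (near_supported_uniform Fc cK F0 d0) => t Ft0 Ft.
rewrite -JB; [|exact: iF..].
apply: (@le_trans _ _ (e / (M * mass K + 1) * M * mass K)).
  apply: J_ind_bounded => //.
    by apply: measurable_funB; exact: measurable_funM.
  move=> x; rewrite -mulrBl normrM distrC mulrAC ler_pM//.
rewrite -mulrA mulrAC ler_pdivrMr; last by rewrite ltr_wpDl// mulr_ge0 ?mass_ge0.
by rewrite ler_pM2l// lerDl.
Qed.

(** Replaces Riemann partitions: a property that holds near each point holds on
    the pieces of a finite Borel partition of a compact set. *)
Lemma finite_borel_partition K (P : G -> G -> Prop) : compact K ->
  (forall t0, \forall t \near t0, P t0 t) ->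
  exists s : seq (G * set (borel G)),
    [/\ forall p, p \in s -> measurable p.2,
        forall p t, p \in s -> p.2 t -> P p.1 t &
        forall t, \sum_(p <- s) ind p.2 t = ind K t].
Proof.
move=> cK PP; have mK := compact_borel Gh cK.
pose O t0 := interior [set t | P t0 t].
have oO t0 : open (O t0) by exact: open_interior.
move: (cK); rewrite compact_cover => /(_ G setT O) [].
- by [].
- by move=> x Kx; exists x => //; exact: PP.
move=> D _ KD.
suff [s [sm sP sE]] : exists s : seq (G * set (borel G)),
    [/\ forall p, p \in s -> measurable p.2,
        forall p t, p \in s -> p.2 t -> P p.1 t &
        forall t, \sum_(p <- s) ind p.2 t =
          ind (K `&` \big[setU/set0]_(x <- D) O x) t].
  exists s; split=> // t; rewrite sE; congr (ind _ _).
  apply/setIidl => x /KD [y Dy xy]; rewrite -bigcup_seq; by exists y.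
elim: (D : seq G) => [|x r [s [sm sP sE]]].
  by exists [::]; split=> // t; rewrite !big_nil setI0 ind_out.
pose U := \big[setU/set0]_(y <- r) O y.
have oU : open U by rewrite /U -bigcup_seq; apply: bigcup_open => y _.
exists ((x, (K `&` O x) `\` U) :: s); split => [p|p t|t].
- rewrite inE => /predU1P[->|/sm//]; apply: measurableD; last exact: open_borel.
  by apply: measurableI => //; exact: open_borel.
- rewrite inE => /predU1P[->|ps]; last exact: sP.
  by move=> [[_ Oxt] _]; exact: (interior_subset Oxt).
- rewrite !big_cons sE /= -/U.
  have [Kt|nK] := pselect (K t); last first.
    rewrite !ind_out ?addr0//; first by move=> [].
      by move=> [].
    by move=> [[]].
  have [Ut|nU] := pselect (U t).
    rewrite [X in X + _]ind_out ?add0r; last by move=> [].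
    by rewrite !ind_in//; split => //; right.
  rewrite [X in _ + X]ind_out ?addr0; last by move=> [].
  have [Ot|nO] := pselect (O x t).
    by rewrite !ind_in//; split => //; left.
  rewrite !ind_out//; first by move=> [_ []].
  by move=> [[]].
Qed.

Lemma ind_le_seq (s : seq (G * set (borel G))) K p t :
  (forall t, \sum_(p <- s) ind p.2 t = ind K t) -> p \in s -> ind p.2 t <= ind K t.
Proof.
move=> sE ps; rewrite -sE (big_rem _ ps) /= lerDl sumr_ge0// => q _; exact: ind_ge0.
Qed.

Definition Cc2 (F : G -> G -> R) := continuous (fun p : G * G => F p.1 p.2) /\
  exists K1 K2, [/\ compact K1, compact K2 &
    forall t x, ~ (K1 t /\ K2 x) -> F t x = 0].

Lemma Cc2_swap F : Cc2 F -> Cc2 (fun x t => F t x).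
Proof.
move=> [Fc [K1 [K2 [c1 c2 F0]]]]; split; last first.
  by exists K2, K1; split=> // t x h; apply: F0 => -[? ?]; exact: h.
move=> p; apply: (@continuous_comp _ _ _ (fun p : G * G => (p.2, p.1)) (fun p : G * G => F p.1 p.2)).
  by apply: cvg_pair; [exact: cvg_snd|exact: cvg_fst].
exact: Fc.
Qed.

Lemma Cc2_section F t : Cc2 F -> Cc (F t).
Proof.
move=> [Fc [K1 [K2 [c1 c2 F0]]]]; split; first exact: section_continuous.
by exists K2 => // x nK; apply: F0 => -[].
Qed.

Lemma Cc2_integral F : Cc2 F -> Cc (fun t => J (F t)).
Proof.
move=> [Fc [K1 [K2 [c1 c2 F0]]]]; split; last first.
  exists K1 => // t nK; rewrite (_ : F t = fun=> 0) ?J0//.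
  by apply/funext => x; apply: F0 => -[].
have -> : (fun t => J (F t)) = (fun t => J (fun x => F t x * cst 1 x)).
  by apply/funext => t; congr J; apply/funext => x; rewrite mulr1.
move=> t0; apply: (@J_parameter_continuous _ F (cst 1) 1 K2) => //.
- by move=> x; rewrite normr1.
- by apply: nearW => t x nK; apply: F0 => -[].
Qed.

(** Both iterated integrals are close to the same sum over a partition of the
    support in the first variable.  Product measures would require
    sigma-finiteness and Borel sets of the product. *)
Lemma Cc_fubini F : Cc2 F -> J (fun t => J (F t)) = J (fun x => J (fun t => F t x)).
Proof.
move=> FF; have [Fc [K1 [K2 [c1 c2 F0]]]] := FF.
have F0' t x : ~ K2 x -> F t x = 0 by move=> nK; apply: F0 => -[].
have F0'' t x : ~ K1 t -> F t x = 0 by move=> nK; apply: F0 => -[].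
apply/eqP; rewrite -subr_eq0 -normr_eq0; apply/eqP.
apply: le_anti; rewrite normr_ge0 andbT.
apply/ler_addgt0Pr => e0 e0_gt0; rewrite add0r.
pose C := mass K1 * mass K2.
have C0 : 0 <= C by rewrite mulr_ge0 ?mass_ge0.
have [e e_gt0 eC] : exists2 e : R, 0 < e & e * C + e * C <= e0.
  exists (e0 / (2 * C + 1)); first by rewrite divr_gt0// ltr_wpDl// mulr_ge0.
  rewrite -mulrDr mulrAC ler_pdivrMr; last by rewrite ltr_wpDl// mulr_ge0.
  by rewrite ler_pM2l//; lra.
have near_F0 (t0 : G) : \forall t \near t0, forall x, ~ K2 x -> F t x = 0.
  by apply: nearW => t; exact: F0'.
have [s [sm sP sE]] := @finite_borel_partition K1
  (fun t0 t => forall x, `|F t x - F t0 x| <= e * ind K2 x) c1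
  (fun t0 => near_supported_uniform Fc c2 (near_F0 t0) e_gt0).
have iK1 := compact_integ_ind c1; have iK2 := compact_integ_ind c2.
have is_ (p : G * set (borel G)) : p \in s -> integ (ind p.2).
  move=> ps; apply: (@le_integ _ _ _ _ (ind K1)) => //.
    by apply: measurable_indic; exact: sm.
  by move=> t; rewrite ger0_norm ?ind_ge0//; exact: ind_le_seq sE ps.
pose S := \sum_(p <- s) mass p.2 * J (F p.1).
have iF t : integ (F t) by apply: Cc_integ => //; exact: Cc2_section.
have FE t x : `|F t x - \sum_(p <- s) ind p.2 t * F p.1 x| <= e * ind K1 t * ind K2 x.
  have [K1t|nK1] := pselect (K1 t); last first.
    rewrite F0''// big_seq big1 => [|p ps].
      by rewrite subr0 normr0 !mulr_ge0 ?ind_ge0// ltW.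
    suff -> : ind p.2 t = 0 by rewrite mul0r.
    by apply: le_anti; rewrite ind_ge0 andbT -(ind_out nK1) (ind_le_seq t sE ps).
  have -> : F t x - \sum_(p <- s) ind p.2 t * F p.1 x =
      \sum_(p <- s) ind p.2 t * (F t x - F p.1 x).
    rewrite -[X in X - _]mul1r -(ind_in K1t) -sE mulr_suml -sumrB.
    by apply: eq_bigr => p _; rewrite mulrBr.
  rewrite (le_trans (ler_norm_sum _ _ _))// mulrAC mulrC -sE mulr_suml.
  rewrite big_seq [leRHS]big_seq ler_sum// => p ps.
  rewrite normrM ger0_norm ?ind_ge0//.
  have [pt|npt] := pselect (p.2 t); last by rewrite ind_out// !mul0r.
  by rewrite ler_wpM2l ?ind_ge0//; exact: sP ps pt x.
have iF' x : integ (fun t => F t x).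
  by apply: Cc_integ => //; exact: (Cc2_section x (Cc2_swap FF)).
have A : `|J (fun t => J (F t)) - S| <= e * C.
  have ip p : p \in s -> integ (fun t => ind p.2 t * J (F p.1)).
    move=> ps; under eq_fun do rewrite mulrC; apply: integZ; exact: is_.
  have iS := integ_sum ip.
  have -> : S = J (fun t => \sum_(p <- s) ind p.2 t * J (F p.1)).
    rewrite J_sum// /S big_seq [RHS]big_seq; apply: eq_bigr => p ps.
    under [RHS]eq_Rintegral do rewrite mulrC.
    by rewrite [RHS]JZ ?is_// mulrC; congr (_ * _); rewrite borel_J_ind//; exact: sm.
  have iJ : integ (fun t => J (F t)) by apply: Cc_integ => //; exact: Cc2_integral.
  rewrite -JB// /C (mulrC (mass K1)) mulrA.
  apply: J_ind_bounded => //; first by apply: (@integ_measurable _ _ mu); exact: integB.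
  move=> t; rewrite (mulrAC e).
  have -> : J (F t) - \sum_(p <- s) ind p.2 t * J (F p.1) =
      J (fun x => F t x - \sum_(p <- s) ind p.2 t * F p.1 x).
    rewrite JB// ?J_sum//.
    - by congr (_ - _); apply: eq_bigr => p _; rewrite JZ.
    - by move=> p _; exact: integZ.
    - by apply: integ_sum => p _; exact: integZ.
  apply: J_ind_bounded => //; apply: (@integ_measurable _ _ mu); apply: integB => //.
  by apply: integ_sum => p _; exact: integZ.
have B : `|J (fun x => J (fun t => F t x)) - S| <= e * C.
  have ip p : p \in s -> integ (fun x => mass p.2 * F p.1 x).
    by move=> ps; exact: integZ.
  have iS := integ_sum ip.
  have -> : S = J (fun x => \sum_(p <- s) mass p.2 * F p.1 x).
    by rewrite J_sum//; apply: eq_bigr => p _; rewrite JZ.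
  have iJ : integ (fun x => J (fun t => F t x)).
    by apply: Cc_integ => //; exact: (Cc2_integral (Cc2_swap FF)).
  rewrite -JB// /C mulrA; apply: J_ind_bounded => //.
    by apply: (@integ_measurable _ _ mu); exact: integB.
  move=> x; rewrite (mulrAC e).
  have iq p : p \in s -> integ (fun t => ind p.2 t * F p.1 x).
    move=> ps; under eq_fun do rewrite mulrC; apply: integZ; exact: is_.
  have -> : J (fun t => F t x) - \sum_(p <- s) mass p.2 * F p.1 x =
      J (fun t => F t x - \sum_(p <- s) ind p.2 t * F p.1 x).
    rewrite JB// ?J_sum//; last exact: integ_sum.
    congr (_ - _); rewrite big_seq [RHS]big_seq; apply: eq_bigr => p ps.
    under [RHS]eq_Rintegral do rewrite mulrC.
    by rewrite [RHS]JZ ?is_// mulrC; congr (_ * _); rewrite borel_J_ind//; exact: sm.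
  apply: J_ind_bounded => //.
    by apply: (@integ_measurable _ _ mu); apply: integB => //; exact: integ_sum.
  by move=> t; rewrite mulrAC.
have -> : J (fun t => J (F t)) - J (fun x => J (fun t => F t x)) =
  (J (fun t => J (F t)) - S) - (J (fun x => J (fun t => F t x)) - S) by ring.
by rewrite (le_trans (ler_normB _ _))// (le_trans (lerD A B)).
Qed.

End fubini.

(** * The modular function *)

Record is_modular {R : realType} {G : topologicalGroupType}
    (mu : {measure set (borel G) -> \bar R}) (D : G -> R) : Prop := {
  modular_continuous : continuous D ;
  modular_gt0 : forall x, 0 < D x ;
  modularM : forall x z, D (x * z)%g = D x * D z ;
  modular_J : forall (g : G -> R) x, Cc g ->
    realint mu (fun y => g (y * x)%g) = D x * realint mu g ;
  modular_inv : forall f : G -> R, Cc f ->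
    realint mu (fun x => f x * D x) = realint mu (fun y => f (y^-1)%g) }.

Section modular_function.
Context {R : realType} {G : topologicalGroupType} (mu : {measure set (borel G) -> \bar R}).
Hypotheses (Gh : hausdorff_space G) (Gl : locally_compact [set: G])
  (Hmu : is_left_haar_measure mu).
Implicit Types (f g : G -> R) (K : set G).
Local Notation J := (realint mu).
Local Notation integ := (integ mu).
Local Notation mass := (mass mu).

Lemma Cc_J_gt0 f x0 : Cc f -> (forall x, 0 <= f x) -> 0 < f x0 -> 0 < J f.
Proof.
move=> fc f0 fx0; have [cf [K cK fK]] := fc.
pose U := f @^-1` [set t | f x0 / 2 < t].
have oU : open U by move/continuousP: cf; apply; exact: open_gt.
have Ux0 : U x0 by rewrite /U /= ltr_pdivrMr// mulr_natr mulr2n ltrDl.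
have UK : U `<=` K.
  move=> x Ux; apply: contrapT => /fK fx; move: Ux; rewrite /U /= fx.
  by rewrite ltNge divr_ge0// ltW.
have mU := open_borel oU.
have Ufin : (mu U < +oo)%E.
  apply: (@le_lt_trans _ _ (mu K)); last exact: haar_compact.
  by apply: le_measure; rewrite ?inE//; exact: compact_borel.
have iU : integ (ind U) by exact: integ_indic.
apply: (@lt_le_trans _ _ (f x0 / 2 * mass U)).
  rewrite mulr_gt0 ?divr_gt0//; apply: fine_gt0.
  by rewrite Ufin (haar_open_gt0 Gh Hmu oU)//; exists x0.
rewrite -borel_J_ind// -JZ//; apply: J_le => //.
- exact: integZ.
- exact: Cc_integ.
move=> x; have [Ux|nU] := pselect (U x); first by rewrite ind_in// mulr1 ltW.
by rewrite ind_out// mulr0.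
Qed.

Lemma Cc_bump (x0 : G) : exists f, [/\ Cc f, forall x, 0 <= f x & f x0 = 1].
Proof.
have [f [cf f01 f1 _ [C cC fC]]] := @compact_open_urysohn R G Gh Gl [set x0] setT
  (@compact_set1 _ x0) openT (fun _ _ => I).
exists f; split; [by split => //; exists C|by move=> x; case/andP: (f01 x)|exact: f1].
Qed.

(** Test h against h times a bump function. *)
Lemma continuous_J_separates (h : G -> R) : continuous h ->
  (forall f, Cc f -> J (fun x => f x * h x) = 0) -> forall x, h x = 0.
Proof.
move=> ch h0 x0; apply: contrapT => hx0.
have [k [kc k0 k1]] := Cc_bump x0.
have khc : Cc (fun x => k x * h x) by exact: CcM.
have := h0 _ khc; apply/eqP; rewrite gt_eqF//.
apply: (@Cc_J_gt0 _ x0); first exact: CcM.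
  by move=> x; rewrite -mulrA -expr2 mulr_ge0 ?sqr_ge0.
by rewrite k1 mul1r -expr2 exprn_even_gt0//=; exact/eqP.
Qed.

Lemma Cc2_mul_right f g : Cc f -> Cc g -> Cc2 (fun x y => f x * g (y * x)%g).
Proof.
move=> [cf [K cK fK]] [cg [L cL gL]]; split.
  move=> p; apply: continuousM.
    by apply: (@continuous_comp _ _ _ fst f); [exact: cvg_fst|exact: cf].
  apply: (@continuous_comp _ _ _ (fun p : G * G => (p.2 * p.1)%g) g); last exact: cg.
  by apply: continuous_mulg; [exact: continuous_snd2|exact: continuous_fst2].
exists K, [set (p.1 * p.2)%g | p in L `*` [set (x^-1)%g | x in K]]; split => //.
  by apply: compact_mulg => //; exact: compact_invg.
move=> x y nKL; have [Kx|/fK ->] := pselect (K x); last by rewrite mul0r.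
rewrite gL ?mulr0// => Lyx; apply: nKL; split=> //.
by exists ((y * x)%g, x^-1%g) => /=; [split=> //; exists x|rewrite mulgK].
Qed.

Lemma Cc2_conv f g : Cc f -> Cc g -> Cc2 (fun x y => f y * g (y^-1 * x)%g).
Proof.
move=> [cf [K cK fK]] [cg [L cL gL]]; split.
  move=> p; apply: continuousM.
    by apply: (@continuous_comp _ _ _ snd f); [exact: cvg_snd|exact: cf].
  apply: (@continuous_comp _ _ _ (fun p : G * G => (p.2^-1 * p.1)%g) g); last exact: cg.
  apply: continuous_mulg; last exact: continuous_fst2.
  by apply: continuous_invg; exact: continuous_snd2.
exists [set (p.1 * p.2)%g | p in K `*` L], K; split => //.
  exact: compact_mulg.
move=> x y nKL; have [Ky|/fK ->] := pselect (K y); last by rewrite mul0r.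
rewrite gL ?mulr0// => Lyx; apply: nKL; split=> //.
by exists (y, y^-1 * x)%g => //=; rewrite mulVKg.
Qed.

Lemma Cc2_conv_left f g : Cc f -> Cc g -> Cc2 (fun y x => g x * f (y^-1 * x)%g).
Proof.
move=> [cf [K cK fK]] [cg [L cL gL]]; split.
  move=> p; apply: continuousM.
    by apply: (@continuous_comp _ _ _ snd g); [exact: cvg_snd|exact: cg].
  apply: (@continuous_comp _ _ _ (fun p : G * G => (p.1^-1 * p.2)%g) f); last exact: cf.
  apply: continuous_mulg; last exact: continuous_snd2.
  by apply: continuous_invg; exact: continuous_fst2.
exists [set (p.1 * p.2)%g | p in L `*` [set (x^-1)%g | x in K]], L; split => //.
  by apply: compact_mulg => //; exact: compact_invg.
move=> y x nKL; have [Lx|/gL ->] := pselect (L x); last by rewrite mul0r.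
rewrite fK ?mulr0// => Kyx; apply: nKL; split=> //.
exists (x, (y^-1 * x)^-1%g) => /=; first by split=> //; exists (y^-1 * x)%g.
by rewrite invgM invgK mulVKg.
Qed.

Lemma J_mulgl_Cc x f : Cc f -> J (fun y => f (x * y)%g) = J f.
Proof. by move=> [cf _]; apply: J_mulgl => //; exact: continuous_borel. Qed.

(** Fubini and the left invariance, used once in each variable.  Its two sides show
    that the dependence on g is only through the integral of g, up to a factor. *)
Lemma J_inversion f g : Cc f -> Cc g ->
  J (fun x => f x * J (fun y => g (y * x)%g)) = J g * J (fun y => f (y^-1)%g).
Proof.
move=> fc gc.
transitivity (J (fun x => J (fun y => f x * g (y * x)%g))).
  by congr J; apply/funext => x; rewrite JZ//; apply: Cc_integ => //; exact: Cc_mulgr.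
rewrite Cc_fubini//; last exact: Cc2_mul_right.
transitivity (J (fun y => J (fun x => g x * f (y^-1 * x)%g))).
  congr J; apply/funext => y.
  rewrite -(@J_mulgl_Cc y (fun x => g x * f (y^-1 * x)%g)).
    by congr J; apply/funext => x; rewrite mulKg mulrC.
  by apply: CcM => //; case: (Cc_mulgl y^-1%g fc).
rewrite (Cc_fubini Gh Hmu (Cc2_conv_left fc gc)) mulrC -JZ; last exact: Cc_integ.
congr J; apply/funext => x; rewrite JZ; last first.
  by apply: Cc_integ => //; apply: (@Cc_invg _ _ (fun y => f (y * x)%g)); exact: Cc_mulgr.
rewrite mulrC; congr (_ * _).
rewrite -(@J_mulgl_Cc x (fun y => f (y^-1 * x)%g)); last first.
  by apply: (@Cc_invg _ _ (fun y => f (y * x)%g)); exact: Cc_mulgr.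
by congr J; apply/funext => y; rewrite invgM mulgVK.
Qed.

Lemma J_mulgr_continuous g : Cc g -> continuous (fun x => J (fun y => g (y * x)%g)).
Proof.
move=> gc x0; have [W [oW Wx0 cW]] := precompact_open_superset Gh Gl (@compact_set1 _ x0).
have [cg [L cL gL]] := gc.
have -> : (fun x => J (fun y => g (y * x)%g)) = (fun x => J (fun y => g (y * x)%g * cst 1 y)).
  by apply/funext => t; congr J; apply/funext => x; rewrite mulr1.
pose K := [set (p.1 * p.2)%g | p in L `*` [set (x^-1)%g | x in closure W]].
apply: (@J_parameter_continuous _ _ mu Gh Hmu _ (fun x y => g (y * x)%g) (cst 1) 1 K) => //.
- move=> p; apply: (@continuous_comp _ _ _ (fun p : G * G => (p.2 * p.1)%g) g); last exact: cg.
  by apply: continuous_mulg; [exact: continuous_snd2|exact: continuous_fst2].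
- by apply: compact_mulg => //; exact: compact_invg.
- by move=> x; rewrite normr1.
have : nbhs x0 W by apply: open_nbhs_nbhs; split => //; exact: Wx0.
apply: filterS => x Wx y nK; apply: gL => Lyx; apply: nK.
exists ((y * x)%g, x^-1%g) => /=; last by rewrite mulgK.
by split=> //; exists x => //; exact: subset_closure.
Qed.

(** D is the quotient J(g(. x)) / J(g) for one fixed g.  By [J_inversion] its
    integrals against compactly supported functions are the same for all g,
    which gives uniqueness without an appeal to the uniqueness of Haar
    measures. *)
Lemma modular_exists : exists D, is_modular mu D.
Proof.
have [g0 [g0c g00 g01]] := Cc_bump 1%g.
have Jg0 : 0 < J g0 by apply: (@Cc_J_gt0 _ 1%g) => //; rewrite g01.
pose D x := (J g0)^-1 * J (fun y => g0 (y * x)%g).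
have cD : continuous D.
  move=> x; apply: (@continuousM _ _ (cst (J g0)^-1) (fun x => J (fun y => g0 (y * x)%g))); first exact: cvg_cst.
  exact: J_mulgr_continuous.
have ic f h : Cc f -> continuous h -> integ (fun x => f x * h x).
  by move=> fc ch; apply: Cc_integ => //; exact: CcM.
have D_inv f : Cc f -> J (fun x => f x * D x) = J (fun y => f (y^-1)%g).
  move=> fc; have := J_inversion fc g0c.
  have -> : (fun x => f x * D x) =
      (fun x => (J g0)^-1 * (f x * J (fun y => g0 (y * x)%g))).
    by apply/funext => x; rewrite /D mulrCA.
  by rewrite JZ ?ic//; [move=> ->; rewrite mulKf// gt_eqF|exact: J_mulgr_continuous].
have DJ g x : Cc g -> J (fun y => g (y * x)%g) = D x * J g.
  move=> gc; apply/eqP; rewrite -subr_eq0; apply/eqP.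
  apply: (@continuous_J_separates (fun x => J (fun y => g (y * x)%g) - D x * J g)).
    move=> z; apply: (@continuousB _ _ _ (fun x => J (fun y => g (y * x)%g)) (fun x => D x * J g)).
      exact: J_mulgr_continuous.
    by apply: (@continuousM _ _ D (cst (J g))); [exact: cD|exact: cvg_cst].
  move=> f fc; transitivity (J (fun x => f x * J (fun y => g (y * x)%g) - J g * (f x * D x))).
    by congr J; apply/funext => z; ring.
  have i1 := ic _ _ fc (J_mulgr_continuous gc); have i2 := ic _ _ fc cD.
  rewrite JB//; last exact: integZ.
  rewrite JZ//; by rewrite J_inversion// D_inv// subrr.
have DM x z : D (x * z)%g = D x * D z.
  have Jg0' : J g0 != 0 by rewrite gt_eqF.
  apply: (mulIf Jg0'); rewrite -DJ// -mulrA -[D z * _]DJ//.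
  rewrite -(DJ (fun y => g0 (y * z)%g) x); last exact: Cc_mulgr.
  by congr J; apply/funext => y; rewrite mulgA.
have D1 : D 1%g = 1.
  rewrite /D (_ : (fun y => g0 (y * 1)%g) = g0) ?mulVf ?gt_eqF//.
  by apply/funext => y; rewrite mulg1.
exists D; split => // x; rewrite lt_def; apply/andP; split; last first.
  by apply: mulr_ge0; [rewrite invr_ge0 ltW|exact: J_ge0].
have := DM x x^-1%g; rewrite mulgV D1 => h; apply/eqP => Dx0.
by move/eqP: h; rewrite Dx0 mul0r oner_eq0.
Qed.

End modular_function.

(** * Right translations and null sets *)

Section right_translation.
Context {R : realType} {G : topologicalGroupType} (mu : {measure set (borel G) -> \bar R}).
Hypotheses (Gh : hausdorff_space G) (Gl : locally_compact [set: G])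
  (Hmu : is_left_haar_measure mu).
Implicit Types (f g : G -> R) (K : set G).
Local Notation J := (realint mu).
Local Notation integ := (integ mu).
Local Notation mass := (mass mu).
Context (D : G -> R) (DD : is_modular mu D).

Let D0 := modular_gt0 DD.

Lemma modular1 : D 1%g = 1.
Proof.
have := modularM DD 1%g 1%g; rewrite mulg1 => h.
by apply: (mulIf (lt0r_neq0 (D0 1%g))); rewrite mul1r -h.
Qed.

Lemma modularV x : D x * D x^-1%g = 1.
Proof. by rewrite -(modularM DD) mulgV modular1. Qed.

Lemma modular_moveE x (a b : \bar R) :
  (a <= (D x)%:E * b)%E = ((D x^-1%g)%:E * a <= b)%E.
Proof.
rewrite -[RHS](@lee_pmul2l _ (D x)%:E)// ?lte_fin ?D0//.
by rewrite muleA -EFinM modularV mul1e.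
Qed.

Lemma measurable_mulgr d (T : measurableType d) x (f : G -> T) :
  measurable_fun setT (f : borel G -> T) ->
  measurable_fun setT (fun y : borel G => f (y * x)%g).
Proof.
move=> mf; apply: (measurableT_comp mf).
by apply: continuous_borel_map; exact: mulgr_continuous.
Qed.

Definition rpre x (E : set G) : set G := (fun y => (y * x)%g) @^-1` E.

Lemma rpre_open x E : open E -> open (rpre x E).
Proof. by move/continuousP: (@mulgr_continuous G x); exact. Qed.

Lemma rpre_measurable x (E : set (borel G)) : measurable E -> measurable (rpre x E : set (borel G)).
Proof.
move=> mE; rewrite -[X in measurable X]setTI.
by apply: (continuous_borel_map (@mulgr_continuous G x)).
Qed.

Lemma rpreK x E : rpre x^-1%g (rpre x E) = E.
Proof. by apply/seteqP; split => y; rewrite /rpre /= mulgVK. Qed.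

Lemma Cc_le_measure f (U : set G) : open U -> Cc f -> (forall x, 0 <= f x <= 1) ->
  (forall x, ~ U x -> f x = 0) -> ((J f)%:E <= mu U)%E.
Proof.
move=> oU fc f01 fU; rewrite J_EFin; last exact: Cc_integ.
have mU := open_borel oU.
rewrite -[leRHS]mul1e -[leRHS]integral_cst// [leRHS]integral_mkcond.
apply: ge0_le_integral => //.
- by move=> x _; rewrite lee_fin; case/andP: (f01 x).
- by apply/measurable_EFinP; apply: continuous_borel; exact: fc.1.
- by apply/(measurable_restrictT _ mU).
move=> x _; rewrite patchE; case: ifPn => xU; first by rewrite lee_fin; case/andP: (f01 x).
have nU : ~ U x by move=> Ux; move: xU; rewrite mem_set.
by rewrite fU.
Qed.

Lemma compact_le_J f K : compact K -> Cc f -> (forall x, 0 <= f x) ->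
  (forall x, K x -> f x = 1) -> (mu K <= (J f)%:E)%E.
Proof.
move=> cK fc f0 f1; have Kf := haar_compact Hmu cK.
rewrite -(@fineK _ (mu K)); last by rewrite ge0_fin_numE.
rewrite lee_fin -/(mass K) -J_ind//; apply: J_le.
- exact: compact_integ_ind.
- exact: Cc_integ.
move=> x; have [Kx|nK] := pselect (K x); first by rewrite ind_in// f1.
by rewrite ind_out.
Qed.

(** Inner regularity reduces the claim to a function between the indicators of a
    compact and of an open set, to which the property of D applies. *)
Lemma open_measure_rpre_le x (U : set G) : open U ->
  (mu (rpre x U) <= (D x)%:E * mu U)%E.
Proof.
move=> oU; have oV := rpre_open x oU.
rewrite (haar_inner_regular Hmu oV); apply: ge_ereal_sup => _ [K [cK KV] <-].
have [f [cf f01 f1 fV [C cC fC]]] := @compact_open_urysohn R G Gh Gl K _ cK oV KV.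
have fc : Cc f by split => //; exists C.
apply: (le_trans (compact_le_J cK fc (fun x => proj1 (andP (f01 x))) f1)).
have -> : J f = D x * J (fun y => f (y * x^-1)%g).
  rewrite -(modular_J DD); last exact: Cc_mulgr.
  by congr J; apply/funext => y; rewrite mulgK.
rewrite EFinM lee_pmul2l ?lte_fin ?D0//; apply: Cc_le_measure => //; first exact: Cc_mulgr.
by move=> y nU; apply: fV; rewrite /rpre /= mulgVK.
Qed.

Lemma measure_rpre_le x (E : set (borel G)) : measurable E ->
  (mu (rpre x E) <= (D x)%:E * mu E)%E.
Proof.
move=> mE; have mE' := rpre_measurable x mE.
rewrite modular_moveE (haar_outer_regular Hmu mE).
apply: le_ereal_inf_tmp => _ [U [oU EU] <-]; rewrite -modular_moveE.
apply: le_trans (open_measure_rpre_le x oU); apply: le_measure; rewrite ?inE//.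
  by apply: open_borel; exact: rpre_open.
by move=> y /EU.
Qed.

(** The reverse inequality is the same one for x^-1. *)
Lemma measure_rpre x (E : set (borel G)) : measurable E ->
  mu (rpre x E) = ((D x)%:E * mu E)%E.
Proof.
move=> mE; apply/eqP; rewrite eq_le measure_rpre_le//=.
have := measure_rpre_le x^-1%g (rpre_measurable x mE).
by rewrite rpreK modular_moveE invgK.
Qed.

Lemma ge0_integral_mulgr x (f : G -> \bar R) :
  measurable_fun setT (f : borel G -> \bar R) -> (forall y, 0 <= f y)%E ->
  (\int[mu]_y f (y * x)%g = (D x)%:E * \int[mu]_y f y)%E.
Proof.
move=> mf f0.
have mx : measurable_fun setT (fun y : borel G => (y * x)%g : borel G).
  by apply: continuous_borel_map; exact: mulgr_continuous.
rewrite -(@ge0_integral_pushforward _ _ _ _ R _ mx mu setT f)//.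
pose d : {nonneg R} := NngNum (ltW (D0 x)).
rewrite (@eq_measure_integral _ _ _ setT (mscale d mu)).
  by rewrite ge0_integral_mscale.
by move=> E mE _; exact: measure_rpre.
Qed.

Lemma integ_mulgr x f : integ f -> integ (fun y => f (y * x)%g).
Proof.
move=> fi; have mf := integ_measurable fi; apply/integrableP; split.
  by apply/measurable_EFinP; exact: measurable_mulgr.
have /integrableP[_] := fi.
rewrite (@ge0_integral_mulgr x (fun y => `|(f y)%:E|%E))//; last first.
  by apply: measurableT_comp => //; exact/measurable_EFinP.
by move=> h; rewrite lte_mul_pinfty// lee_fin ltW.
Qed.

Lemma J_mulgr x f : integ f -> J (fun y => f (y * x)%g) = D x * J f.
Proof.
move=> fi; have mf := integ_measurable fi.
have mfE : measurable_fun setT (EFin \o f : borel G -> \bar R) by exact/measurable_EFinP.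
apply: EFin_inj; rewrite EFinM !J_EFin//; last exact: integ_mulgr.
rewrite [LHS]integralE [in RHS]integralE muleBr//; last exact: integrable_add_def fi.
congr (_ - _)%E.
  rewrite -(@ge0_integral_mulgr x (EFin \o f)^\+%E)//; last exact: measurable_funepos.
  by apply: eq_integral => y _; rewrite !funeposE.
rewrite -(@ge0_integral_mulgr x (EFin \o f)^\-%E)//; last exact: measurable_funeneg.
by apply: eq_integral => y _; rewrite !funenegE.
Qed.

(** The inversion has the density D, and D is bounded below by a positive constant
    on compact sets.  A cover of N by open sets of small measure is turned into functions, where
    [modular_inv] applies. *)
Lemma measure_inv_null K (N : set (borel G)) : compact K -> measurable N -> mu N = 0%E ->
  mu [set z | K z /\ N (z^-1)%g] = 0%E.
Proof.
move=> cK mN N0; have [W [oW KW cW]] := precompact_open_superset Gh Gl cK.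
have [B B0 BP] : exists2 B, 0 < B & forall z, W z -> 1 <= B * D z.
  have /compact_bounded[M [_ MP]] : compact ((fun z => D z^-1%g) @` closure W).
    apply: continuous_compact => //; apply: continuous_subspaceT => z.
    apply: (@continuous_comp _ _ _ (fun z : G => z^-1%g) D); first exact: invg_continuous.
    exact: modular_continuous DD _.
  exists (`|M| + 1); first by rewrite ltr_wpDl.
  move=> z Wz; rewrite -[leLHS](modularV z) [leLHS]mulrC ler_pM2r ?D0//.
  rewrite (le_trans (ler_norm _))//; apply: MP; last first.
    by exists z => //; exact: subset_closure.
  by rewrite (le_lt_trans (ler_norm M))// ltrDl.
apply/eqP; rewrite eq_le measure_ge0 andbT.
apply/lee_addgt0Pr => e e0; rewrite add0e.
have [U [oU NU Ue]] : exists U : set G, [/\ open U, N `<=` U & (mu U <= (e / B)%:E)%E].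
  have := haar_outer_regular Hmu mN; rewrite N0 => inf0.
  have : (ereal_inf [set mu U | U in [set U : set G | open U /\ N `<=` U]] < (e / B)%:E)%E.
    by rewrite -inf0 lte_fin divr_gt0.
  by move=> /ereal_inf_lt[_ [U [oU NU] <-] /ltW Ue]; exists U.
pose V := W `&` (fun z => z^-1%g) @^-1` U.
have oV : open V.
  apply: openI => //; by move/continuousP: (@invg_continuous G); exact.
have mE : measurable ([set z | K z /\ N (z^-1)%g] : set (borel G)).
  apply: measurableI; first exact: compact_borel.
  rewrite -[X in measurable X]setTI.
  by apply: (continuous_borel_map (@invg_continuous G)).
apply: (@le_trans _ _ (mu V)).
  apply: le_measure; rewrite ?inE//; first exact: open_borel.
  by move=> z [/KW Wz /NU Uz].
rewrite (haar_inner_regular Hmu oV); apply: ge_ereal_sup => _ [L [cL LV] <-].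
have [f [cf f01 f1 fV [C cC fC]]] := @compact_open_urysohn R G Gh Gl L _ cL oV LV.
have fc : Cc f by split => //; exists C.
apply: (le_trans (compact_le_J cL fc (fun x => proj1 (andP (f01 x))) f1)).
have iD : integ (fun x => f x * D x).
  exact: (Cc_integ Gh Hmu (CcM fc (modular_continuous DD))).
apply: (@le_trans _ _ (B * J (fun x => f x * D x))%:E).
  rewrite lee_fin -JZ//; apply: J_le => //; [exact: Cc_integ|exact: integZ|].
  move=> x; have [Vx|nV] := pselect (V x); last by rewrite fV// !mul0r mulr0.
  rewrite mulrCA -[leLHS]mulr1 ler_wpM2l//; first by case/andP: (f01 x).
  by apply: BP; case: Vx.
rewrite (modular_inv DD fc) EFinM.
have h : ((J (fun y => f (y^-1)%g))%:E <= mu U)%E.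
  apply: Cc_le_measure => //; first exact: Cc_invg.
  by move=> y nU; apply: fV => -[_]; rewrite /= invgK.
apply: (@le_trans _ _ (B%:E * (e / B)%:E)%E).
  by rewrite lee_pmul2l ?lte_fin//; exact: le_trans Ue.
by rewrite -EFinM mulrCA divff ?mulr1// gt_eqF.
Qed.

(** Null sets do not matter for x |-> g(y^-1 x) as a function of y in a compact
    set, although y^-1 x involves an inversion. *)
Lemma measure_conv_null K (N : set (borel G)) x : compact K -> measurable N -> mu N = 0%E ->
  mu [set y | K y /\ N (y^-1 * x)%g] = 0%E.
Proof.
move=> cK mN N0.
pose L := [set (x^-1 * y)%g | y in K].
have cL : compact L by exact: compact_image_mulgl.
rewrite -(measure_inv_null cL mN N0).
have mE : measurable ([set z | L z /\ N (z^-1)%g] : set (borel G)).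
  apply: measurableI; first exact: compact_borel.
  rewrite -[X in measurable X]setTI.
  by apply: (continuous_borel_map (@invg_continuous G)).
rewrite -[RHS](haar_left_invariant Hmu x mE); congr (mu _).
apply/seteqP; split => y /=.
  move=> [Ky Ny]; exists (x^-1 * y)%g; last by rewrite mulVKg.
  by split; [exists y|rewrite invgM invgK].
move=> [z [[k Kk kz] Nz] <-]; rewrite -kz mulVKg; split => //.
by move: Nz; rewrite -kz invgM invgK.
Qed.

End right_translation.

(** * Density of compactly supported functions *)

Import HBSimple.

Section density.
Context {R : realType} {G : topologicalGroupType} (mu : {measure set (borel G) -> \bar R}).
Hypotheses (Gh : hausdorff_space G) (Gl : locally_compact [set: G])
  (Hmu : is_left_haar_measure mu).
Implicit Types (f g : G -> R) (K : set G).
Local Notation J := (realint mu).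
Local Notation integ := (integ mu).
Local Notation mass := (mass mu).

Lemma Cc0 : Cc ((fun=> 0) : G -> R).
Proof. by split=> [x|]; [exact: cvg_cst|exists set0; first exact: compact0]. Qed.

Lemma CcD f g : Cc f -> Cc g -> Cc (fun x => f x + g x).
Proof.
move=> cf cg; have := CcB cf (CcB Cc0 cg); rewrite (_ : (fun x => _) = fun x => f x + g x)//.
by apply/funext => x; rewrite sub0r opprK.
Qed.

Lemma CcZ k f : Cc f -> Cc (fun x => k * f x).
Proof.
move=> cf; rewrite (_ : (fun x => _) = fun x => f x * (fun=> k) x).
  by apply: CcM => // x; exact: cvg_cst.
by apply/funext => x; rewrite mulrC.
Qed.

Definition approximable f := integ f /\
  forall e, 0 < e -> exists2 g, Cc g & J (fun x => `|f x - g x|) <= e.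

Lemma approximableD f g : approximable f -> approximable g -> approximable (fun x => f x + g x).
Proof.
move=> [fi fa] [gi ga]; split=> [|e e0]; first exact: integD.
have e20 : 0 < e / 2 by rewrite divr_gt0.
have [f' cf Jf] := fa _ e20; have [g' cg Jg] := ga _ e20.
have f'i := Cc_integ Gh Hmu cf; have g'i := Cc_integ Gh Hmu cg.
exists (fun x => f' x + g' x); first exact: CcD.
rewrite [leRHS]splitr; apply: le_trans (lerD Jf Jg).
rewrite -JD; [|exact: integ_abs (integB _ _)|exact: integ_abs (integB _ _)].
apply: J_le.
- by apply: integ_abs; apply: integB; exact: integD.
- by apply: integD; apply: integ_abs; exact: integB.
- move=> x; rewrite (_ : _ - _ = (f x - f' x) + (g x - g' x)); last by ring.
  exact: ler_normD.
Qed.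

Lemma approximableZ k f : approximable f -> approximable (fun x => k * f x).
Proof.
move=> [fi fa]; split=> [|e e0]; first exact: integZ.
have k0 : 0 < `|k| + 1 by rewrite ltr_wpDl.
have [g cg Jg] := fa _ (divr_gt0 e0 k0).
have gi := Cc_integ Gh Hmu cg.
exists (fun x => k * g x); first exact: CcZ.
have -> : (fun x => `|k * f x - k * g x|) = fun x => `|k| * `|f x - g x|.
  by apply/funext => x; rewrite -mulrBr normrM.
rewrite JZ; last by apply: integ_abs; exact: integB.
apply: le_trans (_ : (`|k| + 1) * (e / (`|k| + 1)) <= _); last by rewrite mulrC divfK ?gt_eqF.
by apply: ler_pM => //; [apply: J_ge0|rewrite lerDl].
Qed.

Lemma approximable_sum (I : eqType) (r : seq I) (F : I -> G -> R) :
  (forall i, i \in r -> approximable (F i)) -> approximable (fun x => \sum_(i <- r) F i x).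
Proof.
elim: r => [|i r IH] Fi.
  under eq_fun do rewrite big_nil.
  split=> [|e e0]; first exact: integ0.
  exists (fun=> 0); first exact: Cc0.
  by under eq_fun do rewrite subrr normr0; rewrite J0 ltW.
under eq_fun do rewrite big_cons; apply: approximableD; first by apply: Fi; rewrite mem_head.
by apply: IH => j jr; apply: Fi; rewrite inE jr orbT.
Qed.

Lemma approximable_limit f : integ f ->
  (forall e, 0 < e -> exists2 g, approximable g & J (fun x => `|f x - g x|) <= e) ->
  approximable f.
Proof.
move=> fi H; split=> // e e0; have e20 : 0 < e / 2 by rewrite divr_gt0.
have [g [gi ga] Jfg] := H _ e20; have [h ch Jgh] := ga _ e20; exists h => //.
have hi := Cc_integ Gh Hmu ch.
rewrite [leRHS]splitr; apply: le_trans (lerD Jfg Jgh).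
rewrite -JD; [|exact: integ_abs (integB _ _)|exact: integ_abs (integB _ _)].
apply: J_le.
- by apply: integ_abs; exact: integB.
- by apply: integD; apply: integ_abs; exact: integB.
- by move=> x; exact: ler_distD.
Qed.

(** Regularity gives K below and U above with mu(U) - mu(E) and mu(U) - mu(K)
    small, and a function between their indicators is close to that of E. *)
Lemma approximable_indic (E : set (borel G)) : measurable E -> (mu E < +oo)%E ->
  approximable (ind E).
Proof.
move=> mE Ef; have Ei : integ (ind E) by exact: integ_indic.
split=> // e e0; have e20 : 0 < e / 2 by rewrite divr_gt0.
have Efin : mu E \is a fin_num by rewrite ge0_fin_numE.
have [U [oU EU] UE] : exists2 U : set G, open U /\ E `<=` U & (mu U < mu E + (e / 2)%:E)%E.
  have : (ereal_inf [set mu U | U in [set U : set G | open U /\ E `<=` U]] < mu E + (e / 2)%:E)%E.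
    by rewrite -(haar_outer_regular Hmu mE) lteDl// lte_fin.
  by move=> /ereal_inf_lt[_ [U UP <-] lt]; exists U.
have Ufin : (mu U < +oo)%E.
  by apply: lt_trans UE _; rewrite lte_add_pinfty// ltry.
have UfinN : mu U \is a fin_num by rewrite ge0_fin_numE.
have mU := open_borel oU.
have [K [cK KU] UK] : exists2 K : set G, compact K /\ K `<=` U & (mu U - (e / 2)%:E < mu K)%E.
  have : (mu U - (e / 2)%:E < ereal_sup [set mu K | K in [set K : set G | compact K /\ K `<=` U]])%E.
    by rewrite -(haar_inner_regular Hmu oU) lteBlDr// lteDl// lte_fin.
  by move=> /ereal_sup_gt[_ [K KP <-] lt]; exists K.
have Kfin : mu K \is a fin_num by rewrite ge0_fin_numE//; exact: haar_compact.
have Ui : integ (ind U) by exact: integ_indic.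
have Ki := compact_integ_ind Gh Hmu cK.
have [f [cf f01 fK fU [C cC fC]]] := @compact_open_urysohn R G Gh Gl K U cK oU KU.
have Cf : Cc f by split=> //; exists C.
exists f => //.
have fi := Cc_integ Gh Hmu Cf.
apply: le_trans (_ : J (fun x => (ind U x - ind E x) + (ind U x - ind K x)) <= _).
  apply: J_le; [by apply: integ_abs; exact: integB|by apply: integD; exact: integB|].
  move=> x; have /andP[f0 f1] := f01 x.
  have EUx : ind E x <= ind U x :> R.
    have [Ex|nE] := pselect (E x); last by rewrite (ind_out nE) ind_ge0.
    by rewrite (ind_in (EU _ Ex)) ind_le1.
  have fUx : f x <= ind U x.
    have [Ux|nU] := pselect (U x); first by rewrite ind_in.
    by rewrite fU// ind_ge0.
  have Kfx : ind K x <= f x.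
    have [Kx|nK] := pselect (K x); first by rewrite fK// ind_le1.
    by rewrite ind_out.
  by rewrite ler_norml; apply/andP; split; lra.
rewrite JD; [|exact: integB|exact: integB].
rewrite !JB// !borel_J_ind//; last exact: compact_borel.
move: UE UK; rewrite /mass -(fineK Efin) -(fineK UfinN) -(fineK Kfin) -EFinD -EFinB !lte_fin.
by move=> a b; lra.
Qed.

Lemma Cc_dense f : integ f -> approximable f.
Proof.
move=> fi; apply: (approximable_limit fi) => e e0.
have [g [gi _ gf]] := approximation_sfun_integrable measurableT fi.
have [n gn] : exists n, J (fun x => `|f x - HBSimple.SimpleFun.sort (g n) x|) <= e.
  have /fine_cvgP[_ /cvgrPdist_le/(_ e e0)] := gf.
  move=> [n _ /(_ n (leqnn n)) /=]; rewrite sub0r normrN => h; exists n.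
  by apply: le_trans h; apply: le_trans (ler_norm _).
exists (HBSimple.SimpleFun.sort (g n)) => //; move: (g n) (gi n) => h hi.
have -> : HBSimple.SimpleFun.sort h = fun x : G => \sum_(i < #|` fset_set (range h)|)
   ((fset_set (range h))`_i * ind (h @^-1` [set (fset_set (range h))`_i]) x).
  by apply/funext => x; rewrite fimfunEord.
apply: approximable_sum => i _; set y := _`_i.
have [->|y0] := eqVneq y 0.
  rewrite (_ : (fun x => _) = (fun x => \sum_(i <- [::] : seq nat) 0)); first exact: approximable_sum.
  by apply/funext => x; rewrite mul0r big_nil.
apply: approximableZ; apply: approximable_indic; first exact: measurable_funPTI.
have yi := integ_abs hi.
set E := h @^-1` [set y].
have mE : measurable (E : set (borel G)) by exact: measurable_funPTI.
have : (`|y|%:E * mu E < +oo)%E.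
  apply: le_lt_trans (integrable_lty measurableT yi).
  rewrite -[E]setIT -integral_indic// -ge0_integralZl//; last first.
    by apply/measurable_EFinP; exact: measurable_indic.
  apply: ge0_le_integral => //.
  - apply: emeasurable_funM => //.
    by apply/measurable_EFinP; exact: measurable_indic.
  - exact: measurable_int yi.
  - move=> x _; rewrite -EFinM lee_fin indicE /=; case: (boolP (x \in E)); rewrite ?mulr0// => /set_mem <-.
    by rewrite mulr1.
by apply: contraTT; rewrite -!leNgt !leye_eq => /eqP ->; rewrite gt0_muley ?lte_fin ?normr_gt0.
Qed.
End density.

(** * Dominating series *)

Section summability.
Context {R : realType}.

Lemma nneseries_partial (a : nat -> R) N : (forall n, 0 <= a n) ->
  ((\sum_(n < N) a n)%:E <= \sum_(0 <= n <oo) (a n)%:E)%E.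
Proof.
move=> a0; rewrite -(big_mkord predT a) -sumEFin.
by apply: nneseries_lim_ge => n _; rewrite lee_fin.
Qed.

Lemma nneseries_le (a : nat -> R) B : (forall n, 0 <= a n) ->
  (forall N, \sum_(n < N) a n <= B) -> (\sum_(0 <= n <oo) (a n)%:E <= B%:E)%E.
Proof.
move=> a0 aB; apply: lime_le.
  by apply: is_cvg_nneseries => n _; rewrite lee_fin.
by apply: nearW => N; rewrite sumEFin lee_fin big_mkord.
Qed.

Lemma nneseries_abs_cvg (a : nat -> R) : (\sum_(0 <= n <oo) `|a n|%:E < +oo)%E ->
  cvgn (series a).
Proof.
move=> aoo; apply: normed_cvg; apply: nondecreasing_is_cvgn.
  by apply: (@nondecreasing_series R (fun n => `|a n|) xpredT 0%N) => n _ _; exact: normr_ge0.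
exists (fine (\sum_(0 <= n <oo) `|a n|%:E)%E) => _ [N _ <-].
rewrite -lee_fin fineK; last by rewrite ge0_fin_numE// nneseries_ge0.
rewrite [X in X%:E](_ : _ = \sum_(n < N) `|a n|); last exact: (big_mkord predT (fun n => `|a n|)).
exact: (nneseries_partial N (fun n => normr_ge0 (a n))).
Qed.

Lemma nneseries_abs_cvg0 (a : nat -> R) : (\sum_(0 <= n <oo) `|a n|%:E < +oo)%E ->
  a n @[n --> \oo] --> 0.
Proof. by move=> /nneseries_abs_cvg/cvg_series_cvg_0. Qed.

End summability.

Section domination.
Context {R : realType} {G : topologicalGroupType} (mu : {measure set (borel G) -> \bar R}).
Hypotheses (Gh : hausdorff_space G) (Gl : locally_compact [set: G])
  (Hmu : is_left_haar_measure mu).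
Implicit Types (f g : G -> R) (K : set G).
Local Notation J := (realint mu).
Local Notation integ := (integ mu).

(** The sum of the series of absolute values has a finite integral. *)
Lemma ae_summable (u : nat -> G -> R) B : (forall n, integ (u n)) ->
  (forall N, \sum_(n < N) J (fun x => `|u n x|) <= B) ->
  {ae mu, forall x : borel G, (\sum_(0 <= n <oo) `|u n x|%:E < +oo)%E}.
Proof.
move=> ui uB.
have um n : measurable_fun setT (fun x : borel G => `|u n x|%:E).
  exact: (measurable_int _ (integ_abs (ui n))).
have S : (\int[mu]_x \sum_(0 <= n <oo) `|u n (x : borel G)|%:E <= B%:E)%E.
  rewrite integral_nneseries//.
  under eq_eseriesr do rewrite -J_EFin ?integ_abs//.
  by apply: nneseries_le => // n; exact: J_ge0.
have Si : mu.-integrable setT (fun x : borel G => \sum_(0 <= n <oo) `|u n x|%:E)%E.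
  apply/integrableP; split; first by apply: ge0_emeasurable_sum.
  under eq_integral do rewrite gee0_abs ?nneseries_ge0//.
  by apply: le_lt_trans S _; rewrite ltry.
apply: filterS (integrable_ae measurableT Si) => x /(_ I).
by rewrite ge0_fin_numE// nneseries_ge0.
Qed.

(** Telescope a fast approximating sequence f_n of q by compactly supported
    functions.  The series has nearly the same integral as |q|, which keeps
    estimates sharp. *)
Lemma Cc_domination q e : integ q -> 0 < e ->
  exists h : nat -> G -> R, [/\ forall n, Cc (h n), forall n x, 0 <= h n x,
    forall N, \sum_(n < N) J (h n) <= J (fun x => `|q x|) + e &
    {ae mu, forall x : borel G, (`|q x|%:E <= \sum_(0 <= n <oo) (h n x)%:E)%E}].
Proof.
(* Chosen so that the errors d n + d n.+1 and d 0 sum up to at most e. *)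
move=> qi e0; pose d n : R := (e / 4) / 2 ^+ n.
have d0 n : 0 < d n by rewrite !divr_gt0// exprn_gt0.
have /choice[f fP] : forall n, exists f, Cc f /\ J (fun x => `|q x - f x|) <= d n.
  by move=> n; have [f cf Jf] := (Cc_dense Gh Gl Hmu qi).2 (d n) (d0 n); exists f.
have fi n := Cc_integ Gh Hmu (fP n).1.
have qfi n : integ (fun x => `|q x - f n x|) by apply: integ_abs; exact: integB.
pose h n x := if n is m.+1 then `|f n x - f m x| else `|f 0%N x|.
have h0 n x : 0 <= h n x by case: n => [|n] /=.
have ch n : Cc (h n).
  by case: n => [|n]; apply: Cc_abs; [exact: (fP 0).1|apply: CcB; exact: (fP _).1].
have Jh0 : J (h 0%N) <= J (fun x => `|q x|) + d 0%N.
  apply: le_trans (lerD (lexx _) (fP 0%N).2); rewrite -JD//; last exact: integ_abs.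
  apply: J_le; [exact: Cc_integ|by apply: integD => //; exact: integ_abs|].
  by move=> x /=; have := ler_distD (q x) (f 0%N x) 0; rewrite !subr0 addrC distrC.
have JhS n : J (h n.+1) <= d n.+1 + d n.
  apply: le_trans (lerD (fP _).2 (fP _).2); rewrite -JD//.
  apply: J_le; [exact: Cc_integ|by apply: integD|].
  by move=> x /=; rewrite (distrC (q x) (f n.+1 x)); exact: ler_distD.
have sumd N : \sum_(n < N) d n = e / 2 - 2 * d N.
  elim: N => [|N IH]; first by rewrite big_ord0 /d expr0; field.
  by rewrite big_ord_recr /= IH /d exprS; field; rewrite expf_neq0.
have sumd_le N : \sum_(n < N) d n <= e / 2.
  by rewrite sumd lerBlDr lerDl mulr_ge0// ltW.
exists h; split=> //.
  case=> [|N]; first by rewrite big_ord0 addr_ge0 ?J_ge0 ?ltW.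
  rewrite big_ord_recl /=; apply: le_trans (lerD Jh0 (ler_sum _ (fun n _ => JhS _))) _.
  rewrite big_split /= -addrA lerD2l addrA -(big_ord_recl N d) /= [leRHS]splitr.
  by apply: lerD; exact: sumd_le.
apply: filterS (ae_summable (u := fun n x => q x - f n x) (B := e / 2) _ _); last 2 first.
- by move=> n; exact: integB.
- by move=> N; apply: le_trans (sumd_le N); apply: ler_sum => n _; exact: (fP _).2.
move=> x /nneseries_abs_cvg0 qf.
have fS N : (`|f N x|%:E <= \sum_(0 <= n <oo) (h n x)%:E)%E.
  apply: le_trans (nneseries_partial N.+1 (fun n => h0 n x)); rewrite lee_fin.
  elim: N => [|N IH]; first by rewrite big_ord_recl big_ord0 addr0.
  rewrite big_ord_recr /=; apply: le_trans (lerD IH (lexx _)).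
  by rewrite -[X in `|X|](subrK (f N x)) addrC; exact: ler_normD.
have [->|Sfin] := eqVneq (\sum_(0 <= n <oo) (h n x)%:E)%E +oo%E; first exact: leey.
have {}Sfin : (\sum_(0 <= n <oo) (h n x)%:E)%E \is a fin_num.
  by rewrite ge0_fin_numE ?ltey// nneseries_ge0// => n _; rewrite lee_fin.
rewrite -(fineK Sfin) lee_fin; set S := fine _.
apply/ler_addgt0Pr => t t0; have /cvgrPdist_le/(_ t t0)[n _ /(_ n (leqnn n))] := qf.
rewrite sub0r normrN => qft; rewrite -(subrK (f n x) (q x)) addrC.
apply: le_trans (ler_normD _ _) _; apply: lerD => //.
by rewrite -lee_fin /S fineK.
Qed.
End domination.

(** * Measurability of convolutions *)

Section convolution_measurability.
Context {R : realType} {G : topologicalGroupType} (mu : {measure set (borel G) -> \bar R}).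
Hypotheses (Gh : hausdorff_space G) (Gl : locally_compact [set: G])
  (Hmu : is_left_haar_measure mu).
Implicit Types (f g p q : G -> R) (K : set G).
Local Notation J := (realint mu).
Local Notation integ := (integ mu).
Local Notation mass := (mass mu).

Lemma Cc_translation_continuous p x0 e : Cc p -> 0 < e ->
  \forall x \near x0, J (fun y => `|p (x * y)%g - p (x0 * y)%g|) <= e.
Proof.
move=> [cp [S cS pS]] e0.
have [W [oW x0W cW]] := precompact_open_superset Gh Gl (@compact_set1 _ x0).
pose K := [set (q.1 * q.2)%g | q in [set (x^-1)%g | x in closure W] `*` S].
have cK : compact K by apply: compact_mulg => //; exact: compact_invg.
have mK0 : 0 < mass K + 1 by rewrite ltr_wpDl// mass_ge0.
have : \forall x \near x0, forall y, `|p (x * y)%g - p (x0 * y)%g| <= (e / (mass K + 1)) * ind K y.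
  apply: (@near_supported_uniform R G _ (fun x y => p (x * y)%g)) => //.
  - move=> q; apply: (@continuous_comp _ _ _ (fun p : G * G => (p.1 * p.2)%g) p); last exact: cp.
    exact: mulg_continuous.
  - have : \forall x \near x0, W x by apply: open_nbhs_nbhs; split=> //; exact: x0W.
    apply: filterS => x Wx y nK; apply: pS => Sxy; apply: nK.
    exists (x^-1, x * y)%g; last by rewrite /= mulKg.
    by split=> //=; exists x => //; exact: subset_closure.
  - by rewrite divr_gt0.
apply: filterS => x H.
have ci z : integ (fun y => p (z * y)%g).
  by apply: (Cc_integ Gh Hmu); apply: Cc_mulgl; split=> //; exists S.
apply: le_trans (_ : J (fun y => e / (mass K + 1) * ind K y) <= _).
  apply: J_le => //; first by apply: integ_abs; exact: integB.
  by apply: integZ; exact: compact_integ_ind.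
rewrite JZ ?J_ind//; last exact: compact_integ_ind.
by rewrite mulrAC ler_pdivrMr// ler_pM2l// lerDl.
Qed.

(** Standard 3-epsilon argument from the dense set of compactly supported
    functions. *)
Lemma translation_continuous p x0 e : integ p -> 0 < e ->
  \forall x \near x0, J (fun y => `|p (x * y)%g - p (x0 * y)%g|) <= e.
Proof.
move=> pi e0; have e30 : 0 < e / 3 by rewrite divr_gt0.
have [f cf Jf] := (Cc_dense Gh Gl Hmu pi).2 _ e30.
have fi := Cc_integ Gh Hmu cf.
apply: filterS (Cc_translation_continuous x0 cf e30) => x Jx.
have Jz z : J (fun y => `|p (z * y)%g - f (z * y)%g|) <= e / 3.
  rewrite (J_mulgl Hmu z (f := fun y => `|p y - f y|))//.
  by apply: (@integ_measurable _ _ mu); apply: integ_abs; exact: integB.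
have tr z g : integ g -> integ (fun y => g (z * y)%g) by move=> gi; exact: (integ_mulgl Hmu z gi).
have -> : e = e / 3 + e / 3 + e / 3 by field.
apply: le_trans (lerD (lerD (Jz x) Jx) (Jz x0)).
have i1 z : integ (fun y => `|p (z * y)%g - f (z * y)%g|).
  by apply: integ_abs; apply: integB; exact: tr.
have i2 : integ (fun y => `|f (x * y)%g - f (x0 * y)%g|).
  by apply: integ_abs; apply: integB; exact: tr.
rewrite -JD// -JD//; last exact: integD.
apply: J_le; [by apply: integ_abs; apply: integB; exact: tr|by apply: integD => //; exact: integD|].
move=> y; apply: le_trans (ler_distD (f (x0 * y)%g) _ _) _.
by rewrite (distrC (f (x0 * y)%g)) lerD2r; exact: ler_distD.
Qed.

Lemma measurable_convr d (T : measurableType d) (q : G -> T) x :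
  measurable_fun setT (q : borel G -> T) ->
  measurable_fun setT (fun y : borel G => q (y^-1 * x)%g).
Proof.
move=> mq; apply: (measurableT_comp mq); apply: continuous_borel_map.
by apply: continuous_mulg; [exact: invg_continuous|move=> ?; exact: cvg_cst].
Qed.

(** The positive parts of the real and imaginary parts of a complex convolution
    integrand, and of their opposites, have this form. *)
Definition convpos p1 q1 p2 q2 x y : R :=
  Num.max 0 (p1 y * q1 (y^-1 * x)%g + p2 y * q2 (y^-1 * x)%g).

Lemma max0_lip (a b : R) : `|Num.max 0 a - Num.max 0 b| <= `|a - b|.
Proof.
have h1 := ler_norm (a - b); have h2 : - `|a - b| <= a - b by rewrite lerNl -normrN ler_norm.
move: h1 h2; set n := `|a - b| => h1 h2; rewrite ler_norml !maxEle.
by case: ifPn => ?; case: ifPn => ?; apply/andP; split; lra.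
Qed.

Section bounded.
Context (p1 q1 p2 q2 : G -> R) (M : R).
Hypotheses (p1i : integ p1) (p2i : integ p2).
Hypotheses (mq1 : measurable_fun setT (q1 : borel G -> R))
  (mq2 : measurable_fun setT (q2 : borel G -> R)).

Lemma measurable_convpos x : measurable_fun setT (convpos p1 q1 p2 q2 x : borel G -> R).
Proof.
apply: measurable_maxr => //; apply: measurable_funD; apply: measurable_funM;
  by [exact: (@integ_measurable _ _ mu)|exact: measurable_convr].
Qed.

Hypotheses (q1M : forall x, `|q1 x| <= M) (q2M : forall x, `|q2 x| <= M).

Lemma bounded_integ_convpos x : integ (convpos p1 q1 p2 q2 x).
Proof.
apply: (@le_integ _ _ _ _ (fun y => M * (`|p1 y| + `|p2 y|))); first exact: measurable_convpos.
  by apply: integZ; apply: integD; exact: integ_abs.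
move=> y; rewrite -[convpos _ _ _ _ _ _]subr0 -{1}(maxxx 0).
apply: le_trans (max0_lip _ _) _; rewrite subr0; apply: le_trans (ler_normD _ _) _.
by rewrite !normrM mulrDr ![M * _]mulrC lerD// ler_wpM2l.
Qed.

(** After the substitution y |-> x y, the factors q no longer depend on x and the
    claim reduces to the continuity of translations in L^1. *)
Lemma bounded_J_convpos_continuous : continuous (fun x => J (convpos p1 q1 p2 q2 x)).
Proof.
have M0 : 0 <= M by apply: le_trans (q1M 1%g).
have JE x : J (convpos p1 q1 p2 q2 x) = J (fun y => convpos p1 q1 p2 q2 x (x * y)%g).
  by rewrite (J_mulgl Hmu)//; exact: measurable_convpos.
move=> x0; apply/cvgrPdist_le => e e0 /=.
pose d := e / (2 * (M + 1)).
have d0 : 0 < d by rewrite divr_gt0// mulr_gt0// ltr_wpDl.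
apply: filterS2 (translation_continuous x0 p1i d0) (translation_continuous x0 p2i d0) => x J1 J2.
have Fi z : integ (fun y => convpos p1 q1 p2 q2 z (z * y)%g).
  by apply: (integ_mulgl Hmu); exact: bounded_integ_convpos.
have ti p z : integ p -> integ (fun y => p (z * y)%g) by move=> pi; exact: (integ_mulgl Hmu z pi).
rewrite !JE -JB//; apply: le_trans (J_abs (integB (Fi _) (Fi _))) _.
apply: le_trans (_ : M * (d + d) <= _); last first.
  rewrite /d; rewrite (_ : M * _ = e * (M / (M + 1))); last by field; lra.
  by rewrite ger_pMr// ler_pdivrMr ?mul1r ?lerDl// ltr_wpDl.
apply: le_trans (ler_wpM2l M0 (lerD J1 J2)).
have di p : integ p -> integ (fun y => `|p (x * y)%g - p (x0 * y)%g|).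
  by move=> pi; apply: integ_abs; apply: integB; exact: ti.
rewrite -JD ?di// -JZ; last by apply: integD; exact: di.
apply: J_le; [by apply: integ_abs; exact: integB|by apply: integZ; apply: integD; exact: di|].
move=> y; apply: le_trans (max0_lip _ _) _.
rewrite !invgM !mulgVK.
rewrite (_ : _ - _ = (p1 (x0 * y)%g - p1 (x * y)%g) * q1 y^-1%g + (p2 (x0 * y)%g - p2 (x * y)%g) * q2 y^-1%g); last by ring.
apply: le_trans (ler_normD _ _) _.
by rewrite !normrM mulrDr ![M * _]mulrC !(distrC (_ (x0 * y)%g)) lerD// ler_wpM2l.
Qed.

End bounded.

(** Joint measurability of (x, y) |-> q (y^-1 x) for the product sigma-algebra can fail,
    and an almost everywhere argument would not do, since the measure need not be
    complete.  Truncating q1 and q2 to the set where both are bounded by n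
    gives an increasing sequence of integrands to which the bounded case
    applies. *)
Lemma measurable_integral_convpos p1 q1 p2 q2 : integ p1 -> integ p2 ->
  measurable_fun setT (q1 : borel G -> R) -> measurable_fun setT (q2 : borel G -> R) ->
  measurable_fun setT (fun x : borel G => \int[mu]_y (convpos p1 q1 p2 q2 x y)%:E)%E.
Proof.
move=> p1i p2i mq1 mq2.
pose E n : set G := [set x | `|q1 x| <= n%:R /\ `|q2 x| <= n%:R].
have mE n : measurable (E n : set (borel G)).
  have mle q : measurable_fun setT (q : borel G -> R) ->
      measurable ([set x | `|q x| <= n%:R] : set (borel G)).
    move=> mq; rewrite (_ : [set x | _] = (fun x : borel G => `|q x|) @^-1` `]-oo, n%:R]); last first.
      by apply/seteqP; split => x /=; rewrite in_itv.
    by rewrite -[X in measurable X]setTI; apply: measurableT_comp => //; exact: measurable_itv.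
  by apply: measurableI; exact: mle.
pose t q n x : R := q x * ind (E n) x.
have mt q n : measurable_fun setT (q : borel G -> R) -> measurable_fun setT (t q n : borel G -> R).
  by move=> mq; apply: measurable_funM => //; exact: measurable_indic.
have t1 n x : `|t q1 n x| <= n%:R.
  rewrite /t; have [Ex|nE] := pselect (E n x); first by rewrite (ind_in Ex) mulr1; exact: Ex.1.
  by rewrite (ind_out nE) mulr0 normr0.
have t2 n x : `|t q2 n x| <= n%:R.
  rewrite /t; have [Ex|nE] := pselect (E n x); first by rewrite (ind_in Ex) mulr1; exact: Ex.2.
  by rewrite (ind_out nE) mulr0 normr0.
have EE n x y : convpos p1 (t q1 n) p2 (t q2 n) x y = convpos p1 q1 p2 q2 x y * ind (E n) (y^-1 * x)%g.
  rewrite /convpos /t; have [Ex|nE] := pselect (E n (y^-1 * x)%g); first by rewrite (ind_in Ex) !mulr1.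
  by rewrite (ind_out nE) !mulr0 addr0 maxxx.
have W0 p q p' q' x y : 0 <= convpos p q p' q' x y by rewrite le_max lexx.
pose g n x (y : borel G) := (convpos p1 (t q1 n) p2 (t q2 n) x y)%:E.
apply: (@emeasurable_fun_cvg _ (borel G) R setT (fun n (x : borel G) => \int[mu]_y g n x y)%E).
  move=> n; under eq_fun do rewrite -(J_EFin (bounded_integ_convpos p1i p2i (mt _ n mq1) (mt _ n mq2) (t1 n) (t2 n) _)).
  apply/measurable_EFinP; apply: continuous_borel.
  exact: (bounded_J_convpos_continuous p1i p2i (mt _ n mq1) (mt _ n mq2) (t1 n) (t2 n)).
move=> x _.
rewrite (_ : (\int[mu]_y _)%E = \int[mu]_y limn (g^~ x ^~ y))%E; last first.
  apply: eq_integral => y _; apply/esym/cvg_lim => //.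
  have [n nq] : exists n : nat, Num.max `|q1 (y^-1 * x)%g| `|q2 (y^-1 * x)%g| <= n%:R.
    exists (Num.truncn (Num.max `|q1 (y^-1 * x)%g| `|q2 (y^-1 * x)%g|)).+1.
    by apply/ltW/truncnS_gt.
  apply: (@cvg_near_cst _ _ _ _ _); exists n => // m /= nm.
  rewrite /g EE ind_in ?mulr1//; split; apply: le_trans (_ : n%:R <= _); rewrite ?ler_nat//;
    by apply: le_trans nq; rewrite le_max lexx ?orbT.
apply: cvg_monotone_convergence => //.
- by move=> n; apply/measurable_EFinP; apply: measurable_convpos => //; exact: mt.
- by move=> n y _; rewrite lee_fin.
- move=> y _ n m nm; rewrite lee_fin !EE ler_wpM2l//.
  have [[a b]|nE] := pselect (E n (y^-1 * x)%g); last by rewrite (ind_out nE) ind_ge0.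
  by rewrite (ind_in (K := E m)) ?ind_le1//; split; [apply: le_trans a _|apply: le_trans b _]; rewrite ler_nat.
Qed.
End convolution_measurability.

(** * Tonelli's inequality for convolutions *)

Section tonelli.
Context {R : realType} {G : topologicalGroupType} (mu : {measure set (borel G) -> \bar R}).
Hypotheses (Gh : hausdorff_space G) (Gl : locally_compact [set: G])
  (Hmu : is_left_haar_measure mu).
Implicit Types (f g p q : G -> R) (K : set G).
Local Notation J := (realint mu).
Local Notation integ := (integ mu).
Local Notation mass := (mass mu).
Context (D : G -> R) (DD : is_modular mu D).

Definition convabs p q (x : G) (y : borel G) : \bar R := (`|p y| * `|q (y^-1 * x)%g|)%:E.

Lemma convabs_ge0 p q x y : (0 <= convabs p q x y)%E.
Proof. by rewrite lee_fin mulr_ge0. Qed.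

Lemma measurable_convabs p q x : measurable_fun setT (p : borel G -> R) ->
  measurable_fun setT (q : borel G -> R) -> measurable_fun setT (convabs p q x).
Proof.
move=> mp mq; apply/measurable_EFinP; apply: measurable_funM.
  exact: measurableT_comp.
by apply: measurableT_comp => //; exact: measurable_convr.
Qed.

Lemma measurable_integral_convabs p q : integ p -> integ q ->
  measurable_fun setT (fun x : borel G => \int[mu]_y convabs p q x y)%E.
Proof.
move=> ip iq; have := measurable_integral_convpos Gh Gl Hmu (integ_abs ip) (integ0 mu)
  (integ_measurable (integ_abs iq)) (integ_measurable (integ0 mu)).
congr (measurable_fun _ _); apply/funext => x; apply: eq_integral => y _.
by rewrite /convpos mul0r addr0 max_r// mulr_ge0.
Qed.

Lemma convabs_Cc h k : Cc h -> Cc k -> (forall x, 0 <= h x) -> (forall x, 0 <= k x) ->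
  (\int[mu]_(x in setT) \int[mu]_y convabs h k x y = (J h * J k)%:E)%E.
Proof.
move=> hc kc h0 k0; have c2 := Cc2_conv hc kc.
rewrite (_ : J h * J k = J (fun x => J (fun y => h y * k (y^-1 * x)%g))); last first.
  rewrite (Cc_fubini Gh Hmu c2) mulrC -JZ; last exact: Cc_integ.
  congr J; apply/funext => y; rewrite JZ; last by apply: Cc_integ => //; exact: Cc_mulgl.
  by rewrite J_mulgl_Cc// mulrC.
rewrite J_EFin; last by apply: Cc_integ => //; exact: Cc2_integral.
apply: eq_integral => x _; rewrite J_EFin; last by apply: Cc_integ => //; exact: (Cc2_section _ c2).
by apply: eq_integral => y _; rewrite /convabs !ger0_norm.
Qed.

(** Monotone convergence allows to integrate a dominating series termwise, first in y
    and then in x. *)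
Lemma convabs_le_series p q (F : nat -> G -> borel G -> \bar R) (b : nat -> R) B :
  integ p -> integ q ->
  (forall n x y, 0 <= F n x y)%E -> (forall n x, measurable_fun setT (F n x)) ->
  (forall n, measurable_fun setT (fun x : borel G => \int[mu]_y F n x y)%E) ->
  (forall x, {ae mu, forall y, (convabs p q x y <= \sum_(0 <= n <oo) F n x y)%E}) ->
  (forall n, 0 <= b n) ->
  (forall n, (\int[mu]_(x in setT) \int[mu]_y F n x y <= (b n)%:E)%E) ->
  (forall N, \sum_(n < N) b n <= B) ->
  (\int[mu]_(x in setT) \int[mu]_y convabs p q x y <= B%:E)%E.
Proof.
move=> ip iq F0 mF mIF ae b0 Fb bB.
have mp := integ_measurable ip; have mq := integ_measurable iq.
apply: le_trans (_ : \int[mu]_(x in setT) \int[mu]_y \sum_(0 <= n <oo) F n x y <= _)%E.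
  apply: ge0_le_integral => //.
  - by move=> x _; apply: integral_ge0 => y _; exact: convabs_ge0.
  - exact: measurable_integral_convabs.
  - under eq_fun do rewrite integral_nneseries//.
    by apply: ge0_emeasurable_sum => // n x _ _; exact: integral_ge0.
  - move=> x _; apply: ae_ge0_le_integral => //.
    + by move=> y _; exact: convabs_ge0.
    + exact: measurable_convabs.
    + by move=> y _; exact: nneseries_ge0.
    + by apply: ge0_emeasurable_sum => // n x' _ _; exact: F0.
    + by apply: filterS (ae x) => y h _.
under eq_integral do rewrite integral_nneseries//.
rewrite integral_nneseries//; last by move=> n x _; exact: integral_ge0.
apply: le_trans (nneseries_le b0 bB); apply: lee_nneseries => // n _ _.
by apply: integral_ge0 => x _; exact: integral_ge0.
Qed.

Lemma convabs_Cc_right p k : integ p -> Cc k -> (forall x, 0 <= k x) ->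
  (\int[mu]_(x in setT) \int[mu]_y convabs p k x y <= (J (fun y => `|p y|) * J k)%:E)%E.
Proof.
move=> ip kc k0; have ik := Cc_integ Gh Hmu kc.
apply/lee_addgt0Pr => e e0; rewrite -EFinD.
have Jk0 := J_ge0 mu k0.
have e'0 : 0 < e / (J k + 1) by rewrite divr_gt0// ltr_wpDl.
have [h [hc h0 hB ae]] := Cc_domination Gh Gl Hmu ip e'0.
have ih n := Cc_integ Gh Hmu (hc n).
apply: (@convabs_le_series p k (fun n => convabs (h n) k) (fun n => J (h n) * J k)) => //.
- by move=> n x y; exact: convabs_ge0.
- by move=> n x; apply: measurable_convabs; exact: (@integ_measurable _ _ mu).
- by move=> n; exact: measurable_integral_convabs.
- move=> x; apply: filterS ae => y py; rewrite /convabs.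
  under eq_eseriesr do rewrite mulrC EFinM ger0_norm// (ger0_norm (h0 _ _)).
  rewrite nneseriesZl; last by move=> n _; rewrite lee_fin.
  by rewrite EFinM [in leLHS]muleC (ger0_norm (k0 _)); apply: lee_wpmul2l; rewrite ?lee_fin.
- by move=> n; rewrite mulr_ge0// J_ge0.
- by move=> n; rewrite convabs_Cc.
move=> N; rewrite -mulr_suml; apply: le_trans (ler_wpM2r Jk0 (hB N)) _.
rewrite mulrDl lerD2l mulrAC ler_pdivrMr ?ltr_wpDl//.
by rewrite ler_pM2l// lerDl.
Qed.

(** The integrable function p vanishes almost everywhere outside countably many
    compact sets, to each of which [measure_conv_null] applies. *)
Lemma conv_null_ae p (N : set (borel G)) x : integ p -> measurable N -> mu N = 0%E ->
  {ae mu, forall y : borel G, p y != 0 -> ~ N (y^-1 * x)%g}.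
Proof.
move=> ip mN N0; have [h [hc h0 _ ae]] := Cc_domination Gh Gl Hmu ip ltr01.
have : {ae mu, forall y : borel G, forall n, h n y != 0 -> ~ N (y^-1 * x)%g}.
  apply: ae_foralln => n; have [_ [K cK hK]] := hc n.
  exists [set y | K y /\ N (y^-1 * x)%g]; split.
  - apply: measurableI; first exact: compact_borel.
    rewrite -[X in measurable X]setTI.
    exact: (@measurable_convr G _ (borel G) (fun y => y) x (@measurable_id _ _ setT) measurableT _ mN).
  - exact: (measure_conv_null Gh Gl Hmu DD).
  - move=> y /= /not_implyP[hy /contrapT Ny]; split=> //; apply: contrapT => /hK h00.
    by rewrite h00 eqxx in hy.
apply: filterS2 ae => y py H pn0.
apply: contrapT => /contrapT Ny; move: py; rewrite leNgt => /negP; apply.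
rewrite eseries0 ?lte_fin ?normr_gt0// => n _ _; congr EFin.
by apply/eqP; apply: contrapT => /negP hn; exact: (H n hn).
Qed.

(** The inequality is an equality for compactly supported functions, by
    [Cc_fubini].  It extends to integrable functions by domination, first in p
    and then in q. *)
Lemma conv_tonelli p q : integ p -> integ q ->
  (\int[mu]_(x in setT) \int[mu]_y convabs p q x y
    <= (J (fun y => `|p y|) * J (fun y => `|q y|))%:E)%E.
Proof.
move=> ip iq; have Jp0 : 0 <= J (fun y => `|p y|) by exact: J_ge0.
apply/lee_addgt0Pr => e e0; rewrite -EFinD.
have e'0 : 0 < e / (J (fun y => `|p y|) + 1) by rewrite divr_gt0// ltr_wpDl.
have [k [kc k0 kB [N [mN N0 kN]]]] := Cc_domination Gh Gl Hmu iq e'0.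
have ik n := Cc_integ Gh Hmu (kc n).
apply: (@convabs_le_series p q (fun n => convabs p (k n)) (fun n => J (fun y => `|p y|) * J (k n))) => //.
- by move=> n x y; exact: convabs_ge0.
- by move=> n x; apply: measurable_convabs; exact: (@integ_measurable _ _ mu).
- by move=> n; exact: measurable_integral_convabs.
- move=> x; apply: filterS (conv_null_ae x ip mN N0) => y H; rewrite /convabs.
  under eq_eseriesr do rewrite EFinM (ger0_norm (k0 _ _)).
  rewrite nneseriesZl; last by move=> n _; rewrite lee_fin.
  have [->|pn0] := eqVneq (p y) 0; first by rewrite normr0 !mul0r mul0e.
  rewrite EFinM; apply: lee_wpmul2l => //; apply: contrapT => Hn.
  by apply: (H pn0); exact: kN.
- by move=> n; rewrite mulr_ge0// J_ge0.
- by move=> n; exact: convabs_Cc_right.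
move=> M; rewrite -mulr_sumr; apply: le_trans (ler_wpM2l Jp0 (kB M)) _.
rewrite mulrDr lerD2l mulrCA ger_pMr//.
by rewrite ler_pdivrMr ?ltr_wpDl// mul1r lerDl.
Qed.

End tonelli.

(** * Integrals of complex functions *)

Section complex_convolution.
Context {R : realType} {G : topologicalGroupType} (mu : {measure set (borel G) -> \bar R}).
Implicit Types (f g h F : G -> R[i]).
Local Notation J := (realint mu).
Local Notation integ := (integ mu).
Local Notation Re := (@complex.Re R).
Local Notation Im := (@complex.Im R).

Definition cinteg (F : G -> R[i]) : Prop :=
  integ (fun x => Re (F x)) /\ integ (fun x => Im (F x)).

Lemma cintegrableP F : (F : borel G -> R[i]) \in cintegrable mu <-> cinteg F.
Proof. by split=> [/andP[]|[? ?]]; [split|apply/andP; split]. Qed.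

Lemma integ_cabs F : cinteg F -> integ (fun x => cabs (F x)).
Proof. by move=> /cintegrableP; exact: integrable_cabs. Qed.

Lemma Re_le_cabs (z : R[i]) : `|Re z| <= cabs z.
Proof.
case: z => a b; rewrite /cabs /= -sqrtr_sqr; apply: ler_wsqrtr.
by rewrite lerDl sqr_ge0.
Qed.

Lemma Im_le_cabs (z : R[i]) : `|Im z| <= cabs z.
Proof.
case: z => a b; rewrite /cabs /= -sqrtr_sqr; apply: ler_wsqrtr.
by rewrite lerDr sqr_ge0.
Qed.

Definition cint F : R[i] := J (fun x => Re (F x)) +i* J (fun x => Im (F x)).

Lemma cintegD F h : cinteg F -> cinteg h -> cinteg (fun x => F x + h x).
Proof.
move=> [F1 F2] [h1 h2]; split.
  rewrite (_ : (fun x => _) = fun x => Re (F x) + Re (h x)); first exact: integD.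
  by apply/funext => x; case: (F x) (h x) => ? ? [].
rewrite (_ : (fun x => _) = fun x => Im (F x) + Im (h x)); first exact: integD.
by apply/funext => x; case: (F x) (h x) => ? ? [].
Qed.

Lemma cintD F h : cinteg F -> cinteg h -> cint (fun x => F x + h x) = cint F + cint h.
Proof.
move=> [F1 F2] [h1 h2]; rewrite /cint.
rewrite (_ : (fun x => Re _) = fun x => Re (F x) + Re (h x)); last first.
  by apply/funext => x; case: (F x) (h x) => ? ? [].
rewrite (_ : (fun x => Im (_ + _)) = fun x => Im (F x) + Im (h x)); last first.
  by apply/funext => x; case: (F x) (h x) => ? ? [].
by rewrite !JD.
Qed.

Lemma complex_ReM (a z : R[i]) : Re (a * z) = Re a * Re z - Im a * Im z.
Proof. by case: a z => ? ? []. Qed.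

Lemma complex_ImM (a z : R[i]) : Im (a * z) = Re a * Im z + Im a * Re z.
Proof. by case: a z => ? ? []. Qed.

Lemma cintegZ a F : cinteg F -> cinteg (fun x => a * F x).
Proof.
move=> [F1 F2]; split; [under eq_fun do rewrite complex_ReM|under eq_fun do rewrite complex_ImM].
  by apply: integB; exact: integZ.
by apply: integD; exact: integZ.
Qed.

Lemma cintZ a F : cinteg F -> cint (fun x => a * F x) = a * cint F.
Proof.
move=> [F1 F2]; rewrite /cint; apply/eqP; rewrite eq_complex complex_ReM complex_ImM /=.
under eq_fun do rewrite complex_ReM; under [X in _ && (J X == _)]eq_fun do rewrite complex_ImM.
by rewrite JB ?JD ?JZ ?eqxx//; exact: integZ.
Qed.

(** With z the value of the integral, |z|^2 is the integral of Re(z^* F), which is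
    at most |z| |F|. *)
Lemma cint_cabs F : cinteg F -> cabs (cint F) <= J (fun x => cabs (F x)).
Proof.
move=> Fi; have Ji := integ_cabs Fi; have J0' := J_ge0 mu (fun x => cabs_ge0 (F x)).
set z := cint F; have [z0|z0] := eqVneq (cabs z) 0; first by rewrite z0.
have zp : 0 < cabs z by rewrite lt_neqAle eq_sym z0 cabs_ge0.
have cz : cabs z^* = cabs z.
  by rewrite /cabs; case: (z) => a b /=; rewrite sqrrN.
have zz : cabs z ^+ 2 = Re (z^* * z).
  by rewrite /cabs; case: (z) => a b /=; rewrite sqr_sqrtr ?addr_ge0 ?sqr_ge0// mulNr opprK !expr2.
rewrite -(ler_pM2l zp) -expr2 zz /z -cintZ//= -JZ//.
apply: J_le; [by case: (cintegZ z^* Fi)|exact: integZ|].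
by move=> x; rewrite -{1}cz -cabsM; apply: le_trans (ler_norm _) (Re_le_cabs _).
Qed.

Lemma cinteg_dominated F (k : G -> R) : measurable_fun setT (fun x : borel G => Re (F x)) ->
  measurable_fun setT (fun x : borel G => Im (F x)) -> integ k ->
  (forall x, cabs (F x) <= k x) -> cinteg F.
Proof.
move=> m1 m2 ki Fk; split; apply: (le_integ _ ki) => // x; apply: le_trans (Fk x).
  exact: Re_le_cabs.
exact: Im_le_cabs.
Qed.

End complex_convolution.

(** * Convolution of integrable functions *)

Section convolution.
Context {R : realType} {G : topologicalGroupType} (mu : {measure set (borel G) -> \bar R}).
Hypotheses (Gh : hausdorff_space G) (Gl : locally_compact [set: G])
  (Hmu : is_left_haar_measure mu).
Implicit Types (f g h F : G -> R[i]).
Local Notation J := (realint mu).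
Local Notation integ := (integ mu).
Local Notation cinteg := (cinteg mu).
Local Notation cint := (cint mu).
Local Notation Re := (@complex.Re R).
Local Notation Im := (@complex.Im R).
Context (D : G -> R) (DD : is_modular mu D).

(** The integral of a real function is the difference of those of its positive and
    negative parts, even where it is not integrable. *)
Lemma measurable_J_conv p1 q1 p2 q2 : integ p1 -> integ q1 -> integ p2 -> integ q2 ->
  measurable_fun setT (fun x : borel G =>
    J (fun y => p1 y * q1 (y^-1 * x)%g + p2 y * q2 (y^-1 * x)%g)).
Proof.
move=> i1 /integ_measurable j1 i2 /integ_measurable j2.
have E (x : G) : J (fun y => p1 y * q1 (y^-1 * x)%g + p2 y * q2 (y^-1 * x)%g) =
   fine (\int[mu]_y (convpos p1 q1 p2 q2 x y)%:E -
     \int[mu]_y (convpos (fun y => - p1 y) q1 (fun y => - p2 y) q2 x y)%:E)%E.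
  rewrite /realint /Rintegral integralE; congr (fine (_ - _)%E); apply: eq_integral => y _.
    by rewrite funeposE /convpos -EFin_max maxC.
  rewrite funenegE /convpos /= -EFin_max maxC !mulNr -opprD //.
under eq_fun do rewrite E; apply: measurableT_comp => //.
by apply: emeasurable_funB; apply: measurable_integral_convpos => //; exact: integN.
Qed.

Lemma measurable_Re_conv f g : cinteg f -> cinteg g ->
  measurable_fun setT (fun x : borel G => Re (convolution mu f g x)).
Proof.
move=> [f1 f2] [g1 g2].
have := measurable_J_conv f1 g1 f2 (integN g2).
congr measurable_fun; apply/funext => x; congr J; apply/funext => y.
by rewrite complex_ReM mulrN.
Qed.

Lemma measurable_Im_conv f g : cinteg f -> cinteg g ->
  measurable_fun setT (fun x : borel G => Im (convolution mu f g x)).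
Proof.
move=> [f1 f2] [g1 g2].
have := measurable_J_conv f1 g2 f2 g1.
congr measurable_fun; apply/funext => x; congr J; apply/funext => y.
by rewrite complex_ImM.
Qed.

Local Notation abs f := (fun x => cabs (f x)).

(** Fails only on a null set; there the value of the convolution is arbitrary. *)
Definition convolvable f g x := (\int[mu]_y convabs (abs f) (abs g) x y < +oo)%E.

Lemma ae_convolvable f g : cinteg f -> cinteg g ->
  {ae mu, forall x : borel G, convolvable f g x}.
Proof.
move=> /integ_cabs fi /integ_cabs gi.
have A0 x : (0 <= \int[mu]_y convabs (abs f) (abs g) x y)%E.
  by apply: integral_ge0 => y _; exact: convabs_ge0.
have Ai : mu.-integrable setT (fun x : borel G => \int[mu]_y convabs (abs f) (abs g) x y)%E.
  apply/integrableP; split; first exact: measurable_integral_convabs.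
  under eq_integral do rewrite gee0_abs//.
  by apply: le_lt_trans (conv_tonelli Gh Gl Hmu DD fi gi) _; rewrite ltry.
apply: filterS (integrable_ae measurableT Ai) => x /(_ I).
by rewrite /convolvable ge0_fin_numE.
Qed.

Lemma measurable_conv_kernel f g x : cinteg f -> cinteg g ->
  measurable_fun setT (fun y : borel G => Re (f y * g (y^-1 * x)%g)) /\
  measurable_fun setT (fun y : borel G => Im (f y * g (y^-1 * x)%g)).
Proof.
move=> [/integ_measurable f1 /integ_measurable f2] [/integ_measurable g1 /integ_measurable g2].
have c1 := measurable_convr x g1; have c2 := measurable_convr x g2.
split; [under eq_fun do rewrite complex_ReM|under eq_fun do rewrite complex_ImM].
  by apply: measurable_funB; exact: measurable_funM.
by apply: measurable_funD; exact: measurable_funM.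
Qed.

Lemma integ_convabs f g x : cinteg f -> cinteg g -> convolvable f g x ->
  integ (fun y => cabs (f y) * cabs (g (y^-1 * x)%g)).
Proof.
move=> /integ_cabs/integ_measurable mf /integ_cabs/integ_measurable mg fgx.
have mc : measurable_fun setT (fun y : borel G => cabs (f y) * cabs (g (y^-1 * x)%g)).
  by apply: measurable_funM => //; exact: (measurable_convr x mg).
apply/integrableP; split; first exact/measurable_EFinP.
apply: le_lt_trans fgx; rewrite le_eqVlt; apply/orP; left; apply/eqP.
by apply: eq_integral => y _; rewrite /= normrM.
Qed.

Lemma cinteg_conv_kernel f g x : cinteg f -> cinteg g -> convolvable f g x ->
  cinteg (fun y => f y * g (y^-1 * x)%g).
Proof.
move=> fi gi fgx; have [m1 m2] := measurable_conv_kernel x fi gi.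
apply: (cinteg_dominated m1 m2 (integ_convabs fi gi fgx)) => y.
by rewrite cabsM.
Qed.

Lemma cabs_conv_le f g x : cinteg f -> cinteg g -> convolvable f g x ->
  cabs (convolution mu f g x) <= fine (\int[mu]_y convabs (abs f) (abs g) x y).
Proof.
move=> fi gi fgx; apply: le_trans (cint_cabs (cinteg_conv_kernel fi gi fgx)) _.
rewrite le_eqVlt; apply/orP; left; apply/eqP; congr fine; apply: eq_integral => y _.
by rewrite /convabs !ger0_norm ?cabs_ge0//= cabsM.
Qed.

Lemma integ_fine_convabs f g : cinteg f -> cinteg g ->
  integ (fun x => fine (\int[mu]_y convabs (abs f) (abs g) x y)) /\
  J (fun x => fine (\int[mu]_y convabs (abs f) (abs g) x y)) <= J (abs f) * J (abs g).
Proof.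
move=> fi gi; have S := ae_convolvable fi gi.
move: (integ_cabs fi) (integ_cabs gi) => {}fi {}gi.
have A0 x : (0 <= \int[mu]_y convabs (abs f) (abs g) x y)%E.
  by apply: integral_ge0 => y _; exact: convabs_ge0.
have mA := measurable_integral_convabs Gh Gl Hmu fi gi.
have mfA := measurableT_comp (@fine_measurable R setT measurableT) mA.
have T := conv_tonelli Gh Gl Hmu DD fi gi.
have E : (\int[mu]_x (fine (\int[mu]_y convabs (abs f) (abs g) (x : borel G) y))%:E =
    \int[mu]_(x in setT) \int[mu]_y convabs (abs f) (abs g) x y)%E.
  apply: ge0_ae_eq_integral => //.
  - by apply/measurable_EFinP.
  - by move=> x _; rewrite lee_fin fine_ge0.
  - by apply: filterS S => x fgx _; rewrite fineK// ge0_fin_numE.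
have Ai : integ (fun x => fine (\int[mu]_y convabs (abs f) (abs g) x y)).
  apply/integrableP; split; first exact/measurable_EFinP.
  under eq_integral do rewrite gee0_abs ?lee_fin ?fine_ge0//.
  by rewrite E; apply: le_lt_trans T _; rewrite ltry.
split=> //; rewrite -lee_fin J_EFin// E; apply: le_trans T _.
rewrite lee_fin le_eqVlt; apply/orP; left; apply/eqP.
by congr (J _ * J _); apply/funext => x; rewrite ger0_norm ?cabs_ge0.
Qed.

End convolution.

(** * The convolution product on L1 *)

Section L1_functions.
Context {R : realType} {G : topologicalGroupType} (mu : {measure set (borel G) -> \bar R}).
Implicit Types (f g h F : G -> R[i]).
Local Notation J := (realint mu).
Local Notation integ := (integ mu).
Local Notation cinteg := (cinteg mu).
Local Notation cint := (cint mu).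
Local Notation Re := (@complex.Re R).
Local Notation Im := (@complex.Im R).
Local Notation abs f := (fun x => cabs (f x)).
Local Notation cls f := (L1class mu (f : borel G -> R[i])).

Lemma ae_le_integ (f g : G -> R) : measurable_fun setT (f : borel G -> R) -> integ g ->
  {ae mu, forall x : borel G, `|f x| <= g x} -> integ f.
Proof.
move=> mf gi fg; have mg := integ_measurable (integ_abs gi).
apply/integrableP; split; first exact/measurable_EFinP.
apply: le_lt_trans (integrable_lty measurableT (integ_abs gi)).
apply: ae_ge0_le_integral => //.
- by apply: measurableT_comp => //; exact/measurable_EFinP.
- by move=> x _; rewrite lee_fin.
- exact/measurable_EFinP.
- by apply: filterS fg => x h _; rewrite lee_fin; apply: le_trans h (ler_norm _).
Qed.

Lemma J_ae_eq (f g : G -> R) : measurable_fun setT (f : borel G -> R) ->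
  measurable_fun setT (g : borel G -> R) -> {ae mu, forall x : borel G, f x = g x} -> J f = J g.
Proof.
move=> mf mg fg; congr fine; apply: ae_eq_integral => //; [exact/measurable_EFinP|exact/measurable_EFinP|].
by apply: filterS fg => x -> _.
Qed.

Lemma J_ae_le (f g : G -> R) : integ f -> integ g ->
  {ae mu, forall x : borel G, f x <= g x} -> J f <= J g.
Proof.
(* Reduces to a pointwise inequality by changing g on a null set. *)
move=> fi gi fg; pose m x := Num.max (f x) (g x).
have mm : measurable_fun setT (m : borel G -> R).
  by apply: measurable_maxr; [exact: integ_measurable fi|exact: integ_measurable gi].
have mi : integ m.
  apply: (le_integ mm (integD (integ_abs fi) (integ_abs gi))) => x.
  by rewrite /m maxEle; case: ifP => _; rewrite ?lerDl ?lerDr.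
rewrite (_ : J g = J m); first by apply: J_le => // x; rewrite /m le_max lexx.
apply: J_ae_eq => //; first exact: integ_measurable gi.
by apply: filterS fg => x h; rewrite /m max_r.
Qed.

Lemma cinteg_ae_dominated F (k : G -> R) : measurable_fun setT (fun x : borel G => Re (F x)) ->
  measurable_fun setT (fun x : borel G => Im (F x)) -> integ k ->
  {ae mu, forall x : borel G, cabs (F x) <= k x} -> cinteg F.
Proof.
move=> m1 m2 ki Fk; split; apply: (ae_le_integ _ ki) => //; apply: filterS Fk => x; apply: le_trans.
  exact: Re_le_cabs.
exact: Im_le_cabs.
Qed.

Lemma L1repr_cinteg (u : L1 mu) : cinteg (L1repr u).
Proof. by apply/cintegrableP; exact: (valP (repr u)). Qed.

Lemma nrmL1 (u : L1 mu) : nrm u = J (abs (L1repr u)).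
Proof. by []. Qed.

Lemma cls_repr F : cinteg F -> {ae mu, forall x, L1repr (cls F) x = F x}.
Proof. by move=> /cintegrableP; exact: L1repr_class. Qed.

Lemma nrm_cls F : cinteg F -> nrm (cls F) = J (abs F).
Proof.
move=> Fi; rewrite nrmL1; apply: J_ae_eq.
- exact: integ_measurable (integ_cabs (L1repr_cinteg _)).
- exact: integ_measurable (integ_cabs Fi).
- by apply: filterS (cls_repr Fi) => x ->.
Qed.

Lemma cls_eq F h : cinteg F -> cinteg h -> {ae mu, forall x : borel G, F x = h x} -> cls F = cls h.
Proof.
move=> Fi hi Fh; apply: L1_eqP; apply: filterS3 (cls_repr Fi) (cls_repr hi) Fh.
by move=> x -> ->.
Qed.

Lemma clsD F h : cinteg F -> cinteg h -> cls (fun x => F x + h x) = cls F + cls h.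
Proof.
move=> Fi hi; apply: L1_eqP; apply: filterS3 (cls_repr Fi) (cls_repr hi)
  (filterI (cls_repr (cintegD Fi hi)) (L1reprD (cls F) (cls h))).
by move=> x Fx hx [-> ->]; rewrite Fx hx.
Qed.

Lemma clsZ a F : cinteg F -> cls (fun x => a * F x) = a *: cls F.
Proof.
move=> Fi; apply: L1_eqP; apply: filterS3 (cls_repr Fi) (cls_repr (cintegZ a Fi))
  (L1repr_scale a (cls F)).
by move=> x Fx -> ->; rewrite Fx.
Qed.

Lemma cls_reprK (u : L1 mu) : cls (L1repr u) = u.
Proof. by apply: L1_eqP; exact: (cls_repr (L1repr_cinteg u)). Qed.

Lemma L1repr_linear a (u v : L1 mu) :
  {ae mu, forall x, L1repr (a *: u + v) x = a * L1repr u x + L1repr v x}.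
Proof.
apply: filterS2 (L1reprD (a *: u) v) (L1repr_scale a u) => x -> h.
by rewrite -h.
Qed.

End L1_functions.

Section convolution_L1.
Context {R : realType} {G : topologicalGroupType} (mu : {measure set (borel G) -> \bar R}).
Hypotheses (Gh : hausdorff_space G) (Gl : locally_compact [set: G])
  (Hmu : is_left_haar_measure mu).
Implicit Types (f g h F : G -> R[i]).
Local Notation J := (realint mu).
Local Notation integ := (integ mu).
Local Notation cinteg := (cinteg mu).
Local Notation cint := (cint mu).
Local Notation abs f := (fun x => cabs (f x)).
Local Notation cls f := (L1class mu (f : borel G -> R[i])).
Local Notation conv := (convolution mu).
Context (D : G -> R) (DD : is_modular mu D).

Lemma conv_cinteg f g : cinteg f -> cinteg g -> cinteg (conv f g).
Proof.
move=> fi gi; apply: (cinteg_ae_dominated (measurable_Re_conv Gh Gl Hmu fi gi)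
  (measurable_Im_conv Gh Gl Hmu fi gi) (integ_fine_convabs Gh Gl Hmu DD fi gi).1).
by apply: filterS (ae_convolvable Gh Gl Hmu DD fi gi) => x; exact: cabs_conv_le.
Qed.

Lemma J_conv_le f g : cinteg f -> cinteg g -> J (abs (conv f g)) <= J (abs f) * J (abs g).
Proof.
move=> fi gi; have [Ai] := integ_fine_convabs Gh Gl Hmu DD fi gi; apply: le_trans.
apply: J_ae_le => //; first exact: integ_cabs (conv_cinteg fi gi).
by apply: filterS (ae_convolvable Gh Gl Hmu DD fi gi) => x; exact: cabs_conv_le.
Qed.

(** The value at every point x only depends on the classes of f and g. *)
Lemma conv_ae_eq f f' g g' x : cinteg f -> cinteg f' -> cinteg g -> cinteg g' ->
  {ae mu, forall y : borel G, f y = f' y} -> {ae mu, forall y : borel G, g y = g' y} ->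
  conv f g x = conv f' g' x.
Proof.
move=> fi f'i gi g'i ff' [N [mN N0 gN]].
have [m1 m2] := measurable_conv_kernel x fi gi.
have [m1' m2'] := measurable_conv_kernel x f'i g'i.
have ae : {ae mu, forall y : borel G, f y * g (y^-1 * x)%g = f' y * g' (y^-1 * x)%g}.
  apply: filterS2 ff' (conv_null_ae Gh Gl Hmu DD x (integ_cabs fi) mN N0) => y <- H.
  have [->|fy0] := eqVneq (f y) 0; first by rewrite !mul0r.
  congr (_ * _); apply: contrapT => ng; apply: H; last exact: gN.
  by apply: contra_neq fy0; exact: cabs_eq0.
rewrite /convolution /cintegral; congr (_ +i* _); apply: J_ae_eq => //;
  by apply: filterS ae => y ->.
Qed.

Lemma conv_linearl a f g h x : cinteg f -> cinteg g -> cinteg h ->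
  convolvable mu f h x -> convolvable mu g h x ->
  conv (fun y => a * f y + g y) h x = a * conv f h x + conv g h x.
Proof.
move=> fi gi hi fx gx.
have F := cinteg_conv_kernel fi hi fx; have H := cinteg_conv_kernel gi hi gx.
rewrite /convolution -(cintZ a F) -(cintD (cintegZ a F) H).
by congr cint; apply/funext => y; rewrite mulrDl mulrA.
Qed.

Lemma conv_linearr a f g h x : cinteg f -> cinteg g -> cinteg h ->
  convolvable mu f g x -> convolvable mu f h x ->
  conv f (fun y => a * g y + h y) x = a * conv f g x + conv f h x.
Proof.
move=> fi gi hi fx gx.
have F := cinteg_conv_kernel fi gi fx; have H := cinteg_conv_kernel fi hi gx.
rewrite /convolution -(cintZ a F) -(cintD (cintegZ a F) H).
by congr cint; apply/funext => y; rewrite mulrDr mulrCA.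
Qed.

Lemma L1conv_cls f g : cinteg f -> cinteg g -> L1conv (cls f) (cls g) = cls (conv f g).
Proof.
move=> fi gi; congr (cls _); apply/funext => x; apply: conv_ae_eq => //;
  by [exact: L1repr_cinteg|exact: cls_repr].
Qed.

Lemma cls_linear a f g : cinteg f -> cinteg g -> cls (fun y => a * f y + g y) = a *: cls f + cls g.
Proof. by move=> fi gi; rewrite clsD ?clsZ//; exact: cintegZ. Qed.

Lemma L1conv_linearl w : linear (fun u : L1 mu => L1conv u w).
Proof.
move=> a u v; rewrite -(cls_reprK u) -(cls_reprK v) -(cls_reprK w).
move: (L1repr u) (L1repr v) (L1repr w) (L1repr_cinteg u) (L1repr_cinteg v) (L1repr_cinteg w).
move=> f g h fi gi hi; have fgi := cintegD (cintegZ a fi) gi.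
rewrite -cls_linear// !L1conv_cls// -cls_linear; [|exact: conv_cinteg|exact: conv_cinteg].
apply: cls_eq; [exact: conv_cinteg|by apply: cintegD; [apply: cintegZ|]; exact: conv_cinteg|].
apply: filterS2 (ae_convolvable Gh Gl Hmu DD fi hi) (ae_convolvable Gh Gl Hmu DD gi hi) => x fx gx.
exact: conv_linearl.
Qed.

Lemma L1conv_linearr w : linear (fun u : L1 mu => L1conv w u).
Proof.
move=> a u v; rewrite -(cls_reprK u) -(cls_reprK v) -(cls_reprK w).
move: (L1repr u) (L1repr v) (L1repr w) (L1repr_cinteg u) (L1repr_cinteg v) (L1repr_cinteg w).
move=> f g h fi gi hi; have fgi := cintegD (cintegZ a fi) gi.
rewrite -cls_linear// !L1conv_cls// -cls_linear; [|exact: conv_cinteg|exact: conv_cinteg].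
apply: cls_eq; [exact: conv_cinteg|by apply: cintegD; [apply: cintegZ|]; exact: conv_cinteg|].
apply: filterS2 (ae_convolvable Gh Gl Hmu DD hi fi) (ae_convolvable Gh Gl Hmu DD hi gi) => x fx gx.
exact: conv_linearr.
Qed.

Lemma L1conv_norm (u v : L1 mu) : nrm (L1conv u v) <= nrm u * nrm v.
Proof.
rewrite -(cls_reprK u) -(cls_reprK v); move: (L1repr_cinteg u) (L1repr_cinteg v) => fi gi.
rewrite L1conv_cls// !nrm_cls//; first exact: J_conv_le.
exact: conv_cinteg.
Qed.

Lemma L1conv_bilinear : exists B : {bilinear L1 mu -> L1 mu -> L1 mu}, B = @L1conv R G mu :> (_ -> _ -> _).
Proof.
have H : bilinear_for *:%R *:%R (@L1conv R G mu : L1 mu -> L1 mu -> L1 mu).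
  by split=> u; [exact: L1conv_linearl|exact: L1conv_linearr].
pose B := bilinear_isBilinear.Build R[i] (L1 mu) (L1 mu) (L1 mu) *:%R *:%R (@L1conv R G mu) H.
pose C : {bilinear L1 mu -> L1 mu -> L1 mu} := HB.pack (@L1conv R G mu) B.
by exists C.
Qed.

End convolution_L1.

(** * Completeness of L1 *)

Section completeness.
Context {R : realType} {G : topologicalGroupType} (mu : {measure set (borel G) -> \bar R}).
Implicit Types (F : G -> R[i]).
Local Notation J := (realint mu).
Local Notation integ := (integ mu).
Local Notation cinteg := (cinteg mu).
Local Notation Re := (@complex.Re R).
Local Notation Im := (@complex.Im R).
Local Notation abs f := (fun x => cabs (f x)).
Local Notation cls f := (L1class mu (f : borel G -> R[i])).

Lemma ReB (a b : R[i]) : Re (a - b) = Re a - Re b.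
Proof. by case: a b => ? ? []. Qed.

Lemma ImB (a b : R[i]) : Im (a - b) = Im a - Im b.
Proof. by case: a b => ? ? []. Qed.

Lemma measurable_cabs F : measurable_fun setT (fun x : borel G => Re (F x)) ->
  measurable_fun setT (fun x : borel G => Im (F x)) ->
  measurable_fun setT (fun x : borel G => cabs (F x)).
Proof.
move=> mR mI; rewrite (_ : (fun x => _) = (@Num.sqrt R) \o
    (fun x : borel G => Re (F x) ^+ 2 + Im (F x) ^+ 2)).
  apply: measurableT_comp.
    by apply: continuous_measurable_fun; exact: sqrt_continuous.
  by apply: measurable_funD; exact: measurable_funX.
by apply/funext => x; rewrite /= /cabs; case: (F x).
Qed.

Lemma cabs_le_Re_Im (z : R[i]) : cabs z <= `|Re z| + `|Im z|.
Proof.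
have {1}-> : z = (Re z)%:C + 'i%C * (Im z)%:C by exact: complexE.
by apply: le_trans (cabsD _ _) _; rewrite cabsM !cabsR cabsi mul1r.
Qed.

Lemma abs_summable_cvg (f : nat -> R) :
  (\sum_(0 <= n <oo) `|f n.+1 - f n|%:E < +oo)%E -> cvgn f.
Proof.
move=> /nneseries_abs_cvg/cvg_ex[l].
have -> : series (fun n => f n.+1 - f n) = fun n => f n - f 0%N.
  by apply/funext => n; rewrite /series /= telescope_sumr.
move=> fl; apply/cvg_ex; exists (l + f 0%N).
rewrite (_ : f = fun n => (f n - f 0%N) + f 0%N); last by apply/funext => n; rewrite subrK.
by apply: cvgD => //; rewrite subrK; exact: cvg_cst.
Qed.

(** The superior limit provides a measurable candidate at all points. *)
Lemma measurable_pointwise_limit (f : nat -> G -> R) :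
  (forall n, measurable_fun setT (f n : borel G -> R)) ->
  exists2 l, measurable_fun setT (l : borel G -> R) & forall x, cvgn (f^~ x) -> f n x @[n --> \oo] --> l x.
Proof.
move=> mf; exists (fun x => fine (limn_esup (fun n => (f n x)%:E))).
  apply: (measurableT_comp (@fine_measurable R setT measurableT)).
  by apply: measurable_fun_limn_esup => n; exact/measurable_EFinP.
move=> x cf; have cE : (f n x)%:E @[n --> \oo] --> (limn (f^~ x))%:E.
  by apply: cvg_EFin; [exact: nearW|exact: cf].
rewrite is_cvg_limn_esupE; last by apply/cvg_ex; eexists; exact: cE.
by rewrite (cvg_lim _ cE).
Qed.

(** Riesz-Fischer: the series of increments converges absolutely almost
    everywhere, and integrating its tail gives the estimate. *)
Lemma L1_series_complete : series_complete (L1 mu).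
Proof.
move=> u t B ut tB; pose f n := L1repr (u n); pose d n x := f n.+1 x - f n x.
have fi n : cinteg (f n) by exact: L1repr_cinteg.
have di n : cinteg (d n).
  rewrite (_ : d n = fun x => f n.+1 x + -1 * f n x); first exact: cintegD (cintegZ _ _).
  by apply/funext => x; rewrite mulN1r.
have Jd n : J (abs (d n)) <= t n.+1 - t n.
  apply: le_trans (ut n); rewrite nrmL1 le_eqVlt; apply/orP; left; apply/eqP.
  apply: J_ae_eq; [exact: integ_measurable (integ_cabs (di n))|
    exact: integ_measurable (integ_cabs (L1repr_cinteg _))|].
  have := L1repr_linear (-1) (u n) (u n.+1); rewrite scaleN1r addrC.
  by apply: filterS => x ->; rewrite mulN1r addrC.
have Sd n N : \sum_(k < N) J (abs (d (n + k)%N)) <= B - t n.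
  apply: le_trans (_ : t (n + N)%N - t n <= _); last by rewrite lerD2r.
  elim: N => [|N IH]; first by rewrite big_ord0 addn0 subrr.
  rewrite big_ord_recr /= addnS (_ : t _ - _ = t (n + N)%N - t n + (t (n + N).+1 - t (n + N)%N)); last by ring.
  exact: lerD.
have aeS : {ae mu, forall x : borel G, (\sum_(0 <= n <oo) `|cabs (d n x)|%:E < +oo)%E}.
  apply: (ae_summable (B := B - t 0%N)) => [n|N]; first exact: integ_cabs.
  apply: le_trans (Sd 0%N N); rewrite le_eqVlt; apply/orP; left; apply/eqP.
  by apply: eq_bigr => k _; congr J; apply/funext => x; rewrite ger0_norm ?cabs_ge0.
have [l1 ml1 fl1] := measurable_pointwise_limit (fun n => integ_measurable (fi n).1).
have [l2 ml2 fl2] := measurable_pointwise_limit (fun n => integ_measurable (fi n).2).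
pose l x : R[i] := l1 x +i* l2 x.
have ael : {ae mu, forall x : borel G, cabs (l x - f n x) @[n --> \oo] --> 0}.
  apply: filterS aeS => x Sx.
  have {}fl1 : Re (f n x) @[n --> \oo] --> l1 x.
    apply: fl1; apply: abs_summable_cvg; apply: le_lt_trans Sx.
    apply: lee_nneseries => // n _.
    by rewrite lee_fin [leRHS]ger0_norm ?cabs_ge0// -ReB; exact: Re_le_cabs.
  have {}fl2 : Im (f n x) @[n --> \oo] --> l2 x.
    apply: fl2; apply: abs_summable_cvg; apply: le_lt_trans Sx.
    apply: lee_nneseries => // n _.
    by rewrite lee_fin [leRHS]ger0_norm ?cabs_ge0// -ImB; exact: Im_le_cabs.
  apply/cvgrPdist_le => e e0; have e20 : 0 < e / 2 by rewrite divr_gt0.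
  move/cvgrPdist_le: fl1 => /(_ _ e20) H1; move/cvgrPdist_le: fl2 => /(_ _ e20).
  apply: filterS2 H1 => n h1 h2; rewrite sub0r normrN ger0_norm ?cabs_ge0//.
  by apply: le_trans (cabs_le_Re_Im _) _; rewrite ReB ImB [leRHS]splitr lerD.
have mlf n : measurable_fun setT (fun x : borel G => Re (l x - f n x)) /\
    measurable_fun setT (fun x : borel G => Im (l x - f n x)).
  have [/integ_measurable m1 /integ_measurable m2] := fi n.
  by split; [under eq_fun do rewrite ReB|under eq_fun do rewrite ImB]; exact: measurable_funB.
have lB n : (\int[mu]_x (cabs (l (x : borel G) - f n x))%:E <= (B - t n)%:E)%E.
  apply: le_trans (_ : \int[mu]_x \sum_(0 <= k <oo) (cabs (d (n + k)%N (x : borel G)))%:E <= _)%E; last first.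
    rewrite integral_nneseries//; last 2 first.
    - by move=> k; apply/measurable_EFinP; exact: integ_measurable (integ_cabs (di _)).
    - by move=> k x _; rewrite lee_fin cabs_ge0.
    under eq_eseriesr do rewrite -(J_EFin (integ_cabs (di _))).
    by apply: nneseries_le (Sd n) => k; apply: J_ge0 => x; exact: cabs_ge0.
  apply: ae_ge0_le_integral => //.
  - by move=> x _; rewrite lee_fin cabs_ge0.
  - by apply/measurable_EFinP; exact: measurable_cabs (mlf n).1 (mlf n).2.
  - by move=> x _; apply: nneseries_ge0 => k _ _; rewrite lee_fin cabs_ge0.
  - apply: ge0_emeasurable_sum => [k x _ _|k _]; first by rewrite lee_fin cabs_ge0.
    by apply/measurable_EFinP; exact: integ_measurable (integ_cabs (di _)).
  apply: filterS ael => x lx _.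
  have df m : (cabs (f (n + m)%N x - f n x) <= \sum_(k < m) cabs (d (n + k)%N x)).
    elim: m => [|m IH]; first by rewrite addn0 subrr cabs0 big_ord0.
    rewrite big_ord_recr /= (_ : _ - _ = (f (n + m)%N x - f n x) + d (n + m)%N x); last first.
      by rewrite /d addnS; zmod_identity.
    by apply: le_trans (cabsD _ _) _; rewrite lerD2r.
  apply/lee_addgt0Pr => e e0; have /cvgrPdist_le/(_ e e0)[N _ /(_ (n + N)%N)] := lx.
  move=> /(_ (leq_addl _ _)); rewrite sub0r normrN ger0_norm ?cabs_ge0// => h.
  have := nneseries_partial N (fun k => cabs_ge0 (d (n + k)%N x)).
  move=> /(fun H => leeD H (lexx e%:E)); apply: le_trans; rewrite -EFinD lee_fin [leRHS]addrC.
  apply: le_trans (lerD h (df N)); apply: le_trans (cabsD _ _).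
  by rewrite subrKA.
have lfi n : cinteg (fun x => l x - f n x).
  have [m1 m2] := mlf n.
  apply: (cinteg_dominated m1 m2 (k := fun x => cabs (l x - f n x))) => //.
  apply/integrableP; split; first by apply/measurable_EFinP; exact: measurable_cabs.
  under eq_integral do rewrite /= ger0_norm ?cabs_ge0//.
  by apply: le_lt_trans (lB n) _; rewrite ltry.
have li : cinteg l.
  rewrite (_ : l = fun x => (l x - f 0%N x) + f 0%N x); first exact: cintegD.
  by apply/funext => x; rewrite subrK.
exists (cls l) => n; rewrite -lee_fin; apply: le_trans (lB n).
rewrite -(J_EFin (integ_cabs (lfi n))) lee_fin -nrm_cls// le_eqVlt; apply/orP; left; apply/eqP.
congr nrm; rewrite -[u n]cls_reprK (_ : (fun x => _) = (fun x => l x + -1 * f n x)).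
  by rewrite clsD ?clsZ ?scaleN1r//; exact: cintegZ.
by apply/funext => x; rewrite mulN1r.
Qed.

End completeness.

(** * Translations as double multipliers of L1 *)

Section translations.
Context {R : realType} {G : topologicalGroupType} (mu : {measure set (borel G) -> \bar R}).
Hypotheses (Gh : hausdorff_space G) (Gl : locally_compact [set: G])
  (Hmu : is_left_haar_measure mu).
Implicit Types (F f g h : G -> R[i]).
Local Notation J := (realint mu).
Local Notation integ := (integ mu).
Local Notation cinteg := (cinteg mu).
Local Notation cint := (cint mu).
Local Notation abs f := (fun x => cabs (f x)).
Local Notation cls f := (L1class mu (f : borel G -> R[i])).
Local Notation conv := (convolution mu).
Context (D : G -> R) (DD : is_modular mu D).

(** Operators on functions that respect almost everywhere equality descend to L^1. *)
Lemma L1_operator (T : (G -> R[i]) -> G -> R[i]) :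
  (forall F, cinteg F -> cinteg (T F)) ->
  (forall a F h, T (fun x => a * F x + h x) = fun x => a * T F x + T h x) ->
  (forall F h, {ae mu, forall x : borel G, F x = h x} -> {ae mu, forall x : borel G, T F x = T h x}) ->
  (forall F, cinteg F -> J (abs (T F)) <= J (abs F)) ->
  exists U : {linear L1 mu -> L1 mu}, contractive U /\
    forall F, cinteg F -> U (cls F) = cls (T F).
Proof.
move=> Ti Tl Tae Tn; pose U (u : L1 mu) := cls (T (L1repr u)).
have Ucls F : cinteg F -> U (cls F) = cls (T F).
  move=> Fi; apply: cls_eq; [exact/Ti/L1repr_cinteg|exact: Ti|].
  by apply: Tae; exact: cls_repr.
have Ul : linear U.
  move=> a u v; rewrite -(cls_reprK u) -(cls_reprK v).
  move: (L1repr u) (L1repr v) (L1repr_cinteg u) (L1repr_cinteg v) => F h Fi hi.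
  rewrite -cls_linear// !Ucls//; last by apply: cintegD => //; exact: cintegZ.
  by rewrite Tl cls_linear//; exact: Ti.
pose L := GRing.isLinear.Build R[i] (L1 mu) (L1 mu) *:%R U Ul.
pose V : {linear L1 mu -> L1 mu} := HB.pack U L.
exists V; split=> // u; rewrite -[X in V X](cls_reprK u).
by rewrite [V _]Ucls ?nrm_cls ?nrmL1; [apply: Tn|apply: Ti|]; exact: L1repr_cinteg.
Qed.

Definition left_shift t F x := F (t^-1 * x)%g.
(** The modular function makes right translation isometric. *)
Definition right_shift t F x := (D t)%:C * F (x * t^-1)%g.

Lemma left_shiftK t F : left_shift t (left_shift t^-1%g F) = F.
Proof. by apply/funext => x; rewrite /left_shift invgK mulVKg. Qed.

Lemma right_shiftK t F : right_shift t (right_shift t^-1%g F) = F.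
Proof.
apply/funext => x; rewrite /right_shift invgK mulgVK mulrA -rmorphM /=.
by rewrite (modularV DD) mul1r.
Qed.

Lemma left_shift_cinteg t F : cinteg F -> cinteg (left_shift t F).
Proof. by move=> [F1 F2]; split; [exact: (integ_mulgl Hmu _ F1)|exact: (integ_mulgl Hmu _ F2)]. Qed.

Lemma right_shift_cinteg t F : cinteg F -> cinteg (right_shift t F).
Proof.
move=> [F1 F2]; apply: cintegZ.
by split; [exact: (integ_mulgr Gh Gl Hmu DD _ F1)|exact: (integ_mulgr Gh Gl Hmu DD _ F2)].
Qed.

Lemma cabs_scale (r : R) z : 0 <= r -> cabs (r%:C * z) = r * cabs z.
Proof. by move=> r0; rewrite cabsM cabsR ger0_norm. Qed.

Lemma left_shift_operator t : exists U : {linear L1 mu -> L1 mu}, contractive U /\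
    forall F, cinteg F -> U (cls F) = cls (left_shift t F).
Proof.
apply: L1_operator => [F|//|F h [N [mN N0 FN]]|F Fi]; first exact: left_shift_cinteg.
  exists [set x : borel G | N (t^-1 * x)%g]; split.
  - by rewrite -[X in measurable X]setTI; apply: (measurable_mulgl t^-1%g (@measurable_id _ _ setT) measurableT).
  - by rewrite -[RHS]N0 -(pushforward_mulgl Hmu t^-1%g mN).
  - by move=> x nx; apply: FN.
rewrite le_eqVlt; apply/orP; left; apply/eqP.
exact: (J_mulgl Hmu t^-1%g (integ_measurable (integ_cabs Fi))).
Qed.

Lemma right_shift_operator t : exists U : {linear L1 mu -> L1 mu}, contractive U /\
    forall F, cinteg F -> U (cls F) = cls (right_shift t F).
Proof.
apply: L1_operator => [F|a F h|F h [N [mN N0 FN]]|F Fi]; first exact: right_shift_cinteg.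
- by apply/funext => x; rewrite /right_shift; ring.
- exists (rpre t^-1%g N : set (borel G)); split; first exact: rpre_measurable.
    by rewrite (measure_rpre Gh Gl Hmu DD)// N0 mule0.
  by move=> x nx; apply: FN => Fh; apply: nx; rewrite /= /right_shift Fh.
rewrite le_eqVlt; apply/orP; left; apply/eqP.
under eq_fun do rewrite /right_shift cabs_scale ?(ltW (modular_gt0 DD _))//.
have Ai := integ_cabs Fi; rewrite JZ; last exact: (integ_mulgr Gh Gl Hmu DD _ Ai).
by rewrite (J_mulgr Gh Gl Hmu DD _ Ai) mulrA (modularV DD) mul1r.
Qed.

Lemma cint_mulgr x F : cinteg F -> cint (fun y => F (y * x)%g) = (D x)%:C * cint F.
Proof.
move=> [F1 F2]; apply/eqP; rewrite eq_complex complex_ReM complex_ImM /= !mul0r subr0 addr0.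
by rewrite (J_mulgr Gh Gl Hmu DD _ F1) (J_mulgr Gh Gl Hmu DD _ F2) !eqxx.
Qed.

(** The substitution y |-> y t^-1 in the convolution integral; the two factors D(t)
    and D(t^-1) cancel. *)
Lemma conv_shift t f g x : cinteg f -> cinteg g -> convolvable mu f (left_shift t g) x ->
  conv (right_shift t f) g x = conv f (left_shift t g) x.
Proof.
move=> fi gi cx; have ki := cinteg_conv_kernel fi (left_shift_cinteg t gi) cx.
have [k1 k2] := ki.
rewrite /convolution -[RHS]mul1r -[1](rmorph1 (@real_complex R)) -(modularV DD t) rmorphM /= -mulrA.
rewrite -(cint_mulgr t^-1%g ki) -cintZ; last first.
  by split; [exact: (integ_mulgr Gh Gl Hmu DD _ k1)|exact: (integ_mulgr Gh Gl Hmu DD _ k2)].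
congr cint; apply/funext => y; rewrite /right_shift /left_shift invgM invgK mulrA.
by rewrite -!mulgA mulKg.
Qed.

Lemma L1conv_shift t f g : cinteg f -> cinteg g ->
  L1conv (cls (right_shift t f)) (cls g) = L1conv (cls f) (cls (left_shift t g)).
Proof.
move=> fi gi; have rfi := right_shift_cinteg t fi; have lgi := left_shift_cinteg t gi.
rewrite (L1conv_cls Gh Gl Hmu DD rfi gi) (L1conv_cls Gh Gl Hmu DD fi lgi).
apply: cls_eq; [exact: (conv_cinteg Gh Gl Hmu DD)|exact: (conv_cinteg Gh Gl Hmu DD)|].
by apply: filterS (ae_convolvable Gh Gl Hmu DD fi lgi) => x; exact: conv_shift.
Qed.

Lemma shift_unimult (B : {bilinear L1 mu -> L1 mu -> L1 mu}) t : B = @L1conv R G mu :> (_ -> _ -> _) ->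
  exists U : unimult B, forall F, cinteg F ->
    umR U (cls F) = cls (right_shift t F) /\ umL U (cls F) = cls (left_shift t F).
Proof.
move=> BE.
have [r [r1 rE]] := right_shift_operator t; have [ri [ri1 riE]] := right_shift_operator t^-1%g.
have [l [l1 lE]] := left_shift_operator t; have [li [li1 liE]] := left_shift_operator t^-1%g.
have rK : cancel r ri.
  move=> u; rewrite -(cls_reprK u) rE ?riE; [|exact/right_shift_cinteg/L1repr_cinteg|exact: L1repr_cinteg].
  by rewrite -{2}[t]invgK right_shiftK.
have riK : cancel ri r.
  move=> u; rewrite -(cls_reprK u) riE ?rE; [|exact/right_shift_cinteg/L1repr_cinteg|exact: L1repr_cinteg].
  by rewrite right_shiftK.
have lK : cancel l li.
  move=> u; rewrite -(cls_reprK u) lE ?liE; [|exact/left_shift_cinteg/L1repr_cinteg|exact: L1repr_cinteg].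
  by rewrite -{2}[t]invgK left_shiftK.
have liK : cancel li l.
  move=> u; rewrite -(cls_reprK u) liE ?lE; [|exact/left_shift_cinteg/L1repr_cinteg|exact: L1repr_cinteg].
  by rewrite left_shiftK.
have M a c : B (r a) c = B a (l c).
  rewrite BE -(cls_reprK a) -(cls_reprK c) rE ?lE; try exact: L1repr_cinteg.
  by apply: L1conv_shift; exact: L1repr_cinteg.
exists (Unimult rK riK lK liK r1 ri1 l1 li1 M) => F Fi /=.
by rewrite rE// lE.
Qed.

End translations.

(** * Convolutions as averages of translations *)

Section averages.
Context {R : realType} {G : topologicalGroupType} (mu : {measure set (borel G) -> \bar R}).
Hypotheses (Gh : hausdorff_space G) (Gl : locally_compact [set: G])
  (Hmu : is_left_haar_measure mu).
Implicit Types (a b c : G -> R) (K L : set G).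
Local Notation J := (realint mu).
Local Notation integ := (integ mu).
Local Notation mass := (mass mu).
Context (D : G -> R) (DD : is_modular mu D).

(** The substitution y |-> x y followed by the inversion, whose density is D. *)
Lemma conv_right_average a b x : Cc a -> Cc b ->
  J (fun y => a y * b (y^-1 * x)%g) = J (fun t => b t * (D t * a (x * t^-1)%g)).
Proof.
move=> ac bc.
have axc : Cc (fun y => a (x * y^-1)%g) by apply: (@Cc_invg _ _ (fun y => a (x * y)%g)); exact: Cc_mulgl.
pose f y := a (x * y^-1)%g * b y.
have fc : Cc f by apply: CcM => //; exact: bc.1.
transitivity (J (fun y => f y * D y)); last first.
  by congr J; apply/funext => t; rewrite /f; ring.
rewrite (modular_inv DD fc) -(@J_mulgl_Cc _ _ mu Hmu x); last first.
  by apply: CcM => //; case: (@Cc_invg _ _ (fun y => b (y * x)%g) (Cc_mulgr x bc)).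
by congr J; apply/funext => y; rewrite /f invgK invgM mulgVK.
Qed.

Lemma integ_mul_ind g (E : set (borel G)) : measurable E -> integ g ->
  integ (fun t => g t * ind E t).
Proof.
move=> mE gi; apply: (le_integ _ (integ_abs gi)).
  by apply: measurable_funM; [exact: integ_measurable gi|exact: measurable_indic].
by move=> t; rewrite normrM ler_piMr// ger0_norm ?ind_ge0 ?ind_le1.
Qed.

(** Replaces the parameter t of F by one point in each piece of a partition of the
    support of b. *)
Lemma step_average (F : G -> G -> R) b K L (s : seq (G * set (borel G))) e :
  continuous (fun p : G * G => F p.1 p.2) -> Cc b -> 0 <= e -> 
  (forall x, ~ K x -> b x = 0) ->
  (forall p, p \in s -> measurable p.2) ->
  (forall t, \sum_(p <- s) ind p.2 t = ind K t :> R) ->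
  (forall p t, p \in s -> p.2 t -> forall x, `|F t x - F p.1 x| <= e * ind L x) ->
  forall x, `|J (fun t => b t * F t x) -
    \sum_(p <- s) J (fun t => b t * ind p.2 t) * F p.1 x| <= e * J (fun t => `|b t|) * ind L x.
Proof.
move=> Fc bc e0 bK ms sK sF x.
have bi := Cc_integ Gh Hmu bc; have bai := integ_abs bi.
have Fx : continuous (fun t => F t x).
  move=> t; apply: (@continuous_comp _ _ _ (fun t => (t, x)) (fun p : G * G => F p.1 p.2)); last exact: Fc.
  by apply: cvg_pair; [exact: cvg_id|exact: cvg_cst].
have bFc : Cc (fun t => b t * F t x) by exact: CcM.
have bFi := Cc_integ Gh Hmu bFc.
have indi g p (ps : p \in s) (gi : integ g) := integ_mul_ind (ms p ps) gi.
have di p : p \in s -> integ (fun t => (b t * ind p.2 t) * (F t x - F p.1 x)).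
  move=> ps; rewrite (_ : (fun t => _) = fun t => (b t * F t x) * ind p.2 t - F p.1 x * (b t * ind p.2 t)).
    by apply: integB; [exact: indi|apply: integZ; exact: indi].
  by apply/funext => t; ring.
have -> : J (fun t => b t * F t x) = \sum_(p <- s) J (fun t => (b t * F t x) * ind p.2 t).
  rewrite -J_sum; last by move=> p ps; exact: indi.
  congr J; apply/funext => t; rewrite -mulr_sumr sK.
  have [Kt|nK] := pselect (K t); first by rewrite (ind_in Kt) mulr1.
  by rewrite bK// !mul0r.
rewrite -sumrB (_ : \sum_(p <- s) _ = \sum_(p <- s) J (fun t => (b t * ind p.2 t) * (F t x - F p.1 x))); last first.
  rewrite !big_seq; apply: eq_bigr => p ps; rewrite [_ * F _ _]mulrC -JZ ?indi// -JB ?indi//.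
    by congr J; apply/funext => t; ring.
  by apply: integZ; exact: indi.
rewrite -J_sum//; have si := integ_sum di.
apply: le_trans (J_abs si) _; rewrite -mulrA [X in _ <= _ * X]mulrC mulrA -JZ//.
apply: J_le; [exact: integ_abs|exact: integZ|] => t.
apply: le_trans (ler_norm_sum _ _ _) _.
apply: le_trans (_ : \sum_(p <- s) (e * ind L x * `|b t|) * ind p.2 t <= _); last first.
  by rewrite -mulr_sumr sK ler_piMr ?ind_le1// !mulr_ge0 ?ind_ge0.
rewrite !big_seq; apply: ler_sum => p ps.
have [pt|npt] := pselect (p.2 t); last by rewrite (ind_out npt) !mulr0 mul0r normr0.
by rewrite (ind_in pt) !mulr1 normrM mulrC ler_wpM2r//; exact: sF.
Qed.

Lemma sum_abs_coefficients b K (s : seq (G * set (borel G))) : Cc b ->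
  (forall p, p \in s -> measurable p.2) ->
  (forall t, \sum_(p <- s) ind p.2 t = ind K t :> R) ->
  \sum_(p <- s) `|J (fun t => b t * ind p.2 t)| <= J (fun t => `|b t|).
Proof.
move=> bc ms sK; have bi := Cc_integ Gh Hmu bc; have bai := integ_abs bi.
have indi g p (ps : p \in s) (gi : integ g) := integ_mul_ind (ms p ps) gi.
apply: le_trans (_ : \sum_(p <- s) J (fun t => `|b t| * ind p.2 t) <= _).
  rewrite !big_seq; apply: ler_sum => p ps; apply: le_trans (J_abs (indi _ _ ps bi)) _.
  apply: J_le; [exact/integ_abs/indi|exact: indi|].
  by move=> t; rewrite normrM (ger0_norm (ind_ge0 _ _)).
rewrite -J_sum; last by move=> p ps; exact: indi.
apply: J_le => //; first by apply: integ_sum => p ps; exact: indi.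
by move=> t; rewrite -mulr_sumr sK ler_piMr ?ind_le1.
Qed.

(** The same points and coefficients serve for a * b and b * c: a partition fine
    enough for both kernels is chosen at once. *)
Lemma simultaneous_averages a b c e : Cc a -> Cc b -> Cc c -> 0 < e ->
  exists s : seq (R * G), [/\ \sum_(p <- s) `|p.1| <= J (fun t => `|b t|),
    J (fun x => `|J (fun t => b t * (D t * a (x * t^-1)%g)) -
       \sum_(p <- s) p.1 * (D p.2 * a (x * p.2^-1)%g)|) <= e &
    J (fun x => `|J (fun t => b t * c (t^-1 * x)%g) -
       \sum_(p <- s) p.1 * c (p.2^-1 * x)%g|) <= e].
Proof.
move=> ac bc cc e0; have [cb [K cK bK]] := bc; have [ca [A cA aA]] := ac; have [cc' [C cC cC0]] := cc.
have [W [oW KW cW]] := precompact_open_superset Gh Gl cK.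
pose F1 t x := D t * a (x * t^-1)%g.
pose F2 t x := c (t^-1 * x)%g.
have F1c : continuous (fun p : G * G => F1 p.1 p.2).
  move=> p; apply: (@continuousM _ _ (fun p : G * G => D p.1) (fun p : G * G => a (p.2 * p.1^-1)%g)).
    by apply: (@continuous_comp _ _ _ fst D); [exact: cvg_fst|exact: (modular_continuous DD)].
  apply: (@continuous_comp _ _ _ (fun p : G * G => (p.2 * p.1^-1)%g) a); last exact: ca.
  apply: continuous_mulg; first exact: continuous_snd2.
  by apply: continuous_invg; exact: continuous_fst2.
have F2c : continuous (fun p : G * G => F2 p.1 p.2).
  move=> p; apply: (@continuous_comp _ _ _ (fun p : G * G => (p.1^-1 * p.2)%g) c); last exact: cc'.
  apply: continuous_mulg; last exact: continuous_snd2.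
  by apply: continuous_invg; exact: continuous_fst2.
pose L1 := [set (p.1 * p.2)%g | p in A `*` closure W].
pose L2 := [set (p.1 * p.2)%g | p in closure W `*` C].
have cL1 : compact L1 by exact: compact_mulg.
have cL2 : compact L2 by exact: compact_mulg.
have F10 t x : W t -> ~ L1 x -> F1 t x = 0.
  move=> Wt nx; rewrite /F1 aA ?mulr0// => Ax; apply: nx.
  by exists (x * t^-1, t)%g; [split=> //; exact: subset_closure|rewrite /= mulgVK].
have F20 t x : W t -> ~ L2 x -> F2 t x = 0.
  move=> Wt nx; rewrite /F2 cC0// => Cx; apply: nx.
  by exists (t, t^-1 * x)%g; [split=> //; exact: subset_closure|rewrite /= mulVKg].
pose m := (J (fun t => `|b t|) + 1) * (mass L1 + mass L2 + 1).
have Jb0 : 0 <= J (fun t => `|b t|) by exact: J_ge0.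
have m1 := mass_ge0 mu L1; have m2 := mass_ge0 mu L2.
have m0 : 0 < m by rewrite mulr_gt0//; lra.
pose d := e / m; have d0 : 0 < d by rewrite divr_gt0.
have dm q : 0 <= q -> q <= mass L1 + mass L2 -> d * J (fun t => `|b t|) * q <= e.
  move=> q0 qm; rewrite /d -mulrA mulrAC ler_pdivrMr// ler_pM2l//.
  by rewrite /m; apply: ler_pM => //; lra.
(* Vacuous near a point t0 outside W, so that the supports of F1 t and F2 t
   only have to be controlled for t in W. *)
pose P t0 t := K t -> (forall x, `|F1 t x - F1 t0 x| <= d * ind L1 x) /\
                      (forall x, `|F2 t x - F2 t0 x| <= d * ind L2 x).
have nearP t0 : \forall t \near t0, P t0 t.
  have [Wt0|nW] := pselect (W t0).
    have nW : \forall t \near t0, W t by apply: open_nbhs_nbhs; split.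
    have N1 : \forall t \near t0, forall x, ~ L1 x -> F1 t x = 0.
      by apply: filterS nW => t Wt x; exact: F10.
    have N2 : \forall t \near t0, forall x, ~ L2 x -> F2 t x = 0.
      by apply: filterS nW => t Wt x; exact: F20.
    apply: filterS2 (near_supported_uniform F1c cL1 N1 d0) (near_supported_uniform F2c cL2 N2 d0).
    by move=> t h1 h2 _.
  have nK : ~ K t0 by move=> /KW.
  have : \forall t \near t0, ~ K t.
    by apply: open_nbhs_nbhs; split=> //; apply: closed_openC; exact: compact_closed.
  by apply: filterS => t nKt /nKt.
have [s [ms sP sK]] := @finite_borel_partition R _ Gh _ _ cK nearP.
have sK' p t : p \in s -> p.2 t -> K t.
  move=> ps pt; apply: contrapT => nK; have := ind_le_seq t sK ps.
  by rewrite (ind_in pt) (ind_out nK) ler10.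
have ave F L : continuous (fun p : G * G => F p.1 p.2) -> (forall t, Cc (F t)) ->
    (forall t x, W t -> ~ L x -> F t x = 0) -> compact L -> mass L <= mass L1 + mass L2 ->
    (forall p t, p \in s -> p.2 t -> forall x, `|F t x - F p.1 x| <= d * ind L x) ->
    J (fun x => `|J (fun t => b t * F t x) -
       \sum_(p <- [seq (J (fun t => b t * ind p.2 t), p.1) | p <- s]) p.1 * F p.2 x|) <= e.
  move=> Fc cF F0 cL mL sF; under eq_fun do rewrite big_map /=.
  have X : Cc2 (fun x t => b t * F t x).
    split.
      move=> p; apply: (@continuousM _ _ (fun p : G * G => b p.2) (fun p : G * G => F p.2 p.1)).
        by apply: (@continuous_comp _ _ _ snd b); [exact: cvg_snd|exact: cb].
      apply: (@continuous_comp _ _ _ (fun p : G * G => (p.2, p.1)) (fun p : G * G => F p.1 p.2)); last exact: Fc.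
      by apply: cvg_pair; [exact: cvg_snd|exact: cvg_fst].
    exists L, K; split=> // x t nLK; have [Kt|/bK ->] := pselect (K t); last by rewrite mul0r.
    by rewrite F0 ?mulr0//; [exact: KW|move=> Lx; exact: nLK].
  apply: le_trans (dm _ (mass_ge0 _ _) mL); rewrite -(J_ind mu Gh cL) -JZ; last exact: compact_integ_ind.
  apply: J_le; last exact: (step_average Fc bc (ltW d0) bK ms sK sF).
    apply: integ_abs; apply: integB; first by apply: Cc_integ => //; exact: Cc2_integral.
    by apply: integ_sum => p ps; apply: integZ; exact: Cc_integ.
  by apply: integZ; exact: compact_integ_ind.
exists [seq (J (fun t => b t * ind p.2 t), p.1) | p <- s]; split.
- by rewrite big_map /=; exact: sum_abs_coefficients bc ms sK.
- apply: (ave F1 L1) => //; last 2 first.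
  + by rewrite lerDl.
  + by move=> p t ps pt; exact: (sP p t ps pt (sK' _ _ ps pt)).1.
  by move=> t; rewrite /F1; apply: CcZ; exact: (Cc_mulgr t^-1%g ac).
- apply: (ave F2 L2) => //; last 2 first.
  + by rewrite lerDr.
  + by move=> p t ps pt; exact: (sP p t ps pt (sK' _ _ ps pt)).2.
  by move=> t; exact: (Cc_mulgl t^-1%g cc).
Qed.
End averages.

(** * The group algebra and the conclusion *)

Section group_algebra_estimate.
Context {R : realType} {G : topologicalGroupType} (mu : {measure set (borel G) -> \bar R}).
Hypotheses (Gh : hausdorff_space G) (Gl : locally_compact [set: G])
  (Hmu : is_left_haar_measure mu).
Implicit Types (a b c : G -> R) (K L : set G).
Local Notation J := (realint mu).
Local Notation integ := (integ mu).
Local Notation cinteg := (cinteg mu).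
Context (D : G -> R) (DD : is_modular mu D).
Local Notation cls f := (L1class mu (f : borel G -> R[i])).

Definition rcls a : L1 mu := cls (fun x : G => (a x)%:C).

Lemma cinteg_real a : integ a -> cinteg (fun x => (a x)%:C).
Proof. by move=> ai; split=> //; exact: integ0. Qed.

Lemma nrm_rcls a : integ a -> nrm (rcls a) = J (fun x => `|a x|).
Proof.
move=> ai; rewrite nrm_cls; last exact: cinteg_real.
by congr J; apply/funext => x; rewrite cabsR.
Qed.

Lemma rclsD a b : integ a -> integ b -> rcls (fun x => a x + b x) = rcls a + rcls b.
Proof.
move=> ai bi; rewrite -clsD; [|exact: cinteg_real|exact: cinteg_real].
by congr (L1class mu _); apply/funext => x; rewrite rmorphD.
Qed.

Lemma rclsZ k a : integ a -> rcls (fun x => k * a x) = k%:C *: rcls a.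
Proof.
move=> ai; rewrite -clsZ; last exact: cinteg_real.
by congr (L1class mu _); apply/funext => x; rewrite rmorphM.
Qed.

Lemma rclsB a b : integ a -> integ b -> rcls (fun x => a x - b x) = rcls a - rcls b.
Proof.
move=> ai bi; apply/eqP; rewrite -subr_eq0 opprB addrA subr_eq0 -rclsD//; last exact: integB.
by apply/eqP; congr rcls; apply/funext => x; rewrite subrK.
Qed.

Lemma rcls_sum (I : eqType) (s : seq I) (k : I -> R) (F : I -> G -> R) :
  (forall i, i \in s -> integ (F i)) ->
  rcls (fun x => \sum_(i <- s) k i * F i x) = \sum_(i <- s) (k i)%:C *: rcls (F i).
Proof.
elim: s => [|i s IH] Fi.
  rewrite big_nil (_ : (fun x => _) = fun x => 0 * 0).
    by rewrite (@rclsZ 0 (fun=> 0) (integ0 mu)) scale0r.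
  by apply/funext => x; rewrite big_nil mul0r.
have Fs j : j \in s -> integ (F j) by move=> js; apply: Fi; rewrite inE js orbT.
have Fii : integ (F i) by apply: Fi; rewrite mem_head.
rewrite big_cons -IH// -rclsZ// -rclsD; first last.
- by apply: integ_sum => j js; apply: integZ; exact: Fs.
- exact: integZ.
by congr rcls; apply/funext => x; rewrite big_cons.
Qed.

Lemma L1conv_rcls a b : Cc a -> Cc b ->
  L1conv (rcls a) (rcls b) = rcls (fun x => J (fun y => a y * b (y^-1 * x)%g)).
Proof.
move=> ac bc; have ai := Cc_integ Gh Hmu ac; have bi := Cc_integ Gh Hmu bc.
rewrite /rcls (L1conv_cls Gh Gl Hmu DD (cinteg_real ai) (cinteg_real bi)).
congr (L1class mu _); apply/funext => x; apply/eqP; rewrite /convolution /cintegral eq_complex /=.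
under eq_Rintegral do rewrite mulr0 subr0.
under [X in _ && (X == _)]eq_Rintegral do rewrite mulr0 mul0r addr0.
by rewrite /realint eqxx -/(realint _ (fun=> 0)) J0 eqxx.
Qed.

(** Density of compactly supported functions in the real L^1, and u = Re u + i Im u
    with both parts of norm at most that of u; hence the factor 2. *)
Lemma extend_from_Cc (X : normedModType R[i]) (f : L1 mu -> X) (C k : R) :
  linear f -> (forall u, nrm (f u) <= C * nrm u) -> 0 <= C -> 0 <= k ->
  (forall a, Cc a -> nrm (f (rcls a)) <= k * nrm (rcls a)) ->
  forall u, nrm (f u) <= 2 * k * nrm u.
Proof.
move=> fl fC C0 k0 fk.
have fD u v : f (u + v) = f u + f v by have := fl 1 u v; rewrite !scale1r.
have f0 : f 0 = 0.
  by apply/eqP; have /eqP := fD 0 0; rewrite addr0 -{1}[f 0]addr0 (inj_eq (addrI _)) eq_sym.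
have fZ z u : f (z *: u) = z *: f u by have := fl z u 0; rewrite !addr0 f0 addr0.
have fr a : integ a -> nrm (f (rcls a)) <= k * nrm (rcls a).
  move=> ai; apply/ler_addgt0Pr => e e0.
  have m0 : 0 < C + k + 1 by lra.
  have [g gc Jg] := (Cc_dense Gh Gl Hmu ai).2 _ (divr_gt0 e0 m0).
  have gi := Cc_integ Gh Hmu gc.
  have d1 : nrm (rcls a - rcls g) <= e / (C + k + 1).
    by rewrite -rclsB// nrm_rcls//; exact: integB.
  have -> : rcls a = rcls g + (rcls a - rcls g) by rewrite addrC subrK.
  rewrite fD; apply: le_trans (nrmD _ _) _.
  have -> : rcls g + (rcls a - rcls g) = rcls a by rewrite addrC subrK.
  apply: le_trans (lerD (fk g gc) (fC _)) _.
  have gn : nrm (rcls g) <= nrm (rcls a) + e / (C + k + 1).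
    rewrite (_ : rcls g = rcls a - (rcls a - rcls g)); last by rewrite opprB addrC subrK.
    by apply: le_trans (nrmB _ _) _; rewrite lerD2l.
  apply: le_trans (lerD (ler_wpM2l k0 gn) (ler_wpM2l C0 d1)) _.
  rewrite mulrDr -addrA lerD2l -mulrDl mulrCA ger_pMr// ler_pdivrMr// mul1r.
  by lra.
move=> u; rewrite -(cls_reprK u); have [F1 F2] := L1repr_cinteg u.
set F := L1repr u in F1 F2 *.
have dec : cls F = rcls (fun x => complex.Re (F x)) + 'i%C *: rcls (fun x => complex.Im (F x)).
  rewrite -clsZ; last exact: cinteg_real.
  rewrite -clsD; [|exact: cinteg_real|by apply: cintegZ; exact: cinteg_real].
  by congr (L1class mu _); apply/funext => x; exact: complexE.
rewrite [X in f X]dec fD fZ; apply: le_trans (nrmD _ _) _; rewrite nrmZ cabsi mul1r.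
apply: le_trans (lerD (fr _ F1) (fr _ F2)) _.
have n1 : nrm (rcls (fun x => complex.Re (F x))) <= nrm (cls F).
  rewrite nrm_rcls// nrm_cls//; apply: J_le; [exact: integ_abs|exact: integ_cabs|] => x.
  exact: Re_le_cabs.
have n2 : nrm (rcls (fun x => complex.Im (F x))) <= nrm (cls F).
  rewrite nrm_rcls// nrm_cls//; apply: J_le; [exact: integ_abs|exact: integ_cabs|] => x.
  exact: Im_le_cabs.
rewrite -mulrDr [leRHS](_ : _ = k * (2 * nrm (cls F))); last by ring.
by apply: ler_wpM2l => //; lra.
Qed.

Section form.
Context (B : {bilinear L1 mu -> L1 mu -> L1 mu}) (BE : B = @L1conv R G mu :> (_ -> _ -> _)).
Context (X : normedModType R[i]) (phi : {bilinear L1 mu -> L1 mu -> X}) (M al : R).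
Hypotheses (phi_le : forall u v, nrm (phi u v) <= M * nrm u * nrm v) (M0 : 0 <= M) (al0 : 0 <= al)
  (phi_al : forall u v, B u v = 0 -> nrm (phi u v) <= al * nrm u * nrm v).

Lemma B_le u v : nrm (B u v) <= nrm u * nrm v.
Proof. by rewrite BE; exact: (L1conv_norm Gh Gl Hmu DD). Qed.

Lemma averages_L1 a b c e : Cc a -> Cc b -> Cc c -> 0 < e ->
  exists s : seq (R * unimult B), [/\ \sum_(p <- s) `|p.1| <= nrm (rcls b),
    nrm (B (rcls a) (rcls b) - \sum_(p <- s) p.1%:C *: umR p.2 (rcls a)) <= e &
    nrm (B (rcls b) (rcls c) - \sum_(p <- s) p.1%:C *: umL p.2 (rcls c)) <= e].
Proof.
move=> ac bc cc e0.
have ai := Cc_integ Gh Hmu ac; have bi := Cc_integ Gh Hmu bc; have ci := Cc_integ Gh Hmu cc.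
have [U HU] := choice (fun t => shift_unimult Gh Gl Hmu DD t BE).
have [s [s1 s2 s3]] := simultaneous_averages Gh Gl Hmu DD ac bc cc e0.
exists [seq (p.1, U p.2) | p <- s]; rewrite !big_map /=; split.
- by rewrite nrm_rcls.
- have Ri p : p \in s -> integ (fun x => D p.2 * a (x * p.2^-1)%g).
    by move=> _; apply: Cc_integ => //; apply: CcZ; exact: (Cc_mulgr p.2^-1%g ac).
  have E : \sum_(p <- s) p.1%:C *: umR (U p.2) (rcls a) =
      rcls (fun x => \sum_(p <- s) p.1 * (D p.2 * a (x * p.2^-1)%g)).
    rewrite rcls_sum//; apply: eq_bigr => p _; congr (_ *: _).
    rewrite (HU p.2 _ (cinteg_real ai)).1; congr (L1class mu _).
    by apply/funext => x; rewrite /right_shift rmorphM.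
  have Si : integ (fun x => \sum_(p <- s) p.1 * (D p.2 * a (x * p.2^-1)%g)).
    by apply: integ_sum => p ps; apply: integZ; exact: Ri.
  have abi : integ (fun x => J (fun y => a y * b (y^-1 * x)%g)).
    exact: Cc_integ Gh Hmu _ (Cc2_integral Gh Hmu (Cc2_conv ac bc)).
  rewrite E BE L1conv_rcls// -rclsB// nrm_rcls; last exact: integB.
  apply: le_trans s2; rewrite le_eqVlt; apply/orP; left; apply/eqP.
  by congr J; apply/funext => x; rewrite (conv_right_average Hmu DD).
- have Ri p : p \in s -> integ (fun x => c (p.2^-1 * x)%g).
    by move=> _; apply: Cc_integ => //; exact: (Cc_mulgl p.2^-1%g cc).
  have E : \sum_(p <- s) p.1%:C *: umL (U p.2) (rcls c) =
      rcls (fun x => \sum_(p <- s) p.1 * c (p.2^-1 * x)%g).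
    rewrite rcls_sum//; apply: eq_bigr => p _; congr (_ *: _).
    by rewrite (HU p.2 _ (cinteg_real ci)).2.
  have Si : integ (fun x => \sum_(p <- s) p.1 * c (p.2^-1 * x)%g).
    by apply: integ_sum => p ps; apply: integZ; exact: Ri.
  have bci : integ (fun x => J (fun y => b y * c (y^-1 * x)%g)).
    exact: Cc_integ Gh Hmu _ (Cc2_integral Gh Hmu (Cc2_conv bc cc)).
  by rewrite E BE L1conv_rcls// -rclsB// nrm_rcls//; exact: integB.
Qed.

Definition defect u v w := phi (B u v) w - phi u (B v w).

(** Approximating a * b and b * c by the same averages turns the defect into an
    average of terms phi(R_t a, c) - phi(a, L_t c), with total weight at most |b|. *)
Lemma defect_real a b c : Cc a -> Cc b -> Cc c ->
  nrm (defect (rcls a) (rcls b) (rcls c)) <=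
  144 * al * (nrm (rcls a) * nrm (rcls b) * nrm (rcls c)).
Proof.
move=> ac bc cc; set u := rcls a; set v := rcls b; set w := rcls c.
apply/ler_addgt0Pr => e e0.
have m0 : 0 < M * (nrm u + nrm w) + 1 by rewrite ltr_wpDl// mulr_ge0// addr_ge0 ?nrm_ge0.
have [s [s1 s2 s3]] := averages_L1 ac bc cc (divr_gt0 e0 m0).
move: s1 s2 s3; rewrite -/u -/v -/w; set d := e / _.
set R' := \sum_(p <- s) p.1%:C *: umR p.2 u; set L' := \sum_(p <- s) p.1%:C *: umL p.2 w.
move=> s1 s2 s3.
have -> : defect u v w = (\sum_(p <- s) p.1%:C *: (phi (umR p.2 u) w - phi u (umL p.2 w))) +
    (phi (B u v - R') w - phi u (B v w - L')).
  rewrite linearBl linearBr /= /R' /L' linear_sumlz linear_sumr /defect.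
  under eq_bigr do rewrite scalerBr.
  rewrite sumrB.
  under [in RHS]eq_bigr do rewrite -linearZl_LR.
  under [X in _ = (_ - X) + _]eq_bigr do rewrite -linearZr_LR.
  by zmod_identity.
apply: le_trans (nrmD _ _) _; apply: lerD.
  apply: le_trans (nrm_sum _ _ _) _.
  apply: le_trans (_ : \sum_(p <- s) `|p.1| * (144 * al * (nrm u * nrm w)) <= _).
    apply: ler_sum => p _; rewrite nrmZ cabsR ler_wpM2l//.
    exact: (multiplier_estimate B_le (@L1_series_complete R G mu) phi_le M0 al0 phi_al).
  rewrite -mulr_suml [leRHS](_ : _ = nrm v * (144 * al * (nrm u * nrm w))); last by ring.
  by rewrite ler_wpM2r// !mulr_ge0 ?nrm_ge0.
apply: le_trans (nrmB _ _) _; apply: le_trans (lerD (phi_le _ _) (phi_le _ _)) _.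
have n1 : nrm (B u v - R') * nrm w <= d * nrm w by rewrite ler_wpM2r ?nrm_ge0.
have n2 : nrm u * nrm (B v w - L') <= nrm u * d by rewrite ler_wpM2l ?nrm_ge0.
rewrite -!mulrA -mulrDr; apply: le_trans (ler_wpM2l M0 (lerD n1 n2)) _.
rewrite [leLHS](_ : _ = d * (M * (nrm u + nrm w))); last by ring.
by rewrite /d mulrAC ler_pdivrMr// ler_pM2l// lerDl.
Qed.

Lemma defect_le u v w : nrm (defect u v w) <= 2 * M * (nrm u * nrm v * nrm w).
Proof.
apply: le_trans (nrmB _ _) _; apply: le_trans (lerD (phi_le _ _) (phi_le _ _)) _.
have n1 : nrm (B u v) * nrm w <= nrm u * nrm v * nrm w by rewrite ler_wpM2r ?nrm_ge0 ?B_le.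
have n2 : nrm u * nrm (B v w) <= nrm u * (nrm v * nrm w) by rewrite ler_wpM2l ?nrm_ge0 ?B_le.
rewrite -!mulrA -mulrDr; apply: le_trans (ler_wpM2l M0 (lerD n1 n2)) _.
by rewrite le_eqVlt; apply/orP; left; apply/eqP; ring.
Qed.

(** Extends [defect_real] in the three arguments successively; 1152 = 2 * 2 * 2 * 144. *)
Lemma defect_estimate u v w :
  nrm (defect u v w) <= 1152 * al * (nrm u * nrm v * nrm w).
Proof.
have eq_le (p q : R) : p = q -> p <= q by move=> ->.
have ext (f : L1 mu -> X) (n1 n2 k : R) : 0 <= n1 -> 0 <= n2 -> 0 <= k -> linear f ->
    (forall x, nrm (f x) <= 2 * M * (n1 * n2) * nrm x) ->
    (forall a, Cc a -> nrm (f (rcls a)) <= k * nrm (rcls a)) ->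
    forall x, nrm (f x) <= 2 * k * nrm x.
  by move=> n10 n20 k0 fl fM fk; apply: (extend_from_Cc fl fM _ k0 fk); rewrite !mulr_ge0.
have step1 b c x : Cc b -> Cc c ->
    nrm (defect x (rcls b) (rcls c)) <= 2 * (144 * al * (nrm (rcls b) * nrm (rcls c))) * nrm x.
  move=> bc cc; apply: (ext (fun x => defect x (rcls b) (rcls c)) (nrm (rcls b)) (nrm (rcls c)));
    rewrite ?mulr_ge0 ?nrm_ge0//.
  - by move=> z y y'; rewrite /defect !linearPl /= scalerBr; zmod_identity.
  - by move=> y; apply: le_trans (defect_le _ _ _) _; apply: eq_le; ring.
  - by move=> a ac; apply: le_trans (defect_real ac bc cc) _; apply: eq_le; ring.
have step2 c x y : Cc c ->
    nrm (defect x y (rcls c)) <= 2 * (2 * (144 * al * (nrm x * nrm (rcls c)))) * nrm y.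
  move=> cc; apply: (ext (fun y => defect x y (rcls c)) (nrm x) (nrm (rcls c)));
    rewrite ?mulr_ge0 ?nrm_ge0//.
  - by move=> z v' v''; rewrite /defect linearPr linearPl [B (_ + _) _]linearPl linearPr scalerBr; zmod_identity.
  - by move=> y'; apply: le_trans (defect_le _ _ _) _; apply: eq_le; ring.
  - by move=> b bc; apply: le_trans (step1 b c x bc cc) _; apply: eq_le; ring.
rewrite (_ : 1152 * al * _ = 2 * (2 * (2 * (144 * al * (nrm u * nrm v)))) * nrm w); last by ring.
apply: (ext (fun w => defect u v w) (nrm u) (nrm v)); rewrite ?mulr_ge0 ?nrm_ge0//.
- by move=> z w' w''; rewrite /defect !linearPr scalerBr; zmod_identity.
- by move=> y'; apply: le_trans (defect_le _ _ _) _; apply: eq_le; ring.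
- by move=> c cc; apply: le_trans (step2 c u v cc) _; apply: eq_le; ring.
Qed.

End form.
End group_algebra_estimate.

Lemma constant_ge1152 {R : realType} : 1152 <= 288 * pi * (1 + Num.sqrt 2) :> R.
Proof.
have p2 : 2 <= pi :> R by exact: pi_ge2.
have s1 : 1 <= Num.sqrt 2 :> R by rewrite -[X in X <= _]sqrtr1 ler_wsqrtr// ler1n.
nra.
Qed.

Theorem group_algebra_strong_property_B {R : realType} (G : topologicalGroupType)
    (mu : {measure set (borel G) -> \bar R}) :
  hausdorff_space G -> locally_compact [set: G] -> is_left_haar_measure mu ->
  strong_property_B (@L1conv R G mu) (288 * pi * (1 + Num.sqrt 2)).
Proof.
move=> Gh Gl Hmu; have [D DD] := modular_exists Gh Gl Hmu.
have [B BE] := L1conv_bilinear Gh Gl Hmu DD.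
have c := @constant_ge1152 R; rewrite -BE; apply: strong_property_BP.
  by apply: lt_le_trans c; rewrite ltr0n.
move=> X phi M al phi_le M0 al0 phi_al u v w.
apply: le_trans (defect_estimate Gh Gl Hmu DD BE phi_le M0 al0 phi_al u v w) _.
by rewrite !ler_wpM2r ?mulr_ge0 ?nrm_ge0.
Qed.

Theorem theorem3p4 (R : realType) :
  (forall (A : completeNormedModType R[i]) (mul : {bilinear A -> A -> A})
      (star : A -> A),
    is_cstar_algebra mul star ->
    strong_property_B mul (288 * pi * (1 + Num.sqrt 2))) /\
  (forall (G : topologicalGroupType) (mu : {measure set (borel G) -> \bar R}),
    hausdorff_space G -> locally_compact [set: G] ->
    is_left_haar_measure mu ->
    strong_property_B (@L1conv R G mu) (288 * pi * (1 + Num.sqrt 2))).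
Proof.
split=> [A mul star H|G mu Gh Gl Hmu]; first exact: cstar_strong_property_B H.
exact: group_algebra_strong_property_B.
Qed.
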